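(* Consider the series A, B, C or D and a highest weight $[m_{-n},\dots,m_{-1}]$ (for series A: $[m_{-n},\dots,m_{-1},0]$). In the space of functions on the group with the action by right shifts, the irreducible representation generated by the highest vector $v_0$ of this weight consists exactly of the following functions. For series A, B, C, and for D with $m_{-1}\ge0$, they are functions of the determinants $a_X$ with $|X|\le n$. For D with $m_{-1}<0$, they are functions of the determinants $a_X$ with $|X|<n$ and $\bar a_X$ with $|X|=n$. (Below, ''determinants of size $n$'' means the $\bar a_X$ in this last case.) (i) If the highest weight is integer: the functions are the polynomials in these determinants such that in each monomial the sum of the exponents of the determinants of size $n-i+1$ equals $r_{-i}$ for $i=n,\dots,2$, and the sum of the exponents of the determinants of size $n$ equals $|m_{-1}|$. (ii) If the highest weight is half-integer (series B, D): the functions are those of the form $f=\sum_\alpha\sqrt{a_{\pm n,\dots,\pm2,\pm1}}\,f_\alpha$ (for B, and for D with $m_{-1}\ge 0$), respectively $f=\sum_\alpha\sqrt{\bar a_{\pm n,\dots,\pm2,\pm1}}\,f_\alpha$ (for D with $m_{-1}<0$). Here $\alpha$ denotes a choice of signs in the indices $\pm n,\dots,\pm1$: arbitrary for B; with the number of minus signs of the same parity as $n$ for D with $m_{-1}\ge0$; with the number of minus signs of the same parity as $n-1$ for D with $m_{-1}<0$. All $f_\alpha$ are polynomials in the determinants in which the sum of exponents of determinants of size $n-i+1$ equals $r_{-i}$ for $i=n,\dots,2$, and the sum of exponents of determinants of size $n$ equals $|m_{-1}|-\tfrac12$.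
   Context: The groups are as follows. Series A: $GL_{n+1}$, with coordinates indexed by $-n,\dots,-1,1$. Series B: $SO_{2n+1}$, indices $-n,\dots,-1,0,1,\dots,n$. Series C: $Sp_{2n}$, and series D: $SO_{2n}$, both with indices $-n,\dots,-1,1,\dots,n$. The orthogonal and symplectic groups preserve the form with matrix $\Omega$, where $\omega_{i,-i}=1$ for all $i$ (B, D), or $\omega_{i,-i}=1$ for $i<0$ and $-1$ for $i>0$ (C), all other entries being zero. In the half-integer case functions are taken on the corresponding group $Spin$. The group acts by right shifts $(Xf)(g)=f(gX)$. The Lie algebra is spanned by $F_{i,j}=E_{i,j}-E_{-j,-i}$ (B, D), $F_{i,j}=E_{i,j}-\mathrm{sign}(i)\mathrm{sign}(j)E_{-j,-i}$ (C), or $E_{i,j}$ (A); positive roots correspond to $i<j$ and the Cartan subalgebra to $i=j$. Let $a_i^j$ be the matrix-element function (row $j$, column $i$). For $X=\{i_1<\dots<i_k\}$, $a_X=a_{i_1,\dots,i_k}$ is the minor on the first $k$ rows and columns $X$. For series D and $|X|=n$, $\bar a_X$ is the minor on rows $-n,\dots,-2,1$ and columns $X$. The highest vector is $v_0=\prod_{k=2}^{n}(a_{-n,\dots,-k})^{m_{-k}-m_{-k+1}}(a_{-n,\dots,-1})^{m_{-1}}$, except for D with $m_{-1}<0$, where $v_0=\prod_{k=3}^{n}(a_{-n,\dots,-k})^{m_{-k}-m_{-k+1}}(a_{-n,\dots,-2})^{m_{-2}-|m_{-1}|}(\bar a_{-n,\dots,-2,1})^{|m_{-1}|}$. The exponents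 are $r_{-i}=m_{-i}-m_{-i+1}$ for $i=n,\dots,3$, and $r_{-2}=m_{-2}-|m_{-1}|$ (so $r_{-2}=m_{-2}-m_{-1}$ for A, B, C). *)

(* Defs.v *)
From HB Require Import structures.
From mathcomp Require Import boolp classical_sets reals complex.
From mathcomp Require Import all_boot all_order all_algebra.

Set Implicit Arguments.
Unset Strict Implicit.
Unset Printing Implicit Defensive.
Import Order.TTheory GRing.Theory Num.Theory.

Local Open Scope ring_scope.

Section RightShift.
Variables (G : groupType) (C : fieldType).
Implicit Types (f h : G -> C) (V U : set (G -> C)).

Definition right_shift (X : G) f : G -> C := fun g => f (g * X)%g.

Definition subrep V : Prop :=
  [/\ V (fun=> 0),
      forall (c : C) f h, V f -> V h -> V (fun g => c * f g + h g)
    & forall X f, V f -> V (right_shift X f)].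

Definition generated (v : G -> C) : set (G -> C) :=
  fun f => forall V, subrep V -> V v -> V f.

Definition irreducible V : Prop :=
  [/\ subrep V, exists2 f, V f & exists g, f g != 0
    & forall U, subrep U -> (U `<=` V)%classic ->
        (forall f g, U f -> f g = 0) \/ U = V].

End RightShift.

Inductive series := serA | serB | serC | serD.

Definition dim (s : series) (n : nat) : nat :=
  match s with serA => n.+1 | serB => n.*2.+1 | serC | serD => n.*2 end.

(* Rows and columns are numbered by 'I_(dim s n); [label s n p] is the
   coordinate name (-n, ..., -1, (0,) 1, ...) of the position p, so that the
   order of positions is the order of names. *)
Definition label (s : series) (n p : nat) : int :=
  if (p < n)%N then p%:Z - n%:Z
  else if s is serB then p%:Z - n%:Z else p.+1%:Z - n%:Z.

Section Groups.
Variable C : fieldType.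

(* Only meaningful for the series B, C and D. *)
Definition Omega (s : series) (n : nat) : 'M[C]_(dim s n) :=
  \matrix_(p, q)
    if label s n q == - label s n p then
      (if s is serC then if 0 < label s n p then -1 else 1 else 1)
    else 0.

Definition isometry N (Om g : 'M[C]_N) : bool := g^T *m Om *m g == Om.

Definition in_group (s : series) (n : nat) (g : 'M[C]_(dim s n)) : bool :=
  match s with
  | serA => g \in unitmx
  | serC => (g \in unitmx) && isometry (Omega s n) g
  | serB | serD => (\det g == 1) && isometry (Omega s n) g
  end.

Definition classical_group (s : series) (n : nat) : predArgType :=
  {g : 'M[C]_(dim s n) | in_group g}.

Lemma isometry1 N (Om : 'M[C]_N) : isometry Om 1%:M.
Proof. by rewrite /isometry trmx1 mul1mx mulmx1. Qed.

Lemma isometryM N (Om g h : 'M[C]_N) :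
  isometry Om g -> isometry Om h -> isometry Om (g *m h).
Proof.
move=> /eqP eg /eqP eh; rewrite /isometry trmx_mul.
by rewrite -!mulmxA (mulmxA Om) (mulmxA g^T) (mulmxA g^T) eg mulmxA eh.
Qed.

Lemma isometryV N (Om g : 'M[C]_N) :
  g \in unitmx -> isometry Om g -> isometry Om (invmx g).
Proof.
move=> ug /eqP eg; rewrite /isometry -{1}eg trmx_inv -!mulmxA.
by rewrite mulmxV // mulmx1 mulmxA mulVmx ?unitmx_tr // mul1mx.
Qed.

Lemma det1_unitmx N (g : 'M[C]_N) : \det g = 1 -> g \in unitmx.
Proof. by move=> dg; rewrite unitmxE dg unitr1. Qed.

Section ClassicalGroup.
Variables (s : series) (n : nat).
Implicit Types g h : 'M[C]_(dim s n).

Lemma in_group_unit g : in_group g -> g \in unitmx.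
Proof.
by rewrite /in_group; case: s g => // g /andP[] // /eqP /det1_unitmx.
Qed.

Lemma in_group1 : in_group (1%:M : 'M[C]_(dim s n)).
Proof.
by rewrite /in_group; case: s => //; rewrite ?unitmx1 ?det1 ?eqxx // isometry1.
Qed.

Lemma in_groupM g h : in_group g -> in_group h -> in_group (g *m h).
Proof.
rewrite /in_group; case: s g h => /= g h.
- by move=> ug uh; rewrite unitmx_mul ug.
- move=> /andP[/eqP dg ig] /andP[/eqP dh ih].
  by rewrite det_mulmx dg dh mul1r eqxx isometryM.
- move=> /andP[ug ig] /andP[uh ih].
  by rewrite unitmx_mul ug uh isometryM.
- move=> /andP[/eqP dg ig] /andP[/eqP dh ih].
  by rewrite det_mulmx dg dh mul1r eqxx isometryM.
Qed.

Lemma in_groupV g : in_group g -> in_group (invmx g).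
Proof.
move=> gG; have ug := in_group_unit gG; move: gG ug.
rewrite /in_group; case: s g => /= g.
- by move=> _ ug; rewrite unitmx_inv.
- by move=> /andP[/eqP dg ig] ug; rewrite det_inv dg invr1 eqxx isometryV.
- by move=> /andP[_ ig] ug; rewrite unitmx_inv ug isometryV.
- by move=> /andP[/eqP dg ig] ug; rewrite det_inv dg invr1 eqxx isometryV.
Qed.

Let G := classical_group s n.
Definition cg_one : G := Sub (1%:M : 'M_(dim s n)) in_group1.
Definition cg_mul (x y : G) : G := Sub (val x *m val y) (in_groupM (valP x) (valP y)).
Definition cg_inv (x : G) : G := Sub (invmx (val x)) (in_groupV (valP x)).

Lemma cg_mulA : associative cg_mul.
Proof. by move=> x y z; apply: val_inj; rewrite /= mulmxA. Qed.
Lemma cg_mul1 : left_id cg_one cg_mul.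
Proof. by move=> x; apply: val_inj; rewrite /= mul1mx. Qed.
Lemma cg_1mul : right_id cg_one cg_mul.
Proof. by move=> x; apply: val_inj; rewrite /= mulmx1. Qed.
Lemma cg_mulV : left_inverse cg_one cg_inv cg_mul.
Proof.
by move=> x; apply: val_inj; rewrite /= mulVmx // in_group_unit // (valP x).
Qed.
Lemma cg_Vmul : right_inverse cg_one cg_inv cg_mul.
Proof.
by move=> x; apply: val_inj; rewrite /= mulmxV // in_group_unit // (valP x).
Qed.

HB.instance Definition _ := Choice.on (classical_group s n).
HB.instance Definition _ := isGroup.Build (classical_group s n)
  cg_mulA cg_mul1 cg_1mul cg_mulV cg_Vmul.

End ClassicalGroup.

Section Spin.
Variables (N : nat) (Om : 'M[C]_N).
Local Notation op := 'M[C]_(#|{set 'I_N}|).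
Implicit Types (v w : 'cV[C]_N) (vs : seq 'cV[C]_N).

(* Operators on the exterior algebra of C^N, written in the basis e_S indexed
   by the subsets S of 'I_N: [wedge i] is e_i /\ _, and its transpose is the
   contraction with the i-th coordinate form. *)
Definition wedge (i : 'I_N) : op :=
  \matrix_(a, b)
    let S : {set 'I_N} := enum_val a in let T : {set 'I_N} := enum_val b in
    if (i \notin T) && (S == i |: T)
    then (-1) ^+ #|[set j in T | (j < i)%N]| else 0.

(* Chevalley's model of the Clifford algebra of the quadratic form
   v |-> v^T Om v: it is the algebra of operators generated by the
   [clifford v], and x |-> x e_set0 is a linear isomorphism from it onto the
   exterior algebra. *)
Definition clifford v : op :=
  \sum_i v i 0 *: (wedge i + \sum_j Om i j *: (wedge j)^T).

Definition qform v : C := (v^T *m Om *m v) 0 0.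

Definition clifford_prod vs : op :=
  foldr (fun v x => clifford v *m x) 1%:M vs.

(* The group Spin consists of the products x of an even number of unit vectors
   in the Clifford algebra; the pair (x, g) records together with x the
   isometry g it covers, which is determined by x v x^-1 = g v. *)
Definition in_spin (x : op * 'M[C]_N) : Prop :=
  [/\ (\det x.2 = 1) /\ isometry Om x.2,
      exists vs, [/\ ~~ odd (size vs),
                     forall v, v \in vs -> qform v = 1
                   & x.1 = clifford_prod vs]
    & forall v, x.1 *m clifford v = clifford (x.2 *m v) *m x.1].

Definition spin_group : predArgType := {x : op * 'M[C]_N | `[< in_spin x >]}.

Definition covering (x : spin_group) : 'M[C]_N := (val x).2.

Inductive regular : (spin_group -> C) -> Prop :=
| regular_cst c : regular (fun=> c)
| regular_coord a b : regular (fun x => (val x).1 a b)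
| regularD f h : regular f -> regular h -> regular (fun x => f x + h x)
| regularM f h : regular f -> regular h -> regular (fun x => f x * h x).

(* As Spin is an irreducible variety, a regular square root is unique up to a
   global sign. *)
Definition is_sqrt (a t : spin_group -> C) : Prop :=
  regular t /\ forall x, t x ^+ 2 = a x.

Implicit Types S T U : {set 'I_N}.

Let sg (i : 'I_N) (T : {set 'I_N}) : C := (-1) ^+ #|[set j in T | (j < i)%N]|.

Lemma sgU (i j : 'I_N) T : j \notin T ->
  sg i (j |: T) = (if (j < i)%N then -1 else 1) * sg i T.
Proof.
move=> jT; rewrite /sg; case: ifP => ji.
  rewrite -exprS; congr (_ ^+ _).
  have -> : [set k in j |: T | (k < i)%N] = j |: [set k in T | (k < i)%N].
    by apply/setP=> k; rewrite !inE; case: eqP => [->|]; rewrite ?ji.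
  by rewrite cardsU1 !inE (negbTE jT).
rewrite mul1r; congr (_ ^+ _); apply: eq_card => k; rewrite !inE.
by case: eqP => [->|]; rewrite ?ji ?(negbTE jT).
Qed.

Lemma sg2 i T : sg i T * sg i T = 1.
Proof. by rewrite /sg -exprMn mulrNN mulr1 expr1n. Qed.

Lemma sum_set (F : {set 'I_N} -> C) :
  \sum_(c < #|{set 'I_N}|) F (enum_val c) = \sum_(U : {set 'I_N}) F U.
Proof.
rewrite (reindex (@enum_val _ (mem {set 'I_N}))) /=; last first.
  by apply: onW_bij; exact: enum_val_bij.
by [].
Qed.

Let W i (S T : {set 'I_N}) : C :=
  if (i \notin T) && (S == i |: T) then sg i T else 0.

Lemma wedgeE i a b : wedge i a b = W i (enum_val a) (enum_val b).
Proof. by rewrite mxE. Qed.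

Lemma sumW1 (F : {set 'I_N} -> C) j T  :
  \sum_U F U * W j U T = if j \notin T then F (j |: T) * sg j T else 0.
Proof.
case: ifP => jT; last first.
  by rewrite big1 // => U _; rewrite /W jT /= mulr0.
rewrite (bigD1 (j |: T)) //= /W jT eqxx /= big1 ?addr0 // => U /negbTE ->.
by rewrite mulr0.
Qed.

Lemma sumW2 (F : {set 'I_N} -> C) j T  :
  \sum_U F U * W j T U = if j \in T then F (T :\ j) * sg j (T :\ j) else 0.
Proof.
case: ifP => jT; last first.
  rewrite big1 // => U _; rewrite /W; case: ifP; rewrite ?mulr0 //.
  by case/andP=> _ /eqP eT; rewrite eT setU11 in jT.
rewrite (bigD1 (T :\ j)) //= /W !inE eqxx /= setD1K // eqxx /=.
rewrite big1 ?addr0 // => U neU; case: ifP; rewrite ?mulr0 //.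
by case/andP=> jU /eqP eT; rewrite eT setU1K // eqxx in neU.
Qed.

Lemma sgN (i j : 'I_N) : i != j ->
  (if (i < j)%N then -1 else 1 : C) = - (if (j < i)%N then -1 else 1).
Proof.
by move=> ij; case: ltngtP => [_|_|/ord_inj e]; rewrite ?opprK //; rewrite e eqxx in ij.
Qed.

Lemma wedge_anti i j : wedge i *m wedge j + wedge j *m wedge i = 0.
Proof.
apply/matrixP=> a b; rewrite !mxE.
under eq_bigr => c _ do rewrite !wedgeE.
under [X in _ + X]eq_bigr => c _ do rewrite !wedgeE.
rewrite (sum_set (fun U => W i (enum_val a) U * W j U (enum_val b))).
rewrite (sum_set (fun U => W j (enum_val a) U * W i U (enum_val b))).
rewrite !sumW1; move: (enum_val a) (enum_val b) => S T.
rewrite /W !inE; have [->|ij] := eqVneq i j.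
  by rewrite /= mul0r; case: ifP; rewrite addr0.
rewrite /= setUCA; have [iT|iT] := boolP (i \in T); have [jT|jT] := boolP (j \in T) => //=;
  rewrite ?mul0r ?addr0 //.
case: eqP => _; rewrite ?mul0r ?addr0 //.
by rewrite !sgU // (sgN ij) !mulNr mulrAC subrr.
Qed.

Lemma wedge_tr i j :
  wedge i *m (wedge j)^T + (wedge j)^T *m wedge i = (i == j)%:R%:M.
Proof.
apply/matrixP=> a b; rewrite !mxE.
under eq_bigr => c _ do rewrite [_^T _ _]mxE !wedgeE.
under [X in _ + X]eq_bigr => c _ do rewrite [_^T _ _]mxE !wedgeE.
rewrite (sum_set (fun U => W i (enum_val a) U * W j (enum_val b) U)).
rewrite (sum_set (fun U => W j U (enum_val a) * W i U (enum_val b))).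
rewrite sumW1 sumW2 -(inj_eq enum_val_inj); move: (enum_val a) (enum_val b) => S T.
rewrite /W !inE; have [<-|ij] := eqVneq i j.
  rewrite /=; have [iT|iT] := boolP (i \in T) => /=.
    by rewrite setD1K //; case: eqP => _; rewrite ?sg2 ?mul0r addr0.
  rewrite add0r; have [->|neST] := eqVneq S T; first by rewrite iT eqxx sg2.
  case: ifP => [/andP[iS /eqP e]|]; last by rewrite mul0r.
  by case/eqP: neST; rewrite -(setU1K iS) -(setU1K iT) e.
rewrite /= mul0rn.
have [iT|iT] := boolP (i \in T); have [jT|jT] := boolP (j \in T) => //=;
  rewrite ?mul0r ?addr0 //.
  2: case: ifP => [/andP[_ /eqP e]|_]; last by rewrite mul0r addr0.
  2: by have := setU11 j S; rewrite -e !inE (negbTE jT) eq_sym (negbTE ij).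
have jS' : (i |: T == j |: S) && (j \notin S) = (S == i |: T :\ j).
  apply/andP/eqP=> [[/eqP e jS]|->].
    rewrite -(setU1K jS) -e; apply/setP=> k; rewrite !inE.
    by case: (eqVneq k i) => [->|//]; rewrite ij.
  rewrite !inE eqxx (eq_sym j) (negbTE ij) /=; split=> //.
  apply/eqP/setP=> k; rewrite !inE.
  by case: (eqVneq k j) => [->|//]; rewrite jT !orbT.
rewrite andbC jS'; case: eqP => [eS|_]; last by rewrite !mul0r addr0.
have e : sg i T = (if (j < i)%N then -1 else 1) * sg i (T :\ j).
  by rewrite -{1}(setD1K jT) sgU // !inE eqxx.
have e2 : sg j S = (if (i < j)%N then -1 else 1) * sg j (T :\ j).
  by rewrite eS sgU // !inE negb_and iT orbT.
by rewrite e e2 (sgN ij) !mulNr mulrACA; case: ifP => _;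
  rewrite ?mulrNN !mulr1 ?mul1r [sg j _ * _]mulrC subrr.
Qed.

Lemma clifford_bilin (x y : 'cV[C]_N) (P Q : 'I_N -> op) :
  (\sum_i x i 0 *: P i) *m (\sum_j y j 0 *: Q j) =
  \sum_i \sum_j (x i 0 * y j 0) *: (P i *m Q j).
Proof.
rewrite mulmx_suml; apply: eq_bigr => i _; rewrite mulmx_sumr.
by apply: eq_bigr => j _; rewrite -scalemxAl -scalemxAr scalerA.
Qed.

Lemma wedge_sqr0 (x : 'cV[C]_N) :
  (\sum_i x i 0 *: wedge i) *m (\sum_j x j 0 *: wedge j) = 0.
Proof.
rewrite clifford_bilin; pose M i j := (x i 0 * x j 0) *: (wedge i *m wedge j).
have Mii i : M i i = 0.
  rewrite /M; suff -> : wedge i *m wedge i = 0 by rewrite scaler0.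
  apply/matrixP=> a b; rewrite !mxE.
  under eq_bigr => c _ do rewrite !wedgeE.
  rewrite (sum_set (fun U => W i (enum_val a) U * W i U (enum_val b))) sumW1.
  by rewrite /W setU11 /= mul0r; case: ifP.
have Mij i j : M i j = - M j i.
  apply/eqP; rewrite -addr_eq0 /M [x j 0 * _]mulrC -scalerDr wedge_anti.
  by rewrite scaler0.
transitivity (\sum_(i : 'I_N) (\sum_(j : 'I_N | (j < i)%N) M i j +
                           \sum_(j : 'I_N | (i < j)%N) M i j)).
  apply: eq_bigr => i _; rewrite (bigID (fun j : 'I_N => (j < i)%N)) /=.
  congr (_ + _); rewrite (bigD1 i) /= ?ltnn // -/(M i i) Mii add0r.
  by apply: eq_bigl => j; rewrite -leqNgt ltn_neqAle andbC eq_sym.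
rewrite big_split /= [X in _ + X](exchange_big_dep xpredT) //= -big_split /=.
rewrite big1 // => i _; rewrite -big_split big1 // => j _ /=.
by rewrite [M i j]Mij addNr.
Qed.

Lemma clifford_sqr v : clifford v *m clifford v = (qform v)%:M.
Proof.
pose A := \sum_i v i 0 *: wedge i.
pose u := Om^T *m v.
pose B := \sum_j u j 0 *: (wedge j)^T.
have -> : clifford v = A + B.
  rewrite /clifford; under eq_bigr do rewrite scalerDr.
  rewrite big_split /=; congr (_ + _); rewrite /B.
  under eq_bigr do rewrite scaler_sumr.
  rewrite exchange_big /=; apply: eq_bigr => j _; rewrite mxE scaler_suml.
  by apply: eq_bigr => i _; rewrite mxE scalerA mulrC.
have BB : B *m B = 0.
  rewrite -[RHS]trmx0 -(wedge_sqr0 u) trmx_mul; congr (_ *m _);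
    by rewrite linear_sum /=; apply: eq_bigr => j _; rewrite linearZ.
have AB : A *m B + B *m A = (qform v)%:M.
  rewrite !clifford_bilin [X in _ + X]exchange_big -big_split /=.
  have -> : qform v = \sum_i v i 0 * u i 0.
    rewrite /qform -[v^T *m Om]trmxK trmx_mul trmxK mxE.
    by apply: eq_bigr => i _; rewrite mxE mulrC.
  rewrite raddf_sum /=; apply: eq_bigr => i _; rewrite -big_split /=.
  rewrite (bigD1 i) //= [u i 0 * _]mulrC -scalerDr wedge_tr eqxx scalemx1.
  rewrite big1 ?addr0 // => j ji.
  rewrite [u j 0 * _]mulrC -scalerDr wedge_tr eq_sym (negbTE ji).
  by rewrite raddf0 scaler0.
by rewrite mulmxDl !mulmxDr wedge_sqr0 BB add0r addr0 AB.
Qed.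

Lemma clifford_prod_cat vs ws :
  clifford_prod (vs ++ ws) = clifford_prod vs *m clifford_prod ws.
Proof. by elim: vs => [|v vs IH] /=; rewrite ?mul1mx // IH mulmxA. Qed.

Lemma clifford_prod_rev vs : (forall v, v \in vs -> qform v = 1) ->
  clifford_prod vs *m clifford_prod (rev vs) = 1%:M.
Proof.
elim: vs => [|v vs IH] uvs /=; first by rewrite mul1mx.
rewrite rev_cons -cats1 clifford_prod_cat /= mulmx1 -mulmxA (mulmxA _ _ (clifford v)).
rewrite IH => [|w wvs]; last by apply: uvs; rewrite inE wvs orbT.
by rewrite mul1mx clifford_sqr uvs // mem_head.
Qed.

Lemma in_spin_unit x : in_spin x -> (x.1 \in unitmx) && (x.2 \in unitmx).
Proof.
case=> [[/det1_unitmx -> _] [vs [_ uvs ->]] _]; rewrite andbT.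
by have [] := mulmx1_unit (clifford_prod_rev uvs).
Qed.

Lemma in_spin1 : in_spin (1%:M, 1%:M).
Proof.
split=> [|| v] /=; first by rewrite det1 isometry1.
- by exists [::].
- by rewrite !mul1mx mulmx1.
Qed.

Lemma in_spinM x y : in_spin x -> in_spin y ->
  in_spin (x.1 *m y.1, x.2 *m y.2).
Proof.
move=> [[dx ix] [vs [evs uvs xE]] cx] [[dy iy] [ws [ews uws yE]] cy].
split=> [|| v] /=.
- by rewrite det_mulmx dx dy mul1r isometryM.
- exists (vs ++ ws); split; last by rewrite clifford_prod_cat xE yE.
  + by rewrite size_cat oddD (negbTE evs) (negbTE ews).
  + by move=> v; rewrite mem_cat => /orP[/uvs|/uws].
- by rewrite -mulmxA cy mulmxA cx -!mulmxA.
Qed.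

Lemma in_spinV x : in_spin x -> in_spin (invmx x.1, invmx x.2).
Proof.
move=> xS; have /andP[u1 u2] := in_spin_unit xS.
case: xS => [[dx ix] [vs [evs uvs xE]] cx]; split=> [|| v] /=.
- by rewrite det_inv dx invr1 isometryV.
- exists (rev vs); split; [by rewrite size_rev | |].
    by move=> v; rewrite mem_rev => /uvs.
  apply: (can_inj (mulKmx u1)); rewrite mulmxV // xE.
  by rewrite clifford_prod_rev.
- apply: (can_inj (mulKmx u1)); rewrite mulKVmx // mulmxA cx.
  by rewrite mulKVmx // mulmxK.
Qed.

Lemma spinP (x : spin_group) : in_spin (val x).
Proof. exact/asboolP/(valP x). Qed.

Definition spin_one : spin_group :=
  Sub ((1%:M, 1%:M) : op * 'M[C]_N) (introT (asboolP _) in_spin1).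
Definition spin_mul (x y : spin_group) : spin_group :=
  Sub ((val x).1 *m (val y).1, (val x).2 *m (val y).2)
    (introT (asboolP _) (in_spinM (spinP x) (spinP y))).
Definition spin_inv (x : spin_group) : spin_group :=
  Sub (invmx (val x).1, invmx (val x).2)
    (introT (asboolP _) (in_spinV (spinP x))).

Lemma spin_mulA : associative spin_mul.
Proof. by move=> x y z; apply: val_inj; rewrite /= !mulmxA. Qed.
Lemma spin_mul1 : left_id spin_one spin_mul.
Proof. by case=> [[x g] xP]; apply: val_inj; rewrite /= !mul1mx. Qed.
Lemma spin_1mul : right_id spin_one spin_mul.
Proof. by case=> [[x g] xP]; apply: val_inj; rewrite /= !mulmx1. Qed.
Lemma spin_mulV : left_inverse spin_one spin_inv spin_mul.
Proof.
move=> x; apply: val_inj; have /andP[u1 u2] := in_spin_unit (spinP x).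
by rewrite /= !mulVmx.
Qed.
Lemma spin_Vmul : right_inverse spin_one spin_inv spin_mul.
Proof.
move=> x; apply: val_inj; have /andP[u1 u2] := in_spin_unit (spinP x).
by rewrite /= !mulmxV.
Qed.

HB.instance Definition _ := Choice.on spin_group.
HB.instance Definition _ := isGroup.Build spin_group
  spin_mulA spin_mul1 spin_1mul spin_mulV spin_Vmul.

End Spin.
End Groups.

(* A highest weight [m_{-n}, ..., m_{-1}] is given by m : nat -> rat, where
   m i stands for m_{-i}, 1 <= i <= n. *)
Section Weights.
Variables (s : series) (n : nat) (m : nat -> rat).

Definition dominant : Prop :=
  [/\ forall i, (2 < i <= n)%N -> m i.-1 <= m i,
      (1 < n)%N -> `|m 1%N| <= m 2
    & s <> serD -> 0 <= m 1%N].

Definition integer_weight : Prop :=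
  forall i, (0 < i <= n)%N -> m i \is a Num.int.

Definition half_integer_weight : Prop :=
  forall i, (0 < i <= n)%N -> m i - 2^-1 \is a Num.int.

(* wt_exp i stands for r_{-i}, 2 <= i <= n. *)
Definition wt_exp (i : nat) : rat :=
  if i == 2 then m 2 - `|m 1%N| else m i - m i.-1.

(* the series is D and m_{-1} < 0 *)
Definition neg_weight : bool := if s is serD then m 1%N < 0 else false.

End Weights.

Section Determinants.
Variables (C : fieldType) (s : series) (n : nat).
Local Notation N := (dim s n).
Implicit Types (X Y : {set 'I_N}) (g : 'M[C]_N).

(* The minor on rows Y and columns X, both in increasing order, for
   #|Y| = #|X|; the default value of [nth] is then irrelevant. *)
Definition minor Y X g : C :=
  \det (\matrix_(i < #|X|, j < #|X|)
          g (nth (enum_val j) (enum Y) i) (enum_val j)).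

Definition first_rows (k : nat) : {set 'I_N} := [set p : 'I_N | (p < k)%N].

(* the coordinates -n, ..., -2, 1 *)
Definition bar_rows : {set 'I_N} :=
  [set p : 'I_N | (label s n p <= -2) || (label s n p == 1)].

(* The determinant a_X, or \bar a_X if b holds and X has size n. *)
Definition pdet (b : bool) X g : C :=
  minor (if b && (#|X| == n) then bar_rows else first_rows #|X|) X g.

(* Exponents of the monomials in the determinants of size 1, ..., n. *)
Definition multiexp := {ffun {set 'I_N} -> nat}.

Definition monomial (b : bool) (e : multiexp) g : C :=
  \prod_(X : {set 'I_N} | (0 < #|X| <= n)%N) pdet b X g ^+ e X.

Definition degree (e : multiexp) (k : nat) : nat :=
  \sum_(X : {set 'I_N} | #|X| == k) e X.

(* [top] is the prescribed total exponent of the determinants of size n. *)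
Definition has_degrees (m : nat -> rat) (top : rat) (e : multiexp) : Prop :=
  (forall i, (2 <= i <= n)%N -> (degree e (n - i + 1))%:R = wt_exp m i) /\
  (degree e n)%:R = top.

(* Polynomials in the determinants with the prescribed degrees, as functions
   on a group G which is mapped to the matrices by rho. *)
Definition det_polynomial (G : Type) (rho : G -> 'M[C]_N)
    (m : nat -> rat) (top : rat) (f : G -> C) : Prop :=
  exists P : seq (C * multiexp),
    (forall t, t \in P -> has_degrees m top t.2) /\
    forall x, f x = \sum_(t <- P) t.1 * monomial (neg_weight s m) t.2 (rho x).

(* a_{-n, ..., -k} *)
Definition flag_det (k : nat) g : C :=
  pdet false [set p : 'I_N | label s n p <= - k%:Z] g.

(* The factor of v_0 made of the determinants of size less than n. *)
Definition highest_head (m : nat -> rat) g : C :=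
  \prod_(2 <= k < n.+1) flag_det k g ^+ Num.truncn (wt_exp m k).

(* A choice of signs of the indices n, ..., 1; [eps i] tells that the index
   i + 1 is taken with the minus sign. *)
Definition signs := {ffun 'I_n -> bool}.

Definition sign_set (eps : signs) : {set 'I_N} :=
  [set p : 'I_N | [exists i : 'I_n,
     label s n p == if eps i then - i.+1%:Z else i.+1%:Z]].

Definition minuses (eps : signs) : nat := #|[set i | eps i]|.

Definition allowed_signs (m : nat -> rat) (eps : signs) : bool :=
  match s with
  | serD => odd (minuses eps) == odd (if neg_weight s m then n.-1 else n)
  | _ => true
  end.

(* the indices -n, ..., -2, -1, or -n, ..., -2, 1 for D with m_{-1} < 0 *)
Definition top_signs (m : nat -> rat) : signs :=
  [ffun i : 'I_n => ~~ (neg_weight s m && (i == 0%N :> nat))].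

End Determinants.

Section Representations.
Variables (C : fieldType) (s : series) (n : nat) (m : nat -> rat).

Definition highest_vector (g : classical_group C s n) : C :=
  highest_head m (val g) *
  pdet (neg_weight s m) (sign_set s (top_signs s n m)) (val g)
    ^+ Num.truncn `|m 1%N|.

Definition integer_functions : set (classical_group C s n -> C) :=
  det_polynomial val m `|m 1%N|.

Local Notation Spin := (spin_group (Omega C s n)).
Implicit Types t : signs n -> Spin -> C.

Definition sqrt_family t : Prop :=
  forall eps, allowed_signs s m eps ->
    is_sqrt (fun x => pdet (neg_weight s m) (sign_set s eps) (covering x)) (t eps).

(* The half-integer power |m_{-1}| of a determinant is the power 2 |m_{-1}|
   of its square root. *)
Definition spin_highest_vector t (x : Spin) : C :=
  highest_head m (covering x) *
  t (top_signs s n m) x ^+ Num.truncn (2 * `|m 1%N|).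

Definition half_integer_functions t : set (Spin -> C) :=
  fun f => exists F : signs n -> Spin -> C,
    (forall eps, det_polynomial (@covering _ _ (Omega C s n)) m
                   (`|m 1%N| - 2^-1) (F eps)) /\
    forall x, f x = \sum_(eps | allowed_signs s m eps) t eps x * F eps x.

End Representations.

(* Main.v *)
(* Let M_i be the products of determinants with the prescribed degrees, times
   one of the square roots in the half-integer case, and let v_0 = M_{i0}. The
   group is stable under conjugate transposition, and by the Cauchy-Binet formula
   v_0 (g h^* ) is a non-zero multiple of the sum of the M_i(g) conj(M_i(h)). By
   this positive kernel the right shifts of v_0 span all the M_i. There is an
   element t of the torus for which the M_i are eigenvectors of the right shift
   and the eigenvalue of v_0 is simple, and M_i(1) = 0 unless i = i0. A subspace
   stable under right shifts and containing f != 0 contains a shift of f not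
   vanishing at 1, hence, by applying a polynomial in the shift by t, also v_0.

   For Spin, the square root of the top determinant at x is the vacuum
   expectation value tau(x), and the other square roots are the tau(x w) for
   Weyl group elements w; the decomposition of 1 into the conjugates of the vacuum
   projector under the w gives tau(x y^* ) = sum_w tau(x w) conj(tau(y w)). Other
   choices of the square roots differ by signs, since Spin is irreducible. *)
From HB Require Import structures.
From mathcomp Require Import boolp classical_sets perm ring lra zify.
Require Import Defs.
From mathcomp Require Import reals complex.
From mathcomp Require Import all_boot all_order all_algebra.
Import Order.TTheory GRing.Theory Num.Theory.
Local Open Scope ring_scope.

Set Implicit Arguments.
Unset Strict Implicit.
Unset Printing Implicit Defensive.

(** * Representations with a reproducing kernel *)

(** The M_i are linearly dependent: minors satisfy the Plücker relations, so a function does not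
    determine its coefficients. Spanning is therefore proved in the Hermitian space of coefficient
    vectors, where positivity of the kernel makes the dependence harmless.

    The obstacle for Spin is that the exterior algebra is a sum of several spinor modules, so the
    vacuum is not a line in it. What survives is that the compression pi x pi of an even element x
    by the vacuum projector pi is a scalar multiple of pi, with scalar tau(x). This splits tau of a
    product through pi into two factors, for the kernel as well as for tau(x)^2 as a minor. It
    breaks down for odd elements in series B, since e_0 commutes with pi; there the Weyl
    representatives are made even by a factor e_0. In series D odd elements compress to 0, which is
    the source of the parity condition on the signs. *)

Section Orthogonal.
Variable C : numClosedFieldType.

Definition adjmx k l (A : 'M[C]_(k, l)) : 'M[C]_(l, k) := (map_mx Num.conj A)^T.

Lemma adjmxM k l p (A : 'M_(k, l)) (B : 'M_(l, p)) :
  adjmx (A *m B) = adjmx B *m adjmx A.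
Proof. by rewrite /adjmx map_mxM trmx_mul. Qed.

Lemma adjmxK k l (A : 'M_(k, l)) : adjmx (adjmx A) = A.
Proof. by apply/matrixP=> i j; rewrite !mxE conjCK. Qed.

Lemma adjmx_eq0 k (u : 'rV_k) : u *m adjmx u = 0 -> u = 0.
Proof.
move=> /matrixP/(_ 0 0); rewrite !mxE => s0; apply/rowP=> j; rewrite mxE.
have {}s0 : \sum_i `|u 0 i| ^+ 2 = 0.
  by rewrite -[RHS]s0; apply: eq_bigr => i _; rewrite !mxE normCK.
have /eqP := s0; rewrite psumr_eq0 => [|i _]; last exact: exprn_ge0.
by move=> /allP/(_ j); rewrite mem_index_enum sqrf_eq0 normr_eq0 => /(_ isT)/eqP.
Qed.

(** [S] comes without a basis. A family in [S] of maximal rank, which exists because ranks are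
    bounded by [d], must span it; the Gram matrix of a row basis is invertible by positivity, and
    the usual formula gives the projection. *)
Lemma orthogonal_projection d (S : set 'rV[C]_d) :
  S 0 -> (forall a x y, S x -> S y -> S (a *: x + y)) ->
  forall x, exists2 y, S y & forall z, S z -> (x - y) *m adjmx z = 0.
Proof.
move=> S0 SD x.
pose P r := `[< exists k (A : 'M_(k, d)), (forall i, S (row i A)) /\ \rank A = r >].
have exP : exists r, P r.
  exists 0%N; apply/asboolP; exists 0%N, 0; split; last by rewrite mxrank0.
  by case.
have ubP r : P r -> (r <= d)%N.
  by move=> /asboolP[k [A [_ <-]]]; exact: rank_leq_col.
case: (ex_maxnP exP ubP) => r /asboolP[k [A [SA rA]]] rmax.
have Ssum l (B : 'M_(l, d)) (u : 'rV_l) : (forall i, S (row i B)) -> S (u *m B).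
  move=> SB; rewrite mulmx_sum_row; elim/big_rec: _ => // i y _ Sy; exact: SD.
have subA z : S z -> (z <= A)%MS.
  move=> Sz; have : P (\rank (col_mx z A)).
    apply/asboolP; exists (1 + k)%N, (col_mx z A); split=> // i.
    by case: (split_ordP i) => j ->; rewrite ?rowKu ?rowKd ?ord1 ?row_id.
  move=> /rmax; rewrite -rA => le_rank.
  have sAc : (A <= col_mx z A)%MS by rewrite -addsmxE addsmxSr.
  have eqA : (A == col_mx z A)%MS by rewrite -(mxrank_leqif_eq sAc) eqn_leq mxrankS.
  by rewrite (eqmxP eqA) -addsmxE addsmxSl.
pose B := row_base A.
have freeH : B *m adjmx B \in unitmx.
  rewrite -row_free_unit; apply: inj_row_free => v vH.
  apply: (row_free_inj (row_base_free A)); rewrite -/B mul0mx; apply: adjmx_eq0.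
  by rewrite adjmxM mulmxA -(mulmxA v) vH mul0mx.
have SB i : S (row i B).
  have /submxP[u ->] : (row i B <= A)%MS.
    by rewrite (submx_trans (row_sub _ _)) ?eq_row_base.
  exact: Ssum.
exists (x *m adjmx B *m invmx (B *m adjmx B) *m B); first exact: Ssum.
move=> z /subA; rewrite -(eq_row_base A) => /submxP[u ->].
have e0 : (x - x *m adjmx B *m invmx (B *m adjmx B) *m B) *m adjmx B = 0.
  by rewrite mulmxBl -(mulmxA _ B) mulmxKV // subrr.
by rewrite -/B (adjmxM u B) mulmxA e0 mul0mx.
Qed.

End Orthogonal.

Section Reproducing.
Variables (C : numClosedFieldType) (G : groupType) (I : finType).
Variables (M : I -> G -> C) (i0 : I) (star : G -> G) (c : C).
Hypothesis c_neq0 : c != 0.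
Hypothesis starK : involutive star.
Hypothesis kernel :
  forall g h, M i0 (g * star h)%g = c * \sum_i M i g * Num.conj (M i h).

Definition lin_span : set (G -> C) :=
  fun f => exists x : I -> C, forall g, f g = \sum_i x i * M i g.

Lemma generated_subrep (v : G -> C) : subrep (generated v).
Proof.
split=> [V [] //|a f h gf gh V rV Vv|X f gf V rV Vv].
  by have [_ VD _] := rV; apply: VD; [apply: gf|apply: gh].
by have [_ _ VR] := rV; apply: VR; apply: gf.
Qed.

Lemma subrep_sum (V : set (G -> C)) (x : I -> C) (F : I -> G -> C) :
  subrep V -> (forall i, V (F i)) -> V (fun g => \sum_i x i * F i g).
Proof.
move=> [V0 VD _] VF; elim: (index_enum I) => [|i s IH].
  by rewrite (_ : (fun _ => _) = fun=> 0) //; apply/funext=> g; rewrite big_nil.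
rewrite (_ : (fun _ => _) = fun g => x i * F i g + \sum_(j <- s) x j * F j g).
  exact: VD.
by apply/funext=> g; rewrite big_cons.
Qed.

(* The coefficient vectors of the shifts of M i0 are the conjugates of the
   vectors (M j h)_j, so a combination of the M j whose coefficients are
   orthogonal to all of them is the zero function. *)
Lemma span_sub_generated i : generated (M i0) (M i).
Proof.
have rV := generated_subrep (M i0); have [V0 VD VR] := rV.
pose comb (x : 'rV[C]_#|I|) := fun g => \sum_j x 0 (enum_rank j) * M j g.
pose S : set 'rV[C]_#|I| := fun x => generated (M i0) (comb x).
have S0 : S 0.
  rewrite /S (_ : comb 0 = fun=> 0) //; apply/funext=> g.
  by rewrite /comb big1 // => j _; rewrite mxE mul0r.
have SD a x y : S x -> S y -> S (a *: x + y).
  move=> Sx Sy; rewrite /S (_ : comb _ = fun g => a * comb x g + comb y g).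
    exact: VD.
  apply/funext=> g; rewrite /comb mulr_sumr -big_split /=.
  by apply: eq_bigr => j _; rewrite !mxE mulrDl mulrA.
have [y Sy orth] := orthogonal_projection S0 SD (delta_mx 0 (enum_rank i)).
suff <- : comb y = M i by [].
apply/funext=> h; pose z : 'rV[C]_#|I| := \row_j Num.conj (M (enum_val j) h).
have Sz : S z.
  rewrite /S (_ : comb z = fun g => c^-1 * right_shift (star h) (M i0) g + 0).
    by apply: VD => //; apply: VR => V _.
  apply/funext=> g; rewrite addr0 /right_shift kernel mulKf //.
  by apply: eq_bigr => j _; rewrite mxE enum_rankK mulrC.
have combE u : comb u h = \sum_(j < #|I|) u 0 j * M (enum_val j) h.
  rewrite /comb (reindex (@enum_val _ (mem I))) /=; last first.
    by apply: onW_bij; exact: enum_val_bij.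
  by apply: eq_bigr => j _; rewrite enum_valK.
have /matrixP/(_ 0 0) := orth z Sz; rewrite !mxE => e0; apply/esym/eqP.
rewrite -subr_eq0 -[X in _ == X]e0 combE.
have -> : M i h = \sum_(j < #|I|) delta_mx (0 : 'I_1) (enum_rank i) 0 j * M (enum_val j) h.
  rewrite (bigD1 (enum_rank i)) //= mxE !eqxx mul1r enum_rankK big1 ?addr0 //.
  by move=> j /negbTE ji; rewrite mxE ji mul0r.
apply/eqP; rewrite -sumrB; apply: eq_bigr => j _.
by rewrite !mxE conjCK mulrBl.
Qed.

Lemma right_shift_in_span X : lin_span (right_shift X (M i0)).
Proof.
exists (fun i => c * Num.conj (M i (star X))) => g.
rewrite /right_shift -{1}[X]starK kernel mulr_sumr.
by apply: eq_bigr => i _; rewrite mulrA mulrAC.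
Qed.

Lemma lin_span_generated : generated (M i0) = lin_span.
Proof.
have rV := generated_subrep (M i0).
apply/seteqP; split=> f; last first.
  case=> x fE; rewrite (_ : f = fun g => \sum_i x i * M i g); last exact/funext.
  exact: subrep_sum span_sub_generated.
(* That [lin_span] is stable under shifts is not known yet. [W], the largest stable set inside it,
   is a subrepresentation by construction and contains [M i0] by the kernel identity. *)
pose W : set (G -> C) := fun f => forall X, lin_span (right_shift X f).
have spanD a f1 f2 : lin_span f1 -> lin_span f2 ->
    lin_span (fun g => a * f1 g + f2 g).
  move=> [x1 e1] [x2 e2]; exists (fun i => a * x1 i + x2 i) => g.
  rewrite e1 e2 mulr_sumr -big_split; apply: eq_bigr => i _ /=.
  by rewrite mulrDl mulrA.
have subW : subrep W.
  split=> [X|a f1 f2 Wf1 Wf2 X|X h Wh Y].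
  - by exists (fun=> 0) => g; rewrite big1 // => i _; rewrite mul0r.
  - exact: (spanD a _ _ (Wf1 X) (Wf2 X)).
  - have := Wh (Y * X)%g; congr lin_span; apply/funext=> g.
    by rewrite /right_shift mulgA.
move=> /(_ W subW right_shift_in_span)/(_ 1%g); congr lin_span.
by apply/funext=> g; rewrite /right_shift mulg1.
Qed.

Variables (t : G) (mu : I -> C).
Hypothesis Mid : forall i, i != i0 -> M i 1%g = 0.
Hypothesis Mid0 : M i0 1%g != 0.
Hypothesis eigen : forall i g, M i (g * t)%g = mu i * M i g.
Hypothesis simple : forall i, i != i0 -> mu i != mu i0.

Lemma reproducing_irreducible : irreducible (generated (M i0)).
Proof.
have rV := generated_subrep (M i0); split=> //.
  by exists (M i0); [move=> V _ | exists 1%g].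
move=> U rU UV; have [U0 UD UR] := rU.
have [[f Uf f1]|no] := pselect (exists2 f, U f & f 1%g != 0); last first.
  left=> f g Uf; have /eqP : right_shift g f 1%g = 0; last first.
    by rewrite /right_shift mul1g => /eqP.
  apply: contrapT => /eqP fg; apply: no; exists (right_shift g f) => //; exact: UR.
right; apply/seteqP; split=> // h; apply => //.
have := UV f Uf; rewrite lin_span_generated => -[x fE].
(* Lagrange interpolation in the right shift by t isolates the component of f
   on M i0, which is non-zero as f 1 != 0. *)
pose p s i : C := \prod_(j <- s) (mu i - mu j).
have Us s : U (fun g => \sum_i x i * p s i * M i g).
  elim: s => [|j s IH].
    suff <- : f = fun g => \sum_i x i * p [::] i * M i g by [].
    by apply/funext=> g; rewrite fE; under [RHS]eq_bigr do rewrite /p big_nil mulr1.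
  have := UD (- mu j) _ _ IH (UR t _ IH); congr U; apply/funext=> g.
  rewrite /right_shift mulr_sumr -big_split; apply: eq_bigr => i _ /=.
  rewrite eigen /p big_cons; set q := \prod_(_ <- _) _.
  by rewrite [(mu i - _) * q]mulrBl mulrBr mulrBl mulNr addrC; congr (_ - _);
    rewrite !mulrA; congr (_ * _); rewrite -!mulrA mulrCA mulrC -!mulrA // mulrC.
pose s := [seq j <- enum I | j != i0].
have p0 : x i0 * p s i0 != 0.
  rewrite mulf_neq0 //.
    move: f1; rewrite fE (bigD1 i0) //= big1 ?addr0 => [|i /Mid ->]; last by rewrite mulr0.
    by rewrite mulf_eq0 negb_or => /andP[].
  rewrite prodf_seq_neq0; apply/allP=> j; rewrite mem_filter => /andP[ji0 _] /=.
  by rewrite subr_eq0 eq_sym simple.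
have := UD (x i0 * p s i0)^-1 _ _ (Us s) U0; congr U; apply/funext=> g.
rewrite addr0 (bigD1 i0) //= big1 ?addr0 => [|i ii0]; first by rewrite mulKf.
rewrite (_ : p s i = 0) ?mulr0 ?mul0r //; apply/eqP.
rewrite /p prodf_seq_eq0; apply/hasP; exists i; last by rewrite subrr eqxx.
by rewrite mem_filter ii0 mem_enum.
Qed.

End Reproducing.

(** * Minors and the Cauchy-Binet formula *)

Section SetNth.
Variables (N : nat) (x0 : 'I_N).
Implicit Types X Y : {set 'I_N}.

(** Unlike [enum_val], this accepts indices from ['I_k] for any [k] provably equal to the cardinal,
    so that minors over different sets are determinants of matrices of one type. [x0] is a mere
    default. *)
Definition setnth X i := nth x0 (enum X) i.

Lemma setnth_inj k X (i j : 'I_k) : #|X| = k -> setnth X i = setnth X j -> i = j.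
Proof.
move=> cX /eqP; rewrite nth_uniq ?enum_uniq -?cardE ?cX // => /eqP.
exact: val_inj.
Qed.

Lemma setnth_in k X (i : 'I_k) : #|X| = k -> setnth X i \in X.
Proof. by move=> cX; rewrite -mem_enum mem_nth // -cardE cX. Qed.

Lemma setnth_imset k X : #|X| = k -> [set setnth X i | i : 'I_k] = X.
Proof.
move=> cX; apply/eqP; rewrite eqEcard; apply/andP; split.
  by apply/subsetP=> _ /imsetP[i _ ->]; exact: setnth_in.
rewrite card_imset ?card_ord ?cX // => i j; exact: setnth_inj.
Qed.

Lemma inj_setnth k (r : 'I_k -> 'I_N) : injective r ->
  exists s : 'S_k, forall i, r i = setnth [set r i | i : 'I_k] (s i).
Proof.
move=> injr; set X := [set _ | _ in _].
have cX : #|X| = k by rewrite card_imset // card_ord.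
have rX i : r i \in enum X by rewrite mem_enum imset_f.
have lt_idx i : (index (r i) (enum X) < k)%N.
  by rewrite -[X in (_ < X)%N]cX cardE index_mem.
pose f i := Ordinal (lt_idx i).
have injf : injective f.
  move=> i j /(congr1 val)/= eij; apply: injr.
  by rewrite -(nth_index x0 (rX i)) eij nth_index.
by exists (perm injf) => i; rewrite permE /setnth nth_index.
Qed.

End SetNth.

Section CauchyBinet.
Variables (C : comNzRingType) (N k : nat) (x0 : 'I_N).

Lemma det_rows_perm (B : 'M[C]_(N, k)) (f : 'I_k -> 'I_N) (s : 'S_k) :
  \det (\matrix_(i < k, j < k) B (f (s i)) j) =
  (-1) ^+ s * \det (\matrix_(i < k, j < k) B (f i) j).
Proof.
rewrite -det_perm -det_mulmx -row_permE; congr (\det _).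
by apply/matrixP=> i j; rewrite !mxE.
Qed.

(** Expand over all maps [f] from ['I_k] to ['I_N]. A map that is not injective repeats a row of
    [B]; the injective ones with image [X] are the enumeration of [X] composed with a permutation,
    and the signs of these permutations assemble the minor of [A]. *)
Lemma cauchy_binet (A : 'M[C]_(k, N)) (B : 'M[C]_(N, k)) :
  \det (A *m B) = \sum_(X : {set 'I_N} | #|X| == k)
    \det (\matrix_(i < k, j < k) A i (setnth x0 X j)) *
    \det (\matrix_(i < k, j < k) B (setnth x0 X i) j).
Proof.
transitivity (\sum_(f : {ffun 'I_k -> 'I_N})
    (\prod_i A i (f i)) * \det (\matrix_(i < k, j < k) B (f i) j)).
  rewrite /determinant.
  under eq_bigr => s _ do under eq_bigr => i _ do rewrite mxE.
  under eq_bigr => s _ do rewrite bigA_distr_bigA mulr_sumr.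
  rewrite exchange_big; apply: eq_bigr => f _; rewrite mulr_sumr.
  apply: eq_bigr => s _; rewrite big_split /= mulrCA; congr (_ * (_ * _)).
  by apply: eq_bigr => i _; rewrite mxE.
rewrite (bigID (fun f : {ffun 'I_k -> 'I_N} => injectiveb f)) /=.
rewrite [X in _ + X]big1 ?addr0 => [|f /injectivePn[i [j ij fij]]]; last first.
  rewrite (_ : \det _ = 0) ?mulr0 //; apply: (determinant_alternate ij) => l.
  by rewrite !mxE fij.
rewrite (partition_big (fun f : {ffun 'I_k -> 'I_N} => [set f i | i : 'I_k])
           (fun X => #|X| == k)) /= => [|f /injectiveP injf]; last first.
  by rewrite card_imset // card_ord.
apply: eq_bigr => X /eqP cX.
pose eX (i : 'I_k) := setnth x0 X i.
pose F (s : 'S_k) : {ffun 'I_k -> 'I_N} := [ffun i => setnth x0 X (s i)].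
have FX s : injectiveb (F s) && ([set F s i | i : 'I_k] == X).
  apply/andP; split.
    by apply/injectiveP=> i j; rewrite !ffunE => /(setnth_inj cX)/perm_inj.
  rewrite -(setnth_imset x0 cX); apply/eqP/setP=> p; apply/imsetP/imsetP.
    by case=> i _ ->; exists (s i); rewrite ?ffunE.
  by case=> i _ ->; exists (s^-1%g i); rewrite ?ffunE ?permKV.
(* The inverse of [F] recovers the permutation; 1 is a default for maps not of the form [F s]. *)
rewrite (reindex_onto F (fun f => if [pick s | f == F s] is Some s then s else 1%g)).
  rewrite (eq_bigl xpredT) => [|s]; last first.
    rewrite FX; case: pickP => [u /eqP Fu|/(_ s)]; last by rewrite eqxx.
    apply/eqP/perm.permP => i; apply: (setnth_inj (x0 := x0) cX).
    by have /ffunP/(_ i) := Fu; rewrite !ffunE.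
  rewrite [X in _ = X * _]/determinant mulr_suml; apply: eq_bigr => s _.
  rewrite (_ : (\matrix_(i, j) B (F s i) j) =
    \matrix_(i, j) B (eX (s i)) j); last first.
    by apply/matrixP=> i j; rewrite !mxE ffunE.
  rewrite (det_rows_perm B eX) mulrCA mulrA; congr (_ * _ * _).
  by apply: eq_bigr => i _; rewrite mxE ffunE.
move=> f /andP[/injectiveP injf /eqP fX].
case: pickP => [s /eqP //|no]; have [s sE] := inj_setnth x0 injf.
case/eqP: (no s); apply/ffunP=> i; rewrite ffunE sE fX //.
Qed.

End CauchyBinet.

Section Minors.
Variables (C : fieldType) (s : series) (n : nat) (x0 : 'I_(Defs.dim s n)).
Local Notation N := (Defs.dim s n).
Implicit Types (X Y Z : {set 'I_N}) (g h : 'M[C]_N).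
Local Notation setnth := (setnth x0).

Lemma minor_setnth k X Y g : #|X| = k -> #|Y| = k ->
  minor Y X g = \det (\matrix_(i < k, j < k) g (setnth Y i) (setnth X j)).
Proof.
move=> <- cY; congr (\det _); apply/matrixP=> i j; rewrite !mxE.
rewrite (set_nth_default x0) -?cardE ?cY //.
by rewrite (enum_val_nth x0).
Qed.

Lemma minorM Y Z g h : #|Y| = #|Z| ->
  minor Y Z (g *m h) = \sum_(X : {set 'I_N} | #|X| == #|Y|) minor Y X g * minor X Z h.
Proof.
move=> cYZ; rewrite (minor_setnth _ (esym cYZ) erefl).
rewrite (_ : (\matrix_(i, j) _) = (\matrix_(i < #|Y|, j < N) g (setnth Y i) j) *m
   (\matrix_(i < N, j < #|Y|) h i (setnth Z j))); last first.
  by apply/matrixP=> i j; rewrite !mxE; apply: eq_bigr => p _; rewrite !mxE.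
rewrite (cauchy_binet x0); apply: eq_bigr => X /eqP cX.
rewrite (minor_setnth _ cX erefl) (minor_setnth _ (esym cYZ) cX).
by congr (_ * _); congr (\det _); apply/matrixP=> i j; rewrite !mxE.
Qed.

Lemma minor_tr Y Z g : #|Y| = #|Z| -> minor Y Z g^T = minor Z Y g.
Proof.
move=> cYZ; rewrite (minor_setnth _ (esym cYZ) erefl) (minor_setnth _ erefl (esym cYZ)).
by rewrite -det_tr; congr (\det _); apply/matrixP=> i j; rewrite !mxE.
Qed.

Lemma minor_map (f : {rmorphism C -> C}) Y Z g : #|Y| = #|Z| ->
  minor Y Z (map_mx f g) = f (minor Y Z g).
Proof.
move=> cYZ; rewrite !(minor_setnth _ (esym cYZ) erefl) -det_map_mx.
by congr (\det _); apply/matrixP=> i j; rewrite !mxE.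
Qed.

(** The sign compares the given orders of rows and columns with the increasing ones, hence is the
    same for all [g]. It will be applied to sign sets, which are listed by absolute values of
    coordinates. *)
Lemma minor_imset_sign k (r c : 'I_k -> 'I_N) : injective r -> injective c ->
  exists b : bool, forall g,
    minor [set r i | i : 'I_k] [set c i | i : 'I_k] g =
    (-1) ^+ b * \det (\matrix_(i, j) g (r i) (c j)).
Proof.
move=> injr injc; have [u uE] := inj_setnth x0 injr.
have [v vE] := inj_setnth x0 injc; exists (u (+) v) => g.
rewrite (@minor_setnth k) ?card_imset ?card_ord //.
set Y := [set _ | _ in _] in uE *; set X := [set _ | _ in _] in vE *.
rewrite (_ : (\matrix_(i, j) g (r i) _) = row_perm u (col_perm v
  (\matrix_(i < k, j < k) g (setnth Y i) (setnth X j)))); last first.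
  by apply/matrixP=> i j; rewrite !mxE uE vE.
rewrite row_permE col_permE !det_mulmx !det_perm odd_permV.
set D := \det _; rewrite signr_addb.
by case: (odd_perm u) (odd_perm v) => [] []; rewrite /= ?expr0 ?expr1; ring.
Qed.

Lemma minor1 Y X : #|X| = #|Y| -> minor Y X (1%:M : 'M[C]_N) = (X == Y)%:R.
Proof.
move=> cXY; have [->|neq] := eqVneq X Y.
  rewrite (minor_setnth _ erefl erefl) (_ : (\matrix_(i, j) _) = 1%:M) ?det1 //.
  apply/matrixP=> i j; rewrite !mxE; congr (_ %:R); congr (nat_of_bool _).
  by apply/eqP/eqP=> [/(setnth_inj erefl)|->].
have [p pY pX] : exists2 p, p \in Y & p \notin X.
  by apply/subsetPn; apply: contraNN neq => YX; rewrite eq_sym eqEcard YX cXY leqnn.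
have /imsetP[i _ pE] : p \in [set setnth Y i | i : 'I_#|Y|] by rewrite setnth_imset.
rewrite (minor_setnth _ cXY erefl) (expand_det_row _ i) big1 // => j _.
rewrite !mxE -pE (_ : p == _ = false) ?mul0r //; apply: contraNF pX => /eqP ->.
exact: setnth_in.
Qed.

Lemma minor_diag_mx Y X g (d : 'rV[C]_N) : #|X| = #|Y| ->
  minor Y X (g *m diag_mx d) = (\prod_(p in X) d 0 p) * minor Y X g.
Proof.
move=> cXY; rewrite !(minor_setnth _ cXY erefl).
rewrite (_ : (\matrix_(i, j) _) =
   (\matrix_(i < #|Y|, j < #|Y|) g (setnth Y i) (setnth X j)) *m
   diag_mx (\row_j d 0 (setnth X j))); last first.
  by apply/matrixP=> i j; rewrite !mul_mx_diag !mxE.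
rewrite det_mulmx det_diag mulrC; congr (_ * _).
rewrite -{2}(setnth_imset x0 cXY) big_imset /=; last first.
  by move=> i j _ _; exact: setnth_inj.
by apply: eq_big => [i|i _]; rewrite ?inE ?mxE.
Qed.

End Minors.

(** Cancel the factors over the intersection: the two differences have the same cardinal, and
    [theta] separates the factors over them. *)
Lemma prod_subset_lt (C : numDomainType) (T : finType) (d : T -> C) (theta : C)
    (F X : {set T}) :
  (forall p, 0 < d p) -> (forall p, p \in F -> theta <= d p) ->
  (forall p, p \notin F -> d p < theta) -> 0 < theta ->
  #|X| = #|F| -> X != F -> \prod_(p in X) d p < \prod_(p in F) d p.
Proof.
move=> d0 dF dnF th0 cXF neq.
rewrite (big_setID F) [ltRHS](big_setID X) /= setIC ltr_pM2l; last first.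
  by apply: prodr_gt0 => p _.
have cD : #|X :\: F| = #|F :\: X|.
  by apply/eqP; rewrite -(eqn_add2l #|X :&: F|) cardsID setIC cardsID cXF.
apply: (@lt_le_trans _ _ (theta ^+ #|X :\: F|)).
  rewrite -prodr_const; apply: ltr_prod => [|p]; last first.
    by rewrite inE => /andP[pF _]; rewrite ltW //= dnF.
  have [p pF pX] : exists2 p, p \in X & p \notin F.
    by apply/subsetPn; apply: contraNN neq => XF; rewrite eqEcard XF cXF leqnn.
  by apply/hasP; exists p; rewrite ?mem_index_enum // inE pX pF.
rewrite cD -prodr_const; apply: ler_prod => p; rewrite inE => /andP[_ pF].
by rewrite ltW //= dF.
Qed.

(** * Products of determinants *)

Section Products.
Variables (C : numClosedFieldType) (s : series) (n : nat) (b : bool).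
Local Notation N := (Defs.dim s n).
Variable x0 : 'I_N.
Variable ks : seq nat.
Local Notation L := (size ks).
Local Notation index := {ffun 'I_L -> {set 'I_N}}.
Local Notation kth j := (nth 0%N ks j).
Implicit Types (X Y : {set 'I_N}) (g h : 'M[C]_N) (phi : index).

Definition top_rows (k : nat) : {set 'I_N} :=
  if b && (k == n) then bar_rows s n else first_rows s n k.

Definition admissible phi := [forall j : 'I_L, #|phi j| == kth j].
(** A product is indexed by the ordered list of its column sets, not by its exponents: a monomial
    occurs once for each ordering of its factors, and this multiplicity absorbs the multinomial
    coefficients of the kernel. The value 0 for wrong sizes lets the index set be a plain function
    type. *)
Definition det_product phi g : C :=
  if admissible phi then \prod_j pdet b (phi j) g else 0.
Definition top_index : index := [ffun j : 'I_L => top_rows (kth j)].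

Hypothesis card_top : forall k, k \in ks -> #|top_rows k| = k.

Lemma top_admissible : admissible top_index.
Proof. by apply/forallP=> j; rewrite ffunE card_top // mem_nth. Qed.

Lemma pdet_minor k X g : #|X| = k -> pdet b X g = minor (top_rows k) X g.
Proof. by move=> <-. Qed.

Lemma pdet_kernel k g h : k \in ks ->
  pdet b (top_rows k) (g *m adjmx h) =
  \sum_(X : {set 'I_N} | #|X| == k) pdet b X g * Num.conj (pdet b X h).
Proof.
move=> kks; have ck := card_top kks; rewrite (pdet_minor _ ck) (minorM x0) // ck.
apply: eq_bigr => X /eqP cX; rewrite !(pdet_minor _ cX); congr (_ * _).
by rewrite (minor_tr x0) ?cX ?ck // (minor_map x0) // cX ck.
Qed.

Lemma det_product_kernel g h :
  det_product top_index (g *m adjmx h) =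
  \sum_phi det_product phi g * Num.conj (det_product phi h).
Proof.
rewrite /det_product top_admissible.
under eq_bigr => j _ do rewrite ffunE pdet_kernel ?mem_nth //.
rewrite (bigA_distr_big_dep (fun (j : 'I_L) X => #|X| == kth j)).
rewrite [RHS](bigID admissible) /= [X in _ + X]big1 ?addr0 => [|phi /negbTE ->]; last first.
  by rewrite mul0r.
apply: eq_big => [phi|phi aphi]; first by apply/familyP/forallP=> a j; have := a j.
have -> : admissible phi by move/familyP: aphi => a; apply/forallP=> j; have := a j.
by rewrite rmorph_prod -big_split.
Qed.

Lemma det_product1 phi : det_product phi 1%:M = (phi == top_index)%:R.
Proof.
have [->|neq] := eqVneq phi top_index.
  rewrite /det_product top_admissible big1 // => j _.
  have cj := card_top (mem_nth 0%N (ltn_ord j)).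
  by rewrite ffunE (pdet_minor _ cj) (minor1 _ x0) // eqxx.
rewrite /det_product; case: ifP => // /forallP aphi.
have [j neqj] : exists j, phi j != top_index j.
  apply/existsP; rewrite -negb_forall; apply: contraNN neq => /forallP e.
  by apply/eqP/ffunP=> j; apply/eqP/e.
rewrite (bigD1 j) //= (pdet_minor _ (eqP (aphi j))) (minor1 _ x0).
  by move: neqj; rewrite ffunE => /negbTE ->; rewrite mul0r.
by rewrite (eqP (aphi j)) card_top // mem_nth.
Qed.

Section Torus.
Variable d : 'rV[C]_N.
Hypothesis d_gt0 : forall p, 0 < d 0 p.
Hypothesis d_top : forall k, k \in ks -> exists theta,
  [/\ 0 < theta, forall p, p \in top_rows k -> theta <= d 0 p
    & forall p, p \notin top_rows k -> d 0 p < theta].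

Definition weight X : C := \prod_(p in X) d 0 p.
(** For inadmissible [phi] the product is the zero function, so any eigenvalue would be correct; 0
    is chosen because it lies below the positive top weight. *)
Definition product_weight phi : C :=
  if admissible phi then \prod_j weight (phi j) else 0.

Lemma weight_gt0 X : 0 < weight X.
Proof. exact: prodr_gt0. Qed.

Lemma weight_lt k X : k \in ks -> #|X| = k -> X != top_rows k ->
  weight X < weight (top_rows k).
Proof.
move=> kks cX neq; have [th [th0 th1 th2]] := d_top kks.
by apply: (prod_subset_lt (theta := th)); rewrite ?card_top.
Qed.

Lemma pdet_diag X g : #|X| \in ks ->
  pdet b X (g *m diag_mx d) = weight X * pdet b X g.
Proof. by move=> cX; rewrite /pdet (minor_diag_mx x0) // -/(top_rows _) card_top. Qed.

Lemma det_product_diag phi g :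
  det_product phi (g *m diag_mx d) = product_weight phi * det_product phi g.
Proof.
rewrite /det_product /product_weight; case: ifP => [/forallP aphi|]; last by rewrite mulr0.
rewrite -big_split; apply: eq_bigr => j _ /=.
by rewrite pdet_diag // (eqP (aphi j)) mem_nth.
Qed.

(** Each factor weighs at most as much as the top one of its size, and strictly less where [phi]
    differs; all weights are positive, so the inequalities can be multiplied. *)
Lemma product_weight_lt phi : phi != top_index ->
  product_weight phi < product_weight top_index.
Proof.
move=> neq; rewrite /product_weight top_admissible.
have top0 : 0 < \prod_j weight (top_index j) by apply: prodr_gt0 => j _; exact: weight_gt0.
case: ifP => // /forallP aphi.
have [j neqj] : exists j, phi j != top_index j.
  apply/existsP; rewrite -negb_forall; apply: contraNN neq => /forallP e.
  by apply/eqP/ffunP=> j; apply/eqP/e.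
have lt_j i : phi i != top_index i -> weight (phi i) < weight (top_index i).
  rewrite ffunE => neqi; apply: weight_lt neqi; rewrite ?mem_nth //.
  exact/eqP.
rewrite (bigD1 j) //= [ltRHS](bigD1 j) //=.
apply: (@le_lt_trans _ _ (weight (phi j) *
    \prod_(i < L | i != j) weight (top_index i))).
  rewrite ler_pM2l ?weight_gt0 //; apply: ler_prod => i _.
  rewrite ltW ?weight_gt0 //=.
  by have [->//|/lt_j/ltW] := eqVneq (phi i) (top_index i).
by rewrite ltr_pM2r ?lt_j //; apply: prodr_gt0 => i _; exact: weight_gt0.
Qed.

End Torus.

Section Span.
Variables (m : nat -> rat) (top : rat).
Hypothesis bE : b = neg_weight s m.
Hypothesis ks_sorted : sorted leq ks.
Hypothesis ks_bound : forall k, k \in ks -> (0 < k <= n)%N.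
Hypothesis ks_wt : forall i, (2 <= i <= n)%N ->
  (count_mem (n - i + 1)%N ks)%:R = wt_exp m i.
Hypothesis ks_top : (count_mem n ks)%:R = top.

Definition exponents phi : multiexp s n := [ffun X => #|[set j | phi j == X]|].

Lemma exponents_degree phi k : admissible phi ->
  degree (exponents phi) k = count_mem k ks.
Proof.
move=> /forallP aphi; rewrite /degree.
under eq_bigr => X _ do rewrite ffunE -sum1_card.
rewrite -sum1_count (big_nth 0%N) big_mkord.
rewrite (partition_big phi (fun X => #|X| == k)) /= => [|j]; last first.
  by rewrite (eqP (aphi j)).
apply: eq_bigr => X /eqP cX; apply: eq_bigl => j; rewrite inE.
rewrite /= -(eqP (aphi j)).
by case: (eqVneq (phi j) X) => [->|_]; rewrite ?cX ?eqxx ?andbF.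
Qed.

Lemma exponents_monomial phi g : admissible phi ->
  monomial b (exponents phi) g = det_product phi g.
Proof.
move=> aphi; rewrite /det_product aphi /monomial; move/forallP: aphi => aphi.
rewrite [RHS](partition_big phi (fun X => (0 < #|X| <= n)%N)) /= => [|j _]; last first.
  by rewrite (eqP (aphi j)) ks_bound // mem_nth.
apply: eq_bigr => X _; rewrite ffunE -prodr_const.
by apply: eq_big => [j|j]; rewrite inE // => /eqP ->.
Qed.

(** List every [X] with multiplicity [e X] and sort by cardinal. The cardinals then form a sorted
    list with the same counts as [ks], hence equal to [ks], so the list is an admissible index. *)
Lemma degrees_product (e : multiexp s n) : has_degrees m top e ->
  exists phi, forall g, monomial b e g = det_product phi g.
Proof.
case=> e_wt e_top.
have deg k : (0 < k <= n)%N -> degree e k = count_mem k ks.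
  case/andP=> k0 kn; apply/eqP; rewrite -(eqr_nat rat).
  have [->|ne] := eqVneq k n; first by rewrite e_top ks_top.
  have kn' : (2 <= n - k + 1 <= n)%N by lia.
  have <- : (n - (n - k + 1) + 1 = k)%N by lia.
  by rewrite e_wt // ks_wt.
(* Exponents of sets of other sizes are unconstrained by the degrees and do not enter [monomial]. *)
pose r := [seq X : {set 'I_N} <- enum {set 'I_N} | (0 < #|X| <= n)%N].
pose S := sort (relpre (fun X : {set 'I_N} => #|X|) leq) (flatten [seq nseq (e X) X | X <- r]).
have memr X : (X \in r) = (0 < #|X| <= n)%N by rewrite mem_filter mem_enum andbT.
have count_S k : count_mem k [seq #|X| | X : {set 'I_N} <- S] = count_mem k ks.
  rewrite count_map (seq.permP (permEl (perm_sort _ _))) count_flatten -map_comp sumnE big_map.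
  have [kn|kn] := boolP (0 < k <= n)%N; last first.
    transitivity 0%N; last by apply/esym/count_memPn; apply: contraNN kn; exact: ks_bound.
    rewrite big_seq big1 // => X; rewrite memr /= count_nseq /= => Xn.
    by case: eqP => // Xk; rewrite -Xk Xn in kn.
  rewrite -deg // /degree big_filter big_enum_cond /=.
  rewrite [RHS]big_mkcond [LHS]big_mkcond; apply: eq_bigr => X _.
  rewrite count_nseq /=; case: eqP => [->|_]; last by rewrite mul0n if_same.
  by rewrite kn mul1n.
have mapS : [seq #|X| | X : {set 'I_N} <- S] = ks.
  apply: (sorted_eq leq_trans anti_leq) => //.
    rewrite sorted_map; apply: sort_sorted => X Y; exact: leq_total.
  by apply/allP => k _; rewrite /= count_S.
have szS : size S = L by rewrite -mapS size_map.
pose phi : index := [ffun j : 'I_L => nth finset.set0 S j].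
have aphi : admissible phi.
  have nthS i : (i < size S)%N -> #|nth finset.set0 S i| = kth i.
    by move=> lt; rewrite -[in RHS]mapS (nth_map finset.set0).
  by apply/forallP=> j; rewrite ffunE nthS // szS.
exists phi => g; rewrite /det_product aphi.
transitivity (\prod_(X <- S) pdet b X g).
  rewrite (perm_big _ (permEl (perm_sort _ _))) big_flatten big_map /monomial.
  rewrite /r big_filter big_enum_cond; apply: eq_bigr => X _.
  by rewrite big_nseq iter_mulr_1.
rewrite (big_nth finset.set0) big_mkord szS.
by apply: eq_bigr => j _; rewrite ffunE.
Qed.

Lemma det_polynomial_span (G : Type) (rho : G -> 'M[C]_N) (f : G -> C) :
  det_polynomial rho m top f <->
  exists x : index -> C, forall u, f u = \sum_phi x phi * det_product phi (rho u).
Proof.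
split=> [[P [Pdeg fE]]|[x fE]].
  elim: P f Pdeg fE => [|[a e] P IH] f Pdeg fE.
    by exists (fun=> 0) => u; rewrite fE big_nil big1 // => i _; rewrite mul0r.
  have [||x xE] := IH (fun u : G => \sum_(t <- P) t.1 * monomial b t.2 (rho u)).
  - by move=> t tP; apply: Pdeg; rewrite inE tP orbT.
  - by move=> u; rewrite bE.
  have [phi phiE] := degrees_product (Pdeg (a, e) (mem_head _ _)).
  exists (fun i => a * (i == phi)%:R + x i) => u.
  rewrite fE big_cons -bE phiE xE; under [RHS]eq_bigr do rewrite mulrDl.
  rewrite big_split [X in _ = X + _](bigD1 phi) //= eqxx mulr1 [X in _ = _ + X + _]big1 ?addr0 // => i /negbTE ->.
  by rewrite mulr0 mul0r.
exists [seq (x phi, exponents phi) | phi <- enum index & admissible phi]; split.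
  move=> t /mapP[phi]; rewrite mem_filter => /andP[aphi _] -> /=.
  by split=> [i /ks_wt <-|]; rewrite exponents_degree.
move=> u; rewrite fE big_map big_filter big_enum_cond /= [LHS](bigID admissible) /=.
rewrite [X in _ + X]big1 ?addr0 => [|phi /negbTE aphi]; last first.
  by rewrite /det_product aphi mulr0.
by apply: eq_bigr => phi aphi; rewrite -bE exponents_monomial.
Qed.

End Span.
End Products.

(** * Coordinates and the torus *)

Section Labels.
Variables (s : series) (n : nat).
Local Notation N := (Defs.dim s n).
Implicit Types p q : 'I_N.

Lemma label_inj p q : label s n p = label s n q -> p = q.
Proof.
move=> e; apply: val_inj; move: e (ltn_ord p) (ltn_ord q); rewrite /label /Defs.dim /=.
by case: s p q => p q; do 2 case: ifP; lia.
Qed.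

(** This makes the form antidiagonal in the order of positions. The names of series A are not
    symmetric about 0. *)
Lemma label_rev p : s <> serA -> label s n (rev_ord p) = - label s n p.
Proof.
have := ltn_ord p; rewrite /label /Defs.dim /=.
by case: s p => p // lt_p _; do 2 case: ifP; lia.
Qed.

Lemma dim_gt0 : (0 < n)%N -> (0 < N)%N.
Proof. by rewrite /Defs.dim; case: s; lia. Qed.

Lemma first_rows_card k : (k <= n)%N -> #|first_rows s n k| = k.
Proof.
move=> kn; have kN : (k <= N)%N by move: kn; rewrite /Defs.dim; case: s; lia.
have injw : injective (widen_ord kN) by move=> i j /(congr1 val)/= /val_inj.
rewrite -[RHS]card_ord -(card_imset _ injw).
apply: eq_card => p; rewrite inE; apply/idP/imsetP=> [pk|[i _ ->]].
  by exists (Ordinal pk) => //; apply: val_inj.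
exact: (ltn_ord i).
Qed.


Lemma flag_set k : (0 < k <= n)%N ->
  [set p : 'I_N | label s n p <= - k%:Z] = first_rows s n (n - k + 1).
Proof.
move=> kn; apply/setP=> p; rewrite !inE; have := ltn_ord p.
by rewrite /label /Defs.dim; case: s p => p /=; case: ifP; lia.
Qed.

Definition pos_minus (i : 'I_n) : 'I_N.
Proof. by exists (n - i.+1)%N; rewrite /Defs.dim; case: s; have := ltn_ord i; lia. Defined.

Lemma label_minus i : label s n (pos_minus i) = - i.+1%:Z.
Proof. by rewrite /label /=; have := ltn_ord i; case: ifP; lia. Qed.

(* The position of the coordinate with absolute value [i + 1], with the minus
   sign if [b] holds. *)
Definition signed_pos (b : bool) (i : 'I_n) : 'I_N :=
  if b then pos_minus i else rev_ord (pos_minus i).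

Lemma label_signed b i : s <> serA ->
  label s n (signed_pos b i) = if b then - i.+1%:Z else i.+1%:Z.
Proof.
by case: b => sA; rewrite /signed_pos ?label_rev // label_minus ?opprK.
Qed.

Lemma signed_pos_inj b c i j : s <> serA -> signed_pos b i = signed_pos c j ->
  b = c /\ i = j.
Proof.
move=> sA /(congr1 (fun p : 'I_N => label s n p)); rewrite !label_signed //.
case: b c => [] [] e; split=> //; try (apply: val_inj => /=); lia.
Qed.

Lemma rev_signed b i : rev_ord (signed_pos b i) = signed_pos (~~ b) i.
Proof. by case: b; rewrite /signed_pos //= rev_ordK. Qed.

Lemma signedP p : s <> serA ->
  (exists b i, p = signed_pos b i) \/ (s = serB /\ label s n p = 0).
Proof.
move=> sA; have := ltn_ord p; have [p0 lt_p|p0 lt_p] := eqVneq (label s n p) 0.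
  by right; split=> //; move: p0 lt_p; rewrite /label /Defs.dim; case: s p sA => p //=; case: ifP; lia.
left; have lt_l : (`|label s n p|.-1 < n)%N.
  by move: p0 lt_p; rewrite /label /Defs.dim; case: s p sA => p //=; case: ifP; lia.
exists (label s n p < 0), (Ordinal lt_l); apply: label_inj.
by rewrite label_signed //=; case: ifP; lia.
Qed.

Lemma sign_set_imset (eps : signs n) : s <> serA ->
  sign_set s eps = [set signed_pos (eps i) i | i : 'I_n].
Proof.
move=> sA; apply/setP=> p; rewrite inE; apply/existsP/imsetP => [[i /eqP li]|[i _ ->]].
  by exists i => //; apply: label_inj; rewrite label_signed.
by exists i; rewrite label_signed.
Qed.

Lemma card_sign_set (eps : signs n) : s <> serA -> #|sign_set s eps| = n.
Proof.
move=> sA; rewrite sign_set_imset // card_imset ?card_ord // => i j.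
by case/(signed_pos_inj sA).
Qed.

(** The bridge between the description of the top determinant by signs and its description by rows.
    Series A is covered too, all its top signs being minus. *)
Lemma sign_set_top (m : nat -> rat) : (0 < n)%N ->
  sign_set s (top_signs s n m) = top_rows s n (neg_weight s m) n.
Proof.
move=> n0; rewrite /top_rows eqxx andbT; apply/setP=> p.
have := ltn_ord p; rewrite /top_signs; case: ifP => [neg|nneg] lt_p; rewrite !inE.
  have [lp1|lp1] := eqVneq (label s n p) 1.
    by rewrite orbT; apply/existsP; exists (Ordinal n0); rewrite ffunE ?neg lp1.
  rewrite orbF; apply/existsP/idP => [[i +]|lp].
    rewrite ffunE ?neg /=.
    by case: (nat_of_ord i) => [|k] /=; [rewrite (negbTE lp1) | lia].
  have lt_l : (`|label s n p|.-1 < n)%N.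
    by move: lp lt_p; rewrite /label /Defs.dim; case: s p lp1 => p //=; case: ifP; lia.
  by exists (Ordinal lt_l); rewrite ffunE ?neg /=; case: ifP; lia.
apply/existsP/idP => [[i +]|lp].
  rewrite ffunE ?nneg /=; have := ltn_ord i; rewrite /label; case: s p lt_p => p _ /=; case: ifP; lia.
have lt_l : (n - p.+1 < n)%N by lia.
by exists (Ordinal lt_l); rewrite ffunE ?nneg /= /label lp; lia.
Qed.

Lemma card_top_rows (m : nat -> rat) k : (0 < k <= n)%N ->
  #|top_rows s n (neg_weight s m) k| = k.
Proof.
move=> kn; rewrite /top_rows; case: ifP => [/andP[neg /eqP kE]|_]; last first.
  by rewrite first_rows_card //; case/andP: kn.
have sA : s <> serA by move: neg; rewrite /neg_weight; case: s.
have n0 : (0 < n)%N by case/andP: kn => ? ?; rewrite -kE.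
rewrite kE -[RHS](card_sign_set (top_signs s n m)) // sign_set_top //.
by rewrite /top_rows neg eqxx.
Qed.

End Labels.

Section Torus.
Variables (C : numClosedFieldType) (s : series) (n : nat) (m : nat -> rat).
Local Notation N := (Defs.dim s n).

(* The order of the labels -1 and 1 is exchanged for D with m_{-1} < 0, so
   that the top rows always carry the largest eigenvalues. *)
Definition torus_exp (p : 'I_N) : int :=
  if neg_weight s m && (`|label s n p| == 1)%N then label s n p
  else - label s n p.

Definition torus_row : 'rV[C]_N := \row_p ratr (4%:Q ^ torus_exp p).

Lemma torus_gt0 p : 0 < torus_row 0 p.
Proof. by rewrite mxE ltr0q exprz_gt0. Qed.

(** [torus_exp] is at least n + 1 - k on the top rows and at most n - k elsewhere, also after the
    exchange of -1 and 1. *)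
Lemma torus_threshold k : (0 < k <= n)%N -> exists theta,
  [/\ 0 < theta,
      forall p, p \in top_rows s n (neg_weight s m) k -> theta <= torus_row 0 p
    & forall p, p \notin top_rows s n (neg_weight s m) k -> torus_row 0 p < theta].
Proof.
move=> kn; exists (ratr (4%:Q ^ (n.+1 - k)%N)).
have lab p : (p < n)%N && (label s n p == p%:Z - n%:Z) ||
    ((n <= p)%N && (0 <= label s n p)).
  by rewrite /label; case: ifP; case: s p => p; rewrite /=; lia.
rewrite /top_rows; split=> [|p|p]; first by rewrite ltr0q exprz_gt0.
  rewrite mxE ler_rat ler_eXz2l // /torus_exp; have := lab p; move: (neg_weight s m) => ng.
by case: (boolP (ng && (k == n))) => ngk; rewrite !inE; case: ifP; lia.
rewrite mxE ltr_rat ltr_eXz2l // /torus_exp; have := lab p; move: (neg_weight s m) => ng.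
by case: (boolP (ng && (k == n))) => ngk; rewrite !inE; case: ifP; lia.
Qed.

End Torus.

(** * Integer weights *)

Section Star.
Variable C : numClosedFieldType.

(** As [Om] is its own inverse up to the sign [e], the isometry equation makes [e *: (g^T *m Om)] a
    left inverse of [g *m Om]. It is then a right inverse as well, so that the transpose of [g] is
    an isometry, and so is its conjugate because [Om] is real. *)
Lemma isometry_adjmx N (Om g : 'M[C]_N) (e : C) :
  Om *m Om = e%:M -> e * e = 1 -> map_mx Num.conj Om = Om ->
  Defs.isometry Om g -> Defs.isometry Om (adjmx g).
Proof.
move=> OmOm ee Omr /eqP gi.
have e1 : (e *: (g^T *m Om)) *m (g *m Om) = 1%:M.
  by rewrite -scalemxAl mulmxA gi OmOm scale_scalar_mx ee.
have e2 : g *m Om *m g^T = Om.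
  have e3 := congr1 (mulmx^~ Om) (mulmx1C e1); rewrite mul1mx in e3.
  rewrite -[RHS]e3 -scalemxAr -scalemxAl -!mulmxA OmOm !mul_mx_scalar.
  by rewrite -!scalemxAr scalerA ee scale1r.
rewrite /Defs.isometry /adjmx trmxK -[X in _ == X]Omr -{2}e2 !map_mxM -[X in _ *m X *m _]Omr.
by rewrite map_trmx.
Qed.

Lemma det_adjmx N (g : 'M[C]_N) : \det (adjmx g) = Num.conj (\det g).
Proof. by rewrite det_tr det_map_mx. Qed.

Lemma adjmx_unit N (g : 'M[C]_N) : (adjmx g \in unitmx) = (g \in unitmx).
Proof. by rewrite unitmx_tr map_unitmx. Qed.

Section Classical.
Variables (s : series) (n : nat).
Local Notation N := (Defs.dim s n).
Local Notation Om := (Omega C s n).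

Lemma OmegaE (p q : 'I_N) : s <> serA ->
  Om p q = if q == rev_ord p then
    (if s is serC then if 0 < label s n p then -1 else 1 else 1) else 0.
Proof.
move=> sA; rewrite mxE -label_rev //; congr (if _ then _ else _).
by apply/eqP/eqP=> [/label_inj|->].
Qed.

Lemma Omega_conj : map_mx Num.conj Om = Om.
Proof.
apply/matrixP=> p q; rewrite !mxE; case: ifP; rewrite ?rmorph0 // => _.
by move: (0 < _) => c; case: (s) => /=; case: c; rewrite ?rmorphN rmorph1.
Qed.

Lemma Omega_sqr : s <> serA -> Om *m Om = (if s is serC then -1 else 1)%:M.
Proof.
move=> sA; apply/matrixP=> p q; rewrite mxE (bigD1 (rev_ord p)) //= big1 ?addr0.
  rewrite !OmegaE // eqxx rev_ordK !mxE eq_sym label_rev //.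
  have [->|_] := eqVneq p q; last by rewrite mulr0 mulr0n.
  rewrite mulr1n; have := signedP q sA; move: sA.
  case: s q => //= q sA; rewrite ?mulr1 // => -[[b [i ->]]|[]//].
  by rewrite label_signed //; case: b; rewrite ?oppr_gt0 ?opprK ltz_nat ?ltr0n /= ?mulr1 ?mul1r.
by move=> r /negbTE neq; rewrite OmegaE // neq mul0r.
Qed.

Lemma in_group_adjmx (g : 'M[C]_N) : in_group g -> in_group (adjmx g).
Proof.
have iso : s <> serA -> Defs.isometry Om g -> Defs.isometry Om (adjmx g).
  move=> sA; apply: isometry_adjmx (Omega_sqr sA) _ Omega_conj.
  by case: (s); rewrite ?mulrNN mulr1.
move: g iso; rewrite /in_group; case: (s) => g iso.
- by rewrite adjmx_unit.
- by case/andP=> /eqP dg /iso ->; rewrite // det_adjmx dg rmorph1 eqxx.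
- by case/andP=> ug /iso ->; rewrite // adjmx_unit ug.
- by case/andP=> /eqP dg /iso ->; rewrite // det_adjmx dg rmorph1 eqxx.
Qed.

Definition star (g : classical_group C s n) : classical_group C s n :=
  Sub (adjmx (val g)) (in_group_adjmx (valP g)).

Lemma starK : involutive star.
Proof. by move=> g; apply: val_inj; rewrite /= adjmxK. Qed.

End Classical.
End Star.

(** * The sizes of the determinants in the highest vector *)

Section Sizes.
Variables (n : nat) (m : nat -> rat) (T : nat).

(** [T] will be |m_{-1}| for integer weights and |m_{-1}| - 1/2 for half-integer ones, where the
    square root carries the missing half. *)
Definition size_mult k : nat :=
  if k == n then T else Num.truncn (wt_exp m (n - k + 1)).
Definition det_sizes : seq nat :=
  flatten [seq nseq (size_mult k) k | k <- iota 1 n].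

Lemma det_sizes_bound k : k \in det_sizes -> (0 < k <= n)%N.
Proof.
case/flatten_mapP=> j; rewrite mem_iota mem_nseq => jn /andP[_ /eqP ->]; lia.
Qed.

Lemma count_det_sizes k : (0 < k <= n)%N -> count_mem k det_sizes = size_mult k.
Proof.
move=> kn; rewrite count_flatten -map_comp sumnE big_map.
have kin : k \in iota 1 n by rewrite mem_iota; lia.
rewrite (bigD1_seq k) ?iota_uniq //=.
rewrite count_nseq /= eqxx mul1n big1 ?addn0 // => j /negbTE jk.
by rewrite count_nseq /= jk.
Qed.

Lemma det_sizes_sorted : sorted leq det_sizes.
Proof.
rewrite /det_sizes; elim: n 1%N => //= k IH a.
rewrite sorted_pairwise ?pairwise_cat; last exact: leq_trans.
rewrite -!sorted_pairwise ?IH ?andbT; do ?exact: leq_trans.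
apply/andP; split; last by elim: size_mult => //= -[|j] //= ->; rewrite leqnn.
apply/allrelP=> i j; rewrite mem_nseq => /andP[_ /eqP ->].
case/flatten_mapP=> l; rewrite mem_iota mem_nseq => al /andP[_ /eqP ->]; lia.
Qed.

Lemma prod_det_sizes (R : comNzRingType) (F : nat -> R) : (0 < n)%N ->
  \prod_(k <- det_sizes) F k =
  (\prod_(2 <= i < n.+1) F (n - i + 1)%N ^+ Num.truncn (wt_exp m i)) * F n ^+ T.
Proof.
move=> n0; rewrite /det_sizes big_flatten big_map /=.
transitivity (\prod_(1 <= k < n.+1) F k ^+ size_mult k).
  by rewrite /index_iota subn1; apply: eq_bigr => k _; rewrite big_nseq iter_mulr_1.
rewrite big_nat_recr //= /size_mult eqxx; congr (_ * _).
rewrite [RHS]big_nat_rev [RHS]big_add1 /=.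
apply: eq_big_nat => i ik.
have -> : (2 + n.+1 - i.+2 = n - i + 1)%N by lia.
have -> : (n - (n - i + 1) + 1 = i)%N by lia.
by case: eqP => //; lia.
Qed.

End Sizes.

Section Weights.
Variables (s : series) (n : nat) (m : nat -> rat).
Hypotheses (n_gt0 : (0 < n)%N) (m_dom : dominant s n m).

Lemma wt_exp_nat i : integer_weight n m \/ half_integer_weight n m ->
  (2 <= i <= n)%N -> (Num.truncn (wt_exp m i))%:R = wt_exp m i.
Proof.
move=> m_int i2n; apply/truncnK; rewrite Num.Theory.natrEint.
case: m_dom => m_dec m_dec1 m_pos; rewrite /wt_exp.
have int_diff j k : (0 < j <= n)%N -> (0 < k <= n)%N -> m j - m k \is a Num.int.
  case: m_int => mi jn kn; first by rewrite rpredB ?mi.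
  rewrite (_ : m j - m k = (m j - 2^-1) - (m k - 2^-1)); last by ring.
  by rewrite rpredB ?mi.
have [i2|i2] := eqVneq i 2.
  rewrite subr_ge0 m_dec1 ?andbT; last by lia.
  case: (ger0P (m 1%N)) => m1; first by rewrite int_diff; lia.
  rewrite opprK; case: m_int => mi; first by rewrite rpredD ?mi; lia.
  (* For negative m_{-1} the exponent is a sum of two half-integers, hence again an integer. *)
  rewrite (_ : m 2 + m 1%N = (m 2 - 2^-1) + (m 1%N - 2^-1) + 1); last by field.
  by rewrite rpredD ?rpred1 // rpredD ?mi //; lia.
by rewrite subr_ge0 m_dec ?andbT ?int_diff; lia.
Qed.

Lemma highest_product (C : numClosedFieldType) T (g : 'M[C]_(Defs.dim s n)) :
  highest_head m g * pdet (neg_weight s m) (sign_set s (top_signs s n m)) g ^+ T =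
  det_product (neg_weight s m) (top_index s n (neg_weight s m) (det_sizes n m T)) g.
Proof.
set b := neg_weight s m; set ks := det_sizes n m T.
have cks k : k \in ks -> #|top_rows s n b k| = k.
  by move=> /det_sizes_bound; exact: card_top_rows.
rewrite /det_product top_admissible //.
transitivity (\prod_(k <- ks) pdet b (top_rows s n b k) g); last first.
  by rewrite (big_nth 0%N) big_mkord; apply: eq_bigr => j _; rewrite ffunE.
rewrite prod_det_sizes // sign_set_top //; congr (_ * _).
apply: eq_big_nat => i i2n; rewrite /flag_det flag_set; last by lia.
have ne : (n - i + 1 == n)%N = false by lia.
have le : (n - i + 1 <= n)%N by lia.
by rewrite /top_rows ne andbF /pdet first_rows_card // ne !andbF.
Qed.

Lemma det_polynomial_sizes (C : numClosedFieldType) T top (G : Type)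
    (rho : G -> 'M[C]_(Defs.dim s n)) f :
  integer_weight n m \/ half_integer_weight n m -> T%:R = top ->
  det_polynomial rho m top f <->
  exists x : _ -> C, forall u, f u = \sum_phi x phi *
    det_product (ks := det_sizes n m T) (neg_weight s m) phi (rho u).
Proof.
move=> m_int Ttop; apply: det_polynomial_span => //.
- exact: det_sizes_sorted.
- exact: det_sizes_bound.
- move=> i i2n; rewrite count_det_sizes ?/size_mult; last by lia.
  have -> : (n - i + 1 == n)%N = false by lia.
  have -> : (n - (n - i + 1) + 1 = i)%N by lia.
  exact: wt_exp_nat.
- by rewrite count_det_sizes ?/size_mult ?eqxx //; lia.
Qed.

End Weights.

Section IntegerWeight.
Variables (C : numClosedFieldType) (s : series) (n : nat) (m : nat -> rat).
Hypotheses (n_gt0 : (0 < n)%N) (m_dom : dominant s n m).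
Local Notation N := (Defs.dim s n).

Lemma torus_exp_rev (p : 'I_N) : s <> serA ->
  torus_exp m (rev_ord p) = - torus_exp m p.
Proof. by move=> sA; rewrite /torus_exp label_rev // abszN; case: ifP. Qed.

Local Notation d := (torus_row C s n m).

Lemma torus_rev p : s <> serA -> d 0 p * d 0 (rev_ord p) = 1.
Proof.
by move=> sA; rewrite !mxE torus_exp_rev // -rmorphM -expfzDr // subrr rmorph1.
Qed.

Lemma torus_isometry : s <> serA -> Defs.isometry (Omega C s n) (diag_mx d).
Proof.
move=> sA; apply/eqP/matrixP=> p q; rewrite tr_diag_mx mul_mx_diag mul_diag_mx mxE [X in X * _]mxE.
rewrite OmegaE //; case: eqP => [->|_]; last by rewrite mulr0 mul0r.
by rewrite mulrAC torus_rev // mul1r.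
Qed.

(** Opposite positions carry inverse eigenvalues, so the square of this positive number is 1.
    Squaring treats the middle position of series B like the others. *)
Lemma torus_det : s <> serA -> \det (diag_mx d) = 1.
Proof.
move=> sA; rewrite det_diag.
have pos : 0 < \prod_p d 0 p by apply: prodr_gt0 => p _; exact: torus_gt0.
apply/eqP; rewrite -sqrp_eq1 ?ltW // expr2 {2}(reindex_inj rev_ord_inj) /=.
by rewrite -big_split big1 //= => p _; rewrite torus_rev.
Qed.

Lemma torus_in_group : Defs.in_group (diag_mx d : 'M[C]_N).
Proof.
have unit_d : diag_mx d \in unitmx.
  rewrite unitmxE det_diag unitfE; apply: lt0r_neq0.
  by apply: prodr_gt0 => p _; exact: torus_gt0.
move: unit_d torus_isometry torus_det; rewrite /Defs.in_group.
case: (s) (d) => d' unit_d iso det_d //.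
- by rewrite det_d // eqxx iso.
- by rewrite unit_d iso.
- by rewrite det_d // eqxx iso.
Qed.

Definition torus : classical_group C s n := Sub (diag_mx d) torus_in_group.

Lemma integer_weight_irreducible : integer_weight n m ->
  irreducible (generated (@highest_vector C s n m)) /\
  generated (@highest_vector C s n m) = @integer_functions C s n m.
Proof.
move=> m_int; set b := neg_weight s m; pose T := Num.truncn `|m 1%N|.
pose ks := det_sizes n m T; pose x0 := Ordinal (dim_gt0 s n_gt0).
have Ttop : T%:R = `|m 1%N|.
  apply/truncnK; rewrite Num.Theory.natrEint normr_ge0 andbT.
  by case: ger0P => _; rewrite ?rpredN m_int.
pose M phi (g : classical_group C s n) := det_product (ks := ks) b phi (val g).
pose i0 := top_index s n b ks.
have -> : @highest_vector C s n m = M i0.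
  by apply/funext=> g; rewrite /highest_vector highest_product.
have cks k : k \in ks -> #|top_rows s n b k| = k.
  by move=> /det_sizes_bound; exact: card_top_rows.
have kernel g h : M i0 (g * star h)%g = 1 * \sum_i M i g * Num.conj (M i h).
  by rewrite mul1r /M /= det_product_kernel.
split; last first.
  rewrite (lin_span_generated (oner_neq0 C) (@starK C s n) kernel).
  apply/seteqP; split=> f; rewrite /integer_functions /=;
    by move/(det_polynomial_sizes n_gt0 m_dom _ _ (or_introl m_int) Ttop).
have th k : k \in ks -> exists theta, [/\ 0 < theta,
    forall p, p \in top_rows s n b k -> theta <= d 0 p
  & forall p, p \notin top_rows s n b k -> d 0 p < theta].
  by move=> /det_sizes_bound; exact: torus_threshold.
apply: (reproducing_irreducible (oner_neq0 C) (@starK C s n) kernel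
  (t := torus) (mu := @product_weight C s n ks d)) => [i|||].
- by rewrite /M /= det_product1 // => /negbTE ->.
- by rewrite /M /= det_product1 // eqxx oner_neq0.
- by move=> i g; rewrite /M /= det_product_diag.
- move=> i /(product_weight_lt cks (@torus_gt0 C s n m) th) lt_i.
  by rewrite lt_eqF.
Qed.

End IntegerWeight.

(** * Clifford words and the vacuum projector *)

Definition basis_vec (C : fieldType) (N : nat) (p : 'I_N) : 'cV[C]_N := delta_mx p 0.

Section Clifford.
Variables (C : numClosedFieldType) (N : nat) (Om : 'M[C]_N).
Hypothesis OmE : forall p q, Om p q = (q == rev_ord p)%:R.
Local Notation K := (#|{set 'I_N}|).
Local Notation op := 'M[C]_K.
Local Notation cl := (clifford Om).
Local Notation cp := (clifford_prod Om).
Local Notation e_ := (@basis_vec C N).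
Implicit Types (u v w : 'cV[C]_N) (us vs : seq 'cV[C]_N) (p q : 'I_N) (z : op).

Lemma basis_vecE p q : e_ p q 0 = (q == p)%:R.
Proof. by rewrite mxE eqxx andbT. Qed.

Definition bform u v : C := (u^T *m Om *m v) 0 0.

Lemma Omega_mulE v p : (Om *m v) p 0 = v (rev_ord p) 0.
Proof.
rewrite mxE (bigD1 (rev_ord p)) //= OmE eqxx mul1r big1 ?addr0 // => q /negbTE neq.
by rewrite OmE neq mul0r.
Qed.

Lemma bformE u v : bform u v = \sum_p u p 0 * v (rev_ord p) 0.
Proof. by rewrite /bform -mulmxA mxE; apply: eq_bigr => p _; rewrite Omega_mulE mxE. Qed.

Lemma bformC u v : bform u v = bform v u.
Proof.
rewrite !bformE (reindex_inj rev_ord_inj); apply: eq_bigr => p _.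
by rewrite rev_ordK mulrC.
Qed.

Lemma bform_basis u q : bform u (e_ q) = u (rev_ord q) 0.
Proof.
rewrite bformE (bigD1 (rev_ord q)) //= basis_vecE rev_ordK eqxx mulr1 big1 ?addr0 //.
by move=> p neq; rewrite basis_vecE -[q]rev_ordK (inj_eq rev_ord_inj) (negbTE neq) mulr0.
Qed.

Lemma bform_basis2 p q : bform (e_ p) (e_ q) = (q == rev_ord p)%:R.
Proof. by rewrite bform_basis basis_vecE -(inj_eq rev_ord_inj) rev_ordK. Qed.

Lemma bformDl a u v w : bform (a *: u + v) w = a * bform u w + bform v w.
Proof. by rewrite /bform linearP /= !mulmxDl -!scalemxAl !mxE. Qed.

Lemma qformE u : qform Om u = bform u u. Proof. by []. Qed.

Lemma cliffordE v : cl v = \sum_p v p 0 *: (wedge C p + (wedge C (rev_ord p))^T).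
Proof.
apply: eq_bigr => p _; congr (_ *: (_ + _)).
rewrite (bigD1 (rev_ord p)) //= OmE eqxx scale1r big1 ?addr0 // => q /negbTE neq.
by rewrite OmE neq scale0r.
Qed.

Lemma clifford_linear a u v : cl (a *: u + v) = a *: cl u + cl v.
Proof.
rewrite !cliffordE scaler_sumr -big_split; apply: eq_bigr => p _ /=.
by rewrite !mxE scalerDl scalerA.
Qed.

Lemma clifford0 : cl 0 = 0.
Proof. by rewrite cliffordE big1 // => p _; rewrite mxE scale0r. Qed.

Lemma cliffordD u v : cl (u + v) = cl u + cl v.
Proof. by rewrite -[u]scale1r clifford_linear !scale1r. Qed.

Lemma cliffordZ a u : cl (a *: u) = a *: cl u.
Proof. by rewrite -[a *: u]addr0 clifford_linear clifford0 addr0. Qed.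

Lemma clifford_basis v : cl v = \sum_p v p 0 *: cl (e_ p).
Proof.
rewrite cliffordE; apply: eq_bigr => p _; congr (_ *: _).
rewrite cliffordE (bigD1 p) //= basis_vecE eqxx scale1r big1 ?addr0 // => q /negbTE neq.
by rewrite basis_vecE neq scale0r.
Qed.

Lemma bformD u v w : bform (u + v) w = bform u w + bform v w.
Proof. by rewrite -{1}[u]scale1r bformDl mul1r. Qed.

Lemma bformZ a u w : bform (a *: u) w = a * bform u w.
Proof. by rewrite /bform linearZ /= -!scalemxAl !mxE. Qed.

Lemma cliffordC u v : cl u *m cl v = (2 * bform u v)%:M - cl v *m cl u.
Proof.
have := clifford_sqr Om (u + v); rewrite cliffordD mulmxDl !mulmxDr !clifford_sqr.
have -> : qform Om (u + v) = qform Om u + 2 * bform u v + qform Om v.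
  rewrite !qformE bformD (bformC u) (bformC v) !bformD (bformC v u); ring.
rewrite !raddfD /= -!addrA => /addrI; rewrite !addrA => /addIr <-.
by rewrite addrK.
Qed.

Lemma clifford_anti u v : bform u v = 0 -> cl u *m cl v = - (cl v *m cl u).
Proof. by move=> uv; rewrite cliffordC uv mulr0 raddf0 add0r. Qed.

(** Transposition exchanges exterior multiplication by e_p with the contraction that belongs to
    e_{-p}. It thus restricts to an antiautomorphism of the Clifford algebra exchanging e_p and
    e_{-p}. *)
Lemma clifford_tr v : (cl v)^T = cl (Om *m v).
Proof.
rewrite !cliffordE linear_sum /= (reindex_inj rev_ord_inj); apply: eq_bigr => p _.
by rewrite linearZ linearD /= trmxK Omega_mulE rev_ordK addrC.
Qed.

Lemma wedge_conj p : map_mx Num.conj (wedge C p) = wedge C p.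
Proof.
apply/matrixP=> a b; rewrite !mxE /=; case: (_ && _); last exact: rmorph0.
by rewrite rmorphXn rmorphN rmorph1.
Qed.

Lemma clifford_adj v : adjmx (cl v) = cl (Om *m map_mx Num.conj v).
Proof.
rewrite -clifford_tr; congr _^T; rewrite !cliffordE raddf_sum /=; apply: eq_bigr => p _.
by rewrite map_mxZ map_mxD -map_trmx !wedge_conj mxE.
Qed.

Lemma Omega_basis p : Om *m e_ p = e_ (rev_ord p).
Proof.
apply/matrixP=> q j; rewrite ord1 Omega_mulE !basis_vecE; congr (_ %:R).
by rewrite -(inj_eq rev_ord_inj) rev_ordK.
Qed.

Lemma clifford_prod_tr vs : (cp vs)^T = cp (rev [seq Om *m v | v <- vs]).
Proof.
elim: vs => [|v vs IH] /=; first by rewrite trmx1.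
by rewrite rev_cons -cats1 clifford_prod_cat trmx_mul IH /= mulmx1 clifford_tr.
Qed.

Lemma clifford_prod_adj vs :
  adjmx (cp vs) = cp (rev [seq Om *m map_mx Num.conj v | v <- vs]).
Proof.
elim: vs => [|v vs IH] /=; first by rewrite /adjmx map_mx1 trmx1.
by rewrite rev_cons -cats1 clifford_prod_cat adjmxM IH /= mulmx1 clifford_adj.
Qed.

Lemma clifford_prod_anti us v : (forall u, u \in us -> bform u v = 0) ->
  cp us *m cl v = (-1) ^+ size us *: (cl v *m cp us).
Proof.
elim: us => [|u us IH] ort /=; first by rewrite mul1mx mulmx1 expr0 scale1r.
rewrite -mulmxA IH => [|w wus]; last by apply: ort; rewrite inE wus orbT.
rewrite -scalemxAr (mulmxA (cl u)) (clifford_anti (ort u (mem_head _ _))) exprS mulN1r.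
by rewrite scaleNr mulNmx scalerN mulmxA.
Qed.

(** * Compression of Clifford words by the vacuum projector *)

Section Vacuum.
Variable yl : seq 'I_N.
Hypothesis yl_iso : forall p q, p \in yl -> q \in yl -> q != rev_ord p.
Hypothesis yl_span : forall p, [|| p \in yl, rev_ord p \in yl | rev_ord p == p].

Definition yset : {set 'I_N} := [set p in yl].
Lemma in_yset p : (p \in yset) = (p \in yl). Proof. by rewrite inE. Qed.

Definition vac : 'cV[C]_K := delta_mx (enum_rank yset) 0.
Definition tau z : C := z (enum_rank yset) (enum_rank yset).

Lemma tauE z : tau z = (vac^T *m z *m vac) 0 0.
Proof. by rewrite /vac trmx_delta -rowE -colE !mxE. Qed.

Lemma tauP a z z' : tau (a *: z + z') = a * tau z + tau z'.
Proof. by rewrite /tau !mxE. Qed.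

Lemma tau_tr z : tau z^T = tau z. Proof. by rewrite /tau mxE. Qed.

Lemma tau_adj z : tau (adjmx z) = Num.conj (tau z).
Proof. by rewrite /tau !mxE. Qed.

(** [vac] is the exterior product of the e_p with p in [yl]: multiplying by e_p repeats a factor,
    and by isotropy the contraction in [cl (e_ p)] finds no factor to remove. *)
Lemma vac_kill p : p \in yl -> cl (e_ p) *m vac = 0.
Proof.
move=> py; rewrite -colE cliffordE (bigD1 p) //= big1 ?addr0 => [|q /negbTE neq]; last first.
  by rewrite basis_vecE neq scale0r.
rewrite basis_vecE eqxx scale1r; apply/matrixP=> a j; rewrite !mxE enum_rankK /= in_yset py /= add0r.
case: ifP => // /andP[_ /eqP ye].
have : rev_ord p \in yset by rewrite ye setU11.
by rewrite in_yset => /(yl_iso py); rewrite eqxx.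
Qed.

Definition num_op p : op := 2^-1 *: (cl (e_ p) *m cl (e_ (rev_ord p))).
(* As [num_op p] is the projector onto the vectors killed by e_p, [vac_proj]
   projects every spinor module onto its vacuum line, so that it compresses an
   even element of the Clifford algebra to a scalar, which is [tau]. *)
Definition vac_proj : op := foldr (fun p z => num_op p *m z) 1%:M yl.

Lemma num_opE p : num_op p = 1%:M - 2^-1 *: (cl (e_ (rev_ord p)) *m cl (e_ p)).
Proof.
rewrite /num_op cliffordC bform_basis2 eqxx mulr1 scalerBr; congr (_ - _).
by rewrite scale_scalar_mx mulVf // pnatr_eq0.
Qed.

Lemma num_op_comm u p : bform (e_ p) u = 0 -> bform (e_ (rev_ord p)) u = 0 ->
  num_op p *m cl u = cl u *m num_op p.
Proof.
move=> pu ru; rewrite /num_op -scalemxAl -scalemxAr -mulmxA (clifford_anti ru) mulmxN.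
by rewrite mulmxA (clifford_anti pu) mulNmx opprK mulmxA.
Qed.

Lemma bform_iso p q : p \in yl -> q \in yl -> bform (e_ p) (e_ q) = 0.
Proof. by move=> py qy; rewrite bform_basis2 (negbTE (yl_iso py qy)). Qed.

Let pi := vac_proj.

Lemma vac_proj_comm u : (forall p, p \in yl -> u p 0 = 0 /\ u (rev_ord p) 0 = 0) ->
  pi *m cl u = cl u *m pi.
Proof.
rewrite /pi /vac_proj; elim: yl => [|p ps IH] uy /=; first by rewrite mul1mx mulmx1.
have [up ur] := uy p (mem_head _ _).
rewrite -mulmxA IH => [|q qps]; last by apply: uy; rewrite inE qps orbT.
by rewrite mulmxA num_op_comm ?mulmxA // bformC bform_basis // rev_ordK.
Qed.

Lemma kill_proj q : q \in yl -> cl (e_ q) *m pi = 0.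
Proof.
move=> qy; suff: forall ps, {subset ps <= yl} -> q \in ps ->
    cl (e_ q) *m foldr (fun p z => num_op p *m z) 1%:M ps = 0 by apply.
elim=> [|p ps IH] //= sub; have py := sub p (mem_head _ _).
have {}sub : {subset ps <= yl} by move=> x xps; apply: sub; rewrite inE xps orbT.
rewrite inE mulmxA; have [<- _|neq /= qps] := eqVneq q p.
  rewrite /num_op -scalemxAr mulmxA clifford_sqr qformE bform_iso //.
  by rewrite raddf0 mul0mx scaler0 mul0mx.
have rq : bform (e_ (rev_ord p)) (e_ q) = 0.
  by rewrite bform_basis2 rev_ordK (negbTE neq).
by rewrite -(num_op_comm (bform_iso py qy) rq) -mulmxA IH ?mulmx0.
Qed.

Lemma projK_num p : p \in yl -> num_op p *m pi = pi.
Proof.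
move=> py; rewrite num_opE mulmxBl mul1mx -scalemxAl -mulmxA kill_proj //.
by rewrite mulmx0 scaler0 subr0.
Qed.

Lemma proj_idem : pi *m pi = pi.
Proof.
suff: forall ps, {subset ps <= yl} ->
    foldr (fun p z => num_op p *m z) 1%:M ps *m pi = pi by apply.
elim=> [|p ps IH] /= sub; first by rewrite mul1mx.
rewrite -mulmxA IH ?projK_num ?sub ?mem_head // => x xps.
by apply: sub; rewrite inE xps orbT.
Qed.

(** The transpose of [pi] kills e_{-p} on its right, which gives [pi^T *m pi = pi^T]; the left side
    is symmetric. *)
Lemma proj_tr : pi^T = pi.
Proof.
have killT p : p \in yl -> pi^T *m cl (e_ (rev_ord p)) = 0.
  by move=> py; apply: trmx_inj; rewrite trmx_mul trmxK clifford_tr Omega_basis rev_ordK kill_proj ?trmx0.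
have piT : pi^T *m pi = pi^T.
  suff: forall ps, {subset ps <= yl} ->
    pi^T *m foldr (fun p z => num_op p *m z) 1%:M ps = pi^T by apply.
  elim=> [|p ps IH] /= sub; first by rewrite mulmx1.
  have py := sub p (mem_head _ _).
  rewrite mulmxA num_opE mulmxBr mulmx1 -scalemxAr mulmxA killT //.
  rewrite mul0mx scaler0 subr0 IH // => x xps.
  by apply: sub; rewrite inE xps orbT.
by rewrite -{2}[pi]trmxK -piT trmx_mul trmxK piT.
Qed.

Lemma proj_kill p : p \in yl -> pi *m cl (e_ (rev_ord p)) = 0.
Proof.
move=> py; apply: trmx_inj.
by rewrite trmx_mul proj_tr clifford_tr Omega_basis rev_ordK kill_proj ?trmx0.
Qed.

Lemma proj_vac : pi *m vac = vac.
Proof.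
suff: forall ps, {subset ps <= yl} ->
    foldr (fun p z => num_op p *m z) 1%:M ps *m vac = vac by apply.
elim=> [|p ps IH] /= sub; first by rewrite mul1mx.
rewrite -mulmxA IH => [|x xps]; last by apply: sub; rewrite inE xps orbT.
rewrite num_opE mulmxBl mul1mx -scalemxAl -mulmxA vac_kill ?sub ?mem_head //.
by rewrite mulmx0 scaler0 subr0.
Qed.

Lemma tau_proj z : tau (pi *m z *m pi) = tau z.
Proof.
rewrite !tauE !mulmxA; have -> : vac^T *m pi = vac^T.
  by apply: trmx_inj; rewrite trmx_mul !trmxK proj_tr proj_vac.
by rewrite -(mulmxA _ pi) proj_vac.
Qed.

Lemma tau_pi : tau pi = 1.
Proof.
rewrite -[pi]mulmx1 -[pi *m _]mulmx1 -mulmxA.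
have -> : pi *m (1%:M *m 1%:M) = pi *m 1%:M *m pi by rewrite !mulmx1 proj_idem.
by rewrite tau_proj /tau mxE eqxx.
Qed.

(** [b] is the parity of the words under consideration; fixing it makes the condition linear in
    [z]. *)
Definition sandwich (b : bool) z : Prop := pi *m z *m pi = (if b then 0 else tau z) *: pi.

Lemma sandwichP b a z z' : sandwich b z -> sandwich b z' -> sandwich b (a *: z + z').
Proof.
rewrite /sandwich => ez ez'; rewrite mulmxDr mulmxDl -scalemxAr -scalemxAl ez ez'.
rewrite scalerA -scalerDl tauP; congr (_ *: _).
by case: b {ez ez'}; rewrite // mulr0 addr0.
Qed.

Lemma sandwich0 b z : pi *m z *m pi = 0 -> sandwich b z.
Proof.
move=> e0; have t0 : tau z = 0 by rewrite -tau_proj e0 /tau mxE.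
by rewrite /sandwich e0 t0 if_same scale0r.
Qed.

Lemma sandwich_sum b (I : finType) (a : I -> C) (F : I -> op) :
  (forall i, sandwich b (F i)) -> sandwich b (\sum_i a i *: F i).
Proof.
move=> sF; elim/big_rec: _ => [|i z _ sz]; last exact: sandwichP.
by apply: sandwich0; rewrite mulmx0 mul0mx.
Qed.

(** The letter e_{-q} is anticommuted to the left until the projector kills it. Each exchange leaves
    a multiple of a word with two letters fewer, that is, of length k - 1, as [k] does not count the
    moving letter. *)
Lemma move_left q k b us vs : q \in yl ->
  (forall ws, (size ws).+1 = k -> sandwich b (cp ws)) ->
  (size us + size vs = k)%N -> sandwich b (cp us *m cl (e_ (rev_ord q)) *m cp vs).
Proof.
move=> qy short; elim/last_ind: us vs => [|us u IH] vs /=.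
  by move=> _; apply: sandwich0; rewrite mul1mx !mulmxA proj_kill ?mul0mx.
rewrite size_rcons => sz; rewrite -cats1 clifford_prod_cat /= mulmx1.
rewrite -(mulmxA (cp us)) cliffordC mulmxBr mulmxBl mul_mx_scalar -scalemxAl.
rewrite -[_ - _]scale1r scalerBr !scale1r -scaleN1r addrC.
rewrite -clifford_prod_cat; apply: sandwichP.
  by have := IH (u :: vs); rewrite /= !mulmxA; apply; rewrite -sz addSnnS.
rewrite -[_ *: _]addr0; apply: sandwichP; last first.
  by apply: sandwich0; rewrite mulmx0 mul0mx.
by apply: short; rewrite size_cat.
Qed.

Lemma sandwich_last k b us p : (p \in yl) || (rev_ord p \in yl) ->
  (forall ws, (size ws).+1 = k -> sandwich b (cp ws)) ->
  size us = k -> sandwich b (cp us *m cl (e_ p)).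
Proof.
case/orP=> py short usk; first by apply: sandwich0; rewrite -!mulmxA kill_proj ?mulmx0.
have := @move_left _ k b us [::] py short; rewrite rev_ordK /= mulmx1 addn0; exact.
Qed.

Lemma rev_ord_fix p q : rev_ord p = p -> rev_ord q = q -> p = q.
Proof.
move=> /(congr1 val)/= pp /(congr1 val)/= qq; apply: val_inj => /=.
by have := ltn_ord p; have := ltn_ord q; lia.
Qed.

(** Induction on the length, expanding the last letter in the basis: e_p with p in [yl] is killed by
    the projector on its right, and e_{-p} is moved to the one on its left. There remains e_0, at a
    fixed position; it commutes with the projector, which is why odd words are allowed only in its
    absence. *)
Lemma sandwich_word vs : odd (size vs) ==> [forall p : 'I_N, rev_ord p != p] ->
  sandwich (odd (size vs)) (cp vs).
Proof.
have [k] := ubnP (size vs); elim: k vs => // k IH vs.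
case/lastP: vs => [_ _|us v]; first by rewrite /sandwich /= mulmx1 proj_idem /tau mxE eqxx scale1r.
rewrite size_rcons ltnS => usk par; set b := odd _ in par *.
have short ws : (size ws).+1 = size us -> sandwich b (cp ws).
  move=> sz; have -> : b = odd (size ws) by rewrite /b -sz /= negbK.
  apply: IH; first by rewrite sz ltnW.
  by move: par; rewrite /b -sz /= negbK.
rewrite -cats1 clifford_prod_cat /= mulmx1 clifford_basis mulmx_sumr.
under eq_bigr do rewrite -scalemxAr.
apply: sandwich_sum => p; case/or3P: (yl_span p) => [py|py|/eqP fixp].
- by apply: (@sandwich_last (size us)); rewrite ?py.
- by apply: (@sandwich_last (size us)); rewrite ?py ?orbT.
have bE : b = false.
  apply/negbTE/negP => bt; by move: par; rewrite bt => /forallP/(_ p); rewrite fixp eqxx.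
move: usk short bE; rewrite /b => {b par}; case/lastP: us => [//|us w].
rewrite size_rcons => usk short bE; rewrite bE in short *.
(* An even word ending in e_0 has another letter [w] before it. Exchange the two and expand [w]: its
   components are again killed or moved away, except the one along e_0, and e_0 e_0 = 1 shortens the
   word. *)
rewrite -cats1 clifford_prod_cat /= mulmx1 -mulmxA cliffordC mulmxBr mul_mx_scalar.
rewrite addrC -scaleN1r -[(2 * _) *: _]addr0; do 2?apply: sandwichP; last 2 first.
- exact: short.
- by apply: sandwich0; rewrite mulmx0 mul0mx.
rewrite mulmxA [cl w]clifford_basis mulmx_sumr; under eq_bigr do rewrite -scalemxAr.
have cpe : cp us *m cl (e_ p) = cp (rcons us (e_ p)).
  by rewrite -cats1 clifford_prod_cat /= mulmx1.
apply: sandwich_sum => q; case/or3P: (yl_span q) => [qy|qy|/eqP fixq].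
- by rewrite cpe; apply: (@sandwich_last (size us).+1); rewrite ?qy ?size_rcons.
- by rewrite cpe; apply: (@sandwich_last (size us).+1); rewrite ?qy ?orbT ?size_rcons.
rewrite (rev_ord_fix fixq fixp) -mulmxA clifford_sqr mul_mx_scalar -[_ *: _]addr0.
by apply: sandwichP; [exact: short | apply: sandwich0; rewrite mulmx0 mul0mx].
Qed.

End Vacuum.
End Clifford.

(** * The group Spin and its irreducibility *)

(** The matrix with blocks 1, w, u, 1 has two triangular factorizations, one for each Schur
    complement. *)
Lemma det_sub_rank1 (R : comNzRingType) N (u : 'cV[R]_N) (w : 'rV[R]_N) :
  \det (1%:M - u *m w) = 1 - (w *m u) 0 0.
Proof.
have e1 : \det (block_mx 1%:M w u (1%:M : 'M_N)) = \det (1%:M - u *m w).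
  have -> : block_mx 1%:M w u 1%:M =
      block_mx 1%:M 0 u 1%:M *m block_mx (1%:M : 'M_1) w 0 (1%:M - u *m w).
    rewrite mulmx_block ?(mul1mx, mul0mx, mulmx0, mulmx1, addr0).
    by rewrite [u *m w + _]addrC subrK.
  by rewrite det_mulmx det_lblock det_ublock !det1 !mul1r.
rewrite -e1; have -> : block_mx 1%:M w u 1%:M =
      block_mx (1%:M : 'M_1) w 0 1%:M *m block_mx (1%:M - w *m u) 0 u 1%:M.
  by rewrite mulmx_block ?(mul1mx, mul0mx, mulmx0, mulmx1, add0r) subrK.
by rewrite det_mulmx det_lblock det_ublock !det1 ?mul1r mulr1 det_mx11 !mxE eqxx.
Qed.

Section Reflections.
Variables (C : numClosedFieldType) (N : nat) (Om : 'M[C]_N).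
Hypothesis OmE : forall p q, Om p q = (q == rev_ord p)%:R.
Local Notation cl := (clifford Om).
Local Notation cp := (clifford_prod Om).
Local Notation e_ := (@basis_vec C N).
Local Notation bf := (bform Om).
Implicit Types (u v w : 'cV[C]_N) (us vs : seq 'cV[C]_N) (p q : 'I_N).

(* The negated reflection in u, which is covered by u itself. *)
Definition refl u : 'M[C]_N := 2 *: (u *m (u^T *m Om)) - 1%:M.
Definition cover us : 'M[C]_N := foldr (fun u g => refl u *m g) 1%:M us.

Lemma refl_mul u v : refl u *m v = (2 * bf u v) *: u - v.
Proof.
rewrite /refl mulmxBl mul1mx -scalemxAl -mulmxA -scalerA; congr (_ *: _ - _).
by rewrite [u^T *m Om *m v]mx11_scalar mul_mx_scalar.
Qed.

Lemma Omega_tr : Om^T = Om.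
Proof.
apply/matrixP=> p q; rewrite mxE !OmE; congr (_ %:R).
by rewrite -(inj_eq rev_ord_inj) rev_ordK eq_sym.
Qed.

Lemma refl_isometry u : qform Om u = 1 -> Defs.isometry Om (refl u).
Proof.
move=> qu; have uOu : u^T *m Om *m u = 1%:M by rewrite [LHS]mx11_scalar -/(qform Om u) qu.
rewrite /Defs.isometry; have -> : (refl u)^T = 2 *: (Om *m u *m u^T) - 1%:M.
  by rewrite /refl linearB linearZ /= !trmx_mul trmxK Omega_tr trmx1.
have uOu2 : u^T *m (Om *m (u *m (u^T *m Om))) = u^T *m Om.
  by rewrite !mulmxA uOu mul1mx.
rewrite /refl !(mulmxBl, mulmxBr) !mul1mx !mulmx1 -!scalemxAl -!scalemxAr scalerA.
rewrite -!mulmxA uOu2; apply/eqP/matrixP=> p q; rewrite !mxE; ring.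
Qed.

Lemma refl_det u : qform Om u = 1 -> \det (refl u) = (-1) ^+ N.+1.
Proof.
move=> qu; have -> : refl u = -1 *: (1%:M - (2 *: u) *m (u^T *m Om)).
  by rewrite scaleN1r opprB -scalemxAl.
rewrite detZ det_sub_rank1 -scalemxAr mxE -/(qform Om u) qu.
by rewrite mulr1 exprS mulrC; congr (_ * _); ring.
Qed.

Lemma clifford_refl u v : qform Om u = 1 -> cl u *m cl v = cl (refl u *m v) *m cl u.
Proof.
move=> qu; rewrite refl_mul clifford_linear // -scaleN1r cliffordZ // scaleN1r mulmxBl -scalemxAl.
by rewrite clifford_sqr qu scalemx1 (cliffordC OmE).
Qed.

Lemma cover_cat us vs : cover (us ++ vs) = cover us *m cover vs.
Proof. by elim: us => [|u us IH] /=; rewrite ?mul1mx // IH mulmxA. Qed.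

Lemma clifford_prod_cover us v : (forall u, u \in us -> qform Om u = 1) ->
  cp us *m cl v = cl (cover us *m v) *m cp us.
Proof.
elim: us v => [|u us IH] v uus /=; first by rewrite !mul1mx mulmx1.
rewrite -mulmxA IH => [|w wus]; last by apply: uus; rewrite inE wus orbT.
by rewrite mulmxA clifford_refl ?uus ?mem_head // !mulmxA.
Qed.

Lemma cover_isometry us : (forall u, u \in us -> qform Om u = 1) ->
  Defs.isometry Om (cover us).
Proof.
elim: us => [|u us IH] uus /=; first exact: isometry1.
apply: isometryM; first by rewrite refl_isometry ?uus ?mem_head.
by apply: IH => w wus; apply: uus; rewrite inE wus orbT.
Qed.

Lemma cover_det us : (forall u, u \in us -> qform Om u = 1) ->
  ~~ odd (size us) -> \det (cover us) = 1.
Proof.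
move=> uus ev; have -> : \det (cover us) = ((-1) ^+ N.+1) ^+ size us.
  elim: us uus {ev} => [|u us IH] uus /=; first by rewrite det1.
  rewrite det_mulmx refl_det ?uus ?mem_head // IH ?exprS // => w wus.
  by apply: uus; rewrite inE wus orbT.
by rewrite exprAC -signr_odd (negbTE ev) expr1n.
Qed.

Lemma word_in_spin us : (forall u, u \in us -> qform Om u = 1) ->
  ~~ odd (size us) -> in_spin Om (cp us, cover us).
Proof.
move=> uus ev; split=> /= [||v]; last exact: clifford_prod_cover.
  by rewrite cover_det // cover_isometry.
by exists us.
Qed.

Definition word_spin us (uus : forall u, u \in us -> qform Om u = 1)
    (ev : ~~ odd (size us)) : spin_group Om :=
  Sub (cp us, cover us) (introT (asboolP _) (word_in_spin uus ev)).

End Reflections.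

(** * Rational functions of one variable without poles at 0 and 1 *)

Section Rational.
Variable C : numClosedFieldType.
Implicit Types phi psi : C -> C.

Lemma poly_fun_eq0 (p : {poly C}) : (forall z, p.[z] = 0) -> p = 0.
Proof.
move=> p0; apply: (@roots_geq_poly_eq0 _ p [seq i%:R | i <- iota 0 (size p)]).
- by apply/allP=> z _; apply/rootP.
- rewrite map_inj_uniq ?iota_uniq // => i j /eqP.
  by rewrite eqr_nat => /eqP.
- by rewrite size_map size_iota.
Qed.

(** Curves in Spin are functions of every parameter, with arbitrary values at the poles of their
    coordinates, so only agreement away from the zeros of [D] is required. The curves are evaluated
    at their ends 0 and 1, which must not be poles. *)
Definition ratfun phi : Prop := exists A D : {poly C},
  [/\ D.[0] != 0, D.[1] != 0 & forall z, D.[z] != 0 -> phi z = A.[z] / D.[z]].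

Lemma ratfun_poly (A : {poly C}) : ratfun (fun z => A.[z]).
Proof. by exists A, 1; split=> *; rewrite !hornerC ?oner_neq0 ?divr1. Qed.

Lemma ratfun_cst c : ratfun (fun=> c).
Proof.
by have := ratfun_poly c%:P; congr ratfun; apply/funext=> z; rewrite hornerC.
Qed.

Lemma ratfun_inv (D : {poly C}) : D.[0] != 0 -> D.[1] != 0 -> ratfun (fun z => (D.[z])^-1).
Proof. by exists 1, D; split=> // z _; rewrite hornerC div1r. Qed.

Lemma ratfunD phi psi : ratfun phi -> ratfun psi -> ratfun (fun z => phi z + psi z).
Proof.
move=> [A [D [D0 D1 e1]]] [B [E [E0 E1 e2]]].
exists (A * E + B * D), (D * E); split=> [||z]; [by rewrite hornerM mulf_neq0 | by rewrite hornerM mulf_neq0 |].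
rewrite hornerM mulf_eq0 negb_or => /andP[Dz Ez]; rewrite e1 // e2 // hornerD !hornerM.
by field; rewrite Dz Ez.
Qed.

Lemma ratfunM phi psi : ratfun phi -> ratfun psi -> ratfun (fun z => phi z * psi z).
Proof.
move=> [A [D [D0 D1 e1]]] [B [E [E0 E1 e2]]].
exists (A * B), (D * E); split=> [||z]; [by rewrite hornerM mulf_neq0 | by rewrite hornerM mulf_neq0 |].
rewrite hornerM mulf_eq0 negb_or => /andP[Dz Ez]; rewrite e1 // e2 // hornerM.
by field; rewrite Dz Ez.
Qed.

Lemma ratfun_sum (I : finType) (F : I -> C -> C) :
  (forall i, ratfun (F i)) -> ratfun (fun z => \sum_i F i z).
Proof.
move=> rF; elim: (index_enum I) => [|i s IH].
  by have := ratfun_cst 0; congr ratfun; apply/funext=> z; rewrite big_nil.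
by have := ratfunD (rF i) IH; congr ratfun; apply/funext=> z; rewrite big_cons.
Qed.

(** Multiplying the numerators by both denominators makes the product vanish at the poles as well,
    so it is zero as a polynomial, and the denominators are not. *)
Lemma ratfun_integral phi psi : ratfun phi -> ratfun psi ->
  (forall z, phi z * psi z = 0) -> phi 0 = 0 \/ psi 1 = 0.
Proof.
move=> [A [D [D0 D1 e1]]] [B [E [E0 E1 e2]]] pp.
have : (A * B) * (D * E) = 0.
  apply: poly_fun_eq0 => z; have := pp z; rewrite !hornerM.
  have [->|Dz] := eqVneq D.[z] 0; first by rewrite mul0r mulr0.
  have [->|Ez] := eqVneq E.[z] 0; first by rewrite !mulr0.
  rewrite e1 // e2 // => /eqP; rewrite !mulf_eq0 !invr_eq0 (negbTE Dz) (negbTE Ez) !orbF.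
  by case/orP=> /eqP ->; rewrite ?mul0r ?mulr0 ?mul0r.
move/eqP; rewrite mulf_eq0 => /orP[]; last first.
  rewrite mulf_eq0 => /orP[/eqP DE|/eqP DE].
    by rewrite DE horner0 eqxx in D0.
  by rewrite DE horner0 eqxx in E0.
rewrite mulf_eq0 => /orP[/eqP A0|/eqP B0]; [left|right].
  by rewrite e1 // A0 horner0 mul0r.
by rewrite e2 // B0 horner0 mul0r.
Qed.

End Rational.

Section Integral.
Variables (C : numClosedFieldType) (N : nat) (Om : 'M[C]_N).
Hypothesis OmE : forall p q, Om p q = (q == rev_ord p)%:R.
Variable i0 : 'I_N.
Hypothesis i0_rev : rev_ord i0 != i0.
Local Notation cl := (clifford Om).
Local Notation cp := (clifford_prod Om).
Local Notation e_ := (@basis_vec C N).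
Local Notation bf := (bform Om).
Implicit Types (u v w : 'cV[C]_N) (us vs ws : seq 'cV[C]_N) (p q : 'I_N).

(** The unit vectors of a hyperbolic plane: the quadratic form is twice the product of the two
    coordinates. *)
Definition hyp_vec (a : C) : 'cV[C]_N := a *: e_ i0 + (2 * a)^-1 *: e_ (rev_ord i0).

Lemma hyp_vec_bf a v :
  bf (hyp_vec a) v = a * v (rev_ord i0) 0 + (2 * a)^-1 * v i0 0.
Proof.
by rewrite /hyp_vec bformDl bformZ ![bf (e_ _) v](bformC OmE) !(bform_basis OmE) rev_ordK.
Qed.

Lemma hyp_vec_unit a : a != 0 -> qform Om (hyp_vec a) = 1.
Proof.
move=> a0; rewrite qformE hyp_vec_bf /hyp_vec !mxE /= !eqxx !andbT.
rewrite (negbTE i0_rev) eq_sym (negbTE i0_rev) /=.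
by field.
Qed.

(* B(p, v) != 1 means that p - v is not isotropic; the excluded values of a in
   p = a e + e' / (2 a) are the roots of a non-zero polynomial. *)
Lemma generic_unit v w : exists2 p, qform Om p = 1 & bf p v != 1 /\ bf p w != 1.
Proof.
(* The value of [Q v] at [a] is 2 a (B(p, v) - 1) for p = [hyp_vec a]; its coefficient -2 of ['X]
   never vanishes. *)
pose Q (v : 'cV[C]_N) : {poly C} :=
  (2 * v (rev_ord i0) 0) *: 'X^2 - 2 *: 'X + (v i0 0)%:P.
have Q0 u : Q u != 0.
  apply/eqP => /polyP/(_ 1%N); rewrite /Q coefD coefB !coefZ coefXn coefX coefC coef0 /=.
  rewrite mulr0 sub0r addr0 mulr1 => /eqP; by rewrite oppr_eq0 pnatr_eq0.
have [a] : exists a, ('X * Q v * Q w).[a] != 0.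
  apply: contrapT => no; have /eqP : 'X * Q v * Q w = 0.
    apply: poly_fun_eq0 => a; apply: contrapT => /eqP a0; apply: no; by exists a.
  by rewrite !mulf_eq0 polyX_eq0 !(negbTE (Q0 _)).
rewrite !hornerM hornerX !mulf_eq0 !negb_or => /andP[/andP[a0 av] aw].
have ok u : (Q u).[a] != 0 -> bf (hyp_vec a) u != 1.
  apply: contraNN => /eqP; rewrite hyp_vec_bf => e1.
  rewrite /Q !hornerD hornerN !hornerZ hornerXn hornerX hornerC; apply/eqP.
  have -> : u i0 0 = (2 * a) * (1 - a * u (rev_ord i0) 0).
    have <- : (2 * a)^-1 * u i0 0 = 1 - a * u (rev_ord i0) 0.
      by apply/eqP; rewrite eq_sym subr_eq addrC e1.
    by rewrite mulVKf // mulf_neq0 ?pnatr_eq0.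
  by ring.
by exists (hyp_vec a); [exact: hyp_vec_unit | split; exact: ok].
Qed.

(** Stereographic projection from a unit vector [p]: the line through [p] with direction [u] meets
    the quadric again at p - (2 B(p, u) / q(u)) u. The direction moves linearly from p - v to p - w,
    and these two are not isotropic by the choice of [p]. *)
Lemma unit_path v w : qform Om v = 1 -> qform Om w = 1 ->
  exists V : C -> 'cV[C]_N,
    [/\ forall z, qform Om (V z) = 1, V 0 = v, V 1 = w
      & forall q, ratfun (fun z => V z q 0)].
Proof.
move=> qv qw; have [p qp [pv pw]] := generic_unit v w.
pose u z := p - v + z *: (v - w).
pose V z := p - (2 * bf p (u z) / qform Om (u z)) *: u z.
have qE x y : bf x x = 1 -> bf y y = 1 -> bf (x - y) (x - y) = 2 - 2 * bf x y.
  move=> qx qy; rewrite bformD -scaleN1r bformZ !(bformC OmE _ (x + _)) !bformD.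
  by rewrite !bformZ qx qy (bformC OmE y x); ring.
have pE y : bf p (p - y) = 1 - bf p y.
  by rewrite (bformC OmE) bformD -scaleN1r bformZ (bformC OmE y p) -(qformE Om p) qp; ring.
have end_pt y : qform Om y = 1 -> bf p y != 1 ->
    p - (2 * bf p (p - y) / qform Om (p - y)) *: (p - y) = y.
  move=> qy py; rewrite qformE qE // pE (_ : _ / _ = 1).
    by rewrite scale1r opprB addrC subrK.
  by field; rewrite -[X in X - _]mulr1 -mulrBr mulf_neq0 ?pnatr_eq0 // subr_eq0 eq_sym.
have q0 y : qform Om y = 1 -> bf p y != 1 -> qform Om (p - y) != 0.
  move=> qy py; rewrite qformE qE //.
  by rewrite -[X in X - _]mulr1 -mulrBr mulf_neq0 ?pnatr_eq0 // subr_eq0 eq_sym.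
have u0 : u 0 = p - v by rewrite /u scale0r addr0.
have u1 : u 1 = p - w by rewrite /u scale1r addrA subrK.
exists V; split=> [z|||q].
(* Where [u z] is isotropic, the convention that 0 has inverse 0 makes [V z] equal to [p], which is
   still a unit vector. *)
- rewrite /V; have [->|qu] := eqVneq (qform Om (u z)) 0.
    by rewrite invr0 mulr0 scale0r subr0.
  set c := _ / _; have cE : c * qform Om (u z) = 2 * bf p (u z) by rewrite /c divfK.
  rewrite qformE -scaleN1r scalerA bformD bformZ !(bformC OmE _ (p + _)) !bformD.
  rewrite !bformZ -!qformE qp (bformC OmE (u z) p).
  rewrite (_ : _ + _ = 1 + c * (c * qform Om (u z) - 2 * bf p (u z))); last by ring.
  by rewrite cE subrr mulr0 addr0.
- by rewrite /V u0 end_pt.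
- by rewrite /V u1 end_pt.
pose U q : {poly C} := ((p - v) q 0)%:P + ((v - w) q 0) *: 'X.
have UE q' z : u z q' 0 = (U q').[z].
  by rewrite /u /U [LHS]mxE hornerD hornerC hornerZ hornerX [X in _ + X = _]mxE mulrC.
pose Qp : {poly C} := \sum_q U q * U (rev_ord q).
have QE z : qform Om (u z) = Qp.[z].
  rewrite qformE (bformE OmE) horner_sum; apply: eq_bigr => q' _.
  by rewrite hornerM -!UE.
pose Bp : {poly C} := \sum_q (p q 0) *: U (rev_ord q).
have BE z : bf p (u z) = Bp.[z].
  by rewrite (bformE OmE) horner_sum; apply: eq_bigr => q' _; rewrite hornerZ -!UE.
have := ratfunD (ratfun_cst (p q 0)) (ratfunM (ratfunM (ratfun_poly (- 2 *: Bp))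
  (@ratfun_inv _ Qp _ _)) (ratfun_poly (U q))).
rewrite -!QE u0 u1 => /(_ (q0 v qv pv) (q0 w qw pw)); congr ratfun.
apply/funext=> z; rewrite /V QE BE -UE !mxE hornerZ; ring.
Qed.


Lemma word_path vs ws : size vs = size ws ->
  (forall v, v \in vs -> qform Om v = 1) -> (forall v, v \in ws -> qform Om v = 1) ->
  exists V : C -> seq 'cV[C]_N,
    [/\ forall z, size (V z) = size vs,
        forall z v, v \in V z -> qform Om v = 1,
        cp (V 0) = cp vs, cp (V 1) = cp ws
      & forall a b, ratfun (fun z => cp (V z) a b)].
Proof.
elim: vs ws => [|v vs IH] [|w ws] //=.
  move=> _ _ _; exists (fun=> [::]); split=> // a b; exact: ratfun_cst.
move=> [/IH{}IH] uvs uws.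
have [||V [szV uV V0 V1 rV]] := IH.
- by move=> x xs; apply: uvs; rewrite inE xs orbT.
- by move=> x xs; apply: uws; rewrite inE xs orbT.
have [W [uW W0 W1 rW]] := unit_path (uvs v (mem_head _ _)) (uws w (mem_head _ _)).
exists (fun z => W z :: V z); split=> [z|z x|||a b] /=.
- by rewrite szV.
- by rewrite inE => /orP[/eqP ->|/uV].
- by rewrite W0 V0.
- by rewrite W1 V1.
have -> : (fun z => (cl (W z) *m cp (V z)) a b) =
    (fun z => \sum_c (\sum_p W z p 0 * cl (e_ p) a c) * cp (V z) c b).
  apply/funext=> z; rewrite mxE; apply: eq_bigr => c _; congr (_ * _).
  by rewrite (clifford_basis OmE) summxE; apply: eq_bigr => p _; rewrite mxE.
apply: ratfun_sum => c; apply: ratfunM => //.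
by apply: ratfun_sum => p; apply: ratfunM => //; exact: ratfun_cst.
Qed.

Local Notation Spin := (spin_group Om).
Implicit Types f h : Spin -> C.

Lemma regular_ext f (x y : Spin) : Defs.regular f -> (val x).1 = (val y).1 -> f x = f y.
Proof.
move=> rf xy; elim: rf => [//|a b|f1 f2 _ -> _ ->|f1 f2 _ -> _ ->] //.
by rewrite xy.
Qed.

Lemma regular_sum (I : finType) (F : I -> Spin -> C) :
  (forall i, Defs.regular (F i)) -> Defs.regular (fun x => \sum_i F i x).
Proof.
move=> rF; elim: (index_enum I) => [|i s IH].
  rewrite (_ : (fun _ => _) = fun=> 0); first exact: regular_cst.
  by apply/funext=> x; rewrite big_nil.
rewrite (_ : (fun _ => _) = fun x => F i x + \sum_(j <- s) F j x).
  exact: regularD.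
by apply/funext=> x; rewrite big_cons.
Qed.

Lemma regular_shift f (Y : Spin) : Defs.regular f -> Defs.regular (right_shift Y f).
Proof.
elim=> [c|a b|f1 f2 _ r1 _ r2|f1 f2 _ r1 _ r2].
- exact: regular_cst.
- have -> : right_shift Y (fun x : Spin => (val x).1 a b) =
      fun x => \sum_c (val x).1 a c * (val Y).1 c b.
    by apply/funext=> x; rewrite /right_shift /= mxE.
  apply: regular_sum => c; apply: regularM; [exact: regular_coord|exact: regular_cst].
- exact: (regularD r1 r2).
- exact: (regularM r1 r2).
Qed.

Lemma clifford_prod_nseq u k : qform Om u = 1 -> ~~ odd k -> cp (nseq k u) = 1%:M.
Proof.
move=> qu; elim/ltn_ind: k => -[|[|k]] IH //= ev.
by rewrite mulmxA clifford_sqr qu mul1mx IH // -[odd k]negbK.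
Qed.

(* Any two elements of Spin lie on a rational curve: after padding by pairs
   u u = 1 they are products of equally many unit vectors, and any two unit
   vectors are joined by a conic of unit vectors. *)
Lemma regular_integral f h : Defs.regular f -> Defs.regular h ->
  (forall x, f x * h x = 0) -> (forall x, f x = 0) \/ (forall x, h x = 0).
Proof.
move=> rf rh fh.
have [f0|/existsNP[x /eqP fx]] := pselect (forall x, f x = 0); first by left.
right=> y; have [_ [vs [evs uvs xE]] _] := spinP x; have [_ [ws [ews uws yE]] _] := spinP y.
have a1 : (1 : C) != 0 := oner_neq0 C; set u0 := hyp_vec 1.
have qu0 : qform Om u0 = 1 by exact: hyp_vec_unit.
pose vs' := vs ++ nseq (size ws) u0; pose ws' := ws ++ nseq (size vs) u0.
have sz : size vs' = size ws' by rewrite !size_cat !size_nseq addnC.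
have uvs' v : v \in vs' -> qform Om v = 1.
  by rewrite mem_cat => /orP[/uvs//|]; rewrite mem_nseq => /andP[_ /eqP ->].
have uws' v : v \in ws' -> qform Om v = 1.
  by rewrite mem_cat => /orP[/uws//|]; rewrite mem_nseq => /andP[_ /eqP ->].
have [V [szV uV V0 V1 rV]] := word_path sz uvs' uws'.
have ev z : ~~ odd (size (V z)).
  by rewrite szV size_cat size_nseq oddD (negbTE evs) (negbTE ews).
pose gam z := word_spin OmE (uV z) (ev z).
have ratg f' : Defs.regular f' -> ratfun (fun z => f' (gam z)).
  elim=> [c|a b|f1 f2 _ r1 _ r2|f1 f2 _ r1 _ r2].
  - exact: ratfun_cst.
  - exact: rV.
  - exact: ratfunD.
  - exact: ratfunM.
have g0 : f (gam 0) = f x.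
  apply: regular_ext => //=; rewrite V0 clifford_prod_cat clifford_prod_nseq // mulmx1.
  by rewrite xE.
have g1 : h (gam 1) = h y.
  apply: regular_ext => //=; rewrite V1 clifford_prod_cat clifford_prod_nseq // mulmx1.
  by rewrite yE.
case: (ratfun_integral (ratg f rf) (ratg h rh) (fun z => fh (gam z))).
  by rewrite g0 => /eqP; rewrite (negbTE fx).
by rewrite g1.
Qed.

Lemma regular_sqr f h : Defs.regular f -> Defs.regular h ->
  (forall x, f x ^+ 2 = h x ^+ 2) -> exists b : bool, forall x, f x = (-1) ^+ b * h x.
Proof.
move=> rf rh fh.
have rD a : Defs.regular (fun x => f x + a * h x).
  by apply: regularD => //; apply: regularM => //; exact: regular_cst.
have [|e|e] := regular_integral (rD 1) (rD (-1)).
- by move=> x; have := fh x; rewrite !expr2 => /eqP; rewrite -subr_eq0 => /eqP <-; ring.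
- exists true => x; have /eqP := e x; rewrite mul1r addr_eq0 => /eqP ->.
  by rewrite expr1 mulN1r.
- exists false => x; have /eqP := e x; rewrite mulN1r subr_eq0 => /eqP ->.
  by rewrite expr0 mul1r.
Qed.

End Integral.

(** * Spinor matrix elements and their squares *)

Section Laplace.
Variables (C : numClosedFieldType) (N : nat) (Om : 'M[C]_N).
Hypothesis OmE : forall p q, Om p q = (q == rev_ord p)%:R.
Local Notation cl := (clifford Om).
Local Notation cp := (clifford_prod Om).
Local Notation e_ := (@basis_vec C N).
Local Notation bf := (bform Om).
Implicit Types (u v w : 'cV[C]_N) (us vs : seq 'cV[C]_N) (p q : 'I_N).

Definition word k (u : 'I_k -> 'cV[C]_N) := cp [seq u i | i <- enum 'I_k].

Lemma wordS k (u : 'I_k.+1 -> 'cV[C]_N) :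
  word u = cl (u ord0) *m word (fun i => u (lift ord0 i)).
Proof. by rewrite /word enum_ordSl /= -map_comp. Qed.

(** [w] travels from right to left; the term in which it meets [u j] carries one sign for each of
    the k - j letters already crossed. *)
Lemma word_clifford k (u : 'I_k.+1 -> 'cV[C]_N) w :
  word u *m cl w = (-1) ^+ k.+1 *: (cl w *m word u) +
  \sum_(j < k.+1) ((-1) ^+ (k - j) * (2 * bf (u j) w)) *: word (fun i => u (lift j i)).
Proof.
elim: k u => [|k IH] u.
  rewrite big_ord1 wordS /word enum_ord0 /= !mulmx1 subnn expr0 mul1r expr1 scaleN1r.
  by rewrite (cliffordC OmE) scalemx1 addrC.
rewrite wordS -mulmxA IH mulmxDr -scalemxAr !mulmxA (cliffordC OmE (u ord0)).
rewrite mulmxBl scalerBr mul_scalar_mx scalerA [X in _ = X *: _ + _](exprS _ k.+1) mulN1r scaleNr.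
rewrite [X in X + _]addrC -addrA; congr (_ + _); rewrite [RHS]big_ord_recl subn0.
congr (_ *: _ + _); rewrite mulmx_sumr; apply: eq_bigr => j _.
rewrite -scalemxAr wordS; congr (_ *: (_ *m _)).
  by congr (cl (u _)); apply: val_inj.
congr cp; apply: eq_map => i; congr (u _); apply: val_inj => /=.
by rewrite /bump; lia.
Qed.

Variable yl : seq 'I_N.
Hypothesis yl_iso : forall p q, p \in yl -> q \in yl -> q != rev_ord p.
Let pi := vac_proj Om yl.

(** The letter next to the word of the [u j] is moved left through it and killed by the projector.
    The contractions left behind are the expansion of the determinant along its last row, each with
    a factor 2 from the anticommutator. *)
Lemma laplace k (u : 'I_k -> 'cV[C]_N) (a : 'I_k -> 'I_N) : (forall l, a l \in yl) ->
  pi *m word u *m cp (rev [seq e_ (rev_ord (a l)) | l <- enum 'I_k]) =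
  (2 ^+ k * \det (\matrix_(l, j) u j (a l) 0)) *: pi.
Proof.
elim: k u a => [|k IH] u a ay.
  by rewrite /word enum_ord0 /= !mulmx1 det_mx00 expr0 mulr1 scale1r.
rewrite enum_ordSr map_rcons rev_rcons /= -!mulmxA (mulmxA (word u)) word_clifford.
rewrite mulmxDl mulmxDr -scalemxAl -scalemxAr !mulmxA (proj_kill OmE yl_iso) //.
rewrite !mul0mx scaler0 add0r (expand_det_row _ ord_max) mulr_sumr scaler_suml.
rewrite mulmx_sumr mulmx_suml; apply: eq_bigr => j _.
rewrite -scalemxAr -scalemxAl -map_comp IH; last by move=> l /=.
rewrite scalerA (bform_basis OmE) rev_ordK; congr (_ *: _).
rewrite /cofactor mxE !exprS.
have -> : row' ord_max (col' j (\matrix_(l, j0) u j0 (a l) 0)) =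
    \matrix_(l, j0) u (lift j j0) ((a \o widen_ord (leqnSn k)) l) 0.
  apply/matrixP=> l i; rewrite !mxE /=; congr (u _ _ _); congr (a _).
  by apply: val_inj; rewrite /= /bump leqNgt ltn_ord.
have -> : (-1) ^+ (k - j) = (-1) ^+ (k + j) :> C.
  rewrite -signr_odd -[RHS]signr_odd /= oddB ?oddD //.
  by rewrite -ltnS.
by ring.
Qed.

Lemma basis_kill_word q ps : {subset ps <= yl} -> q \in ps ->
  cl (e_ q) *m cp [seq e_ p | p <- ps] = 0.
Proof.
elim: ps => [|p ps IH] //= sub; have py := sub p (mem_head _ _).
have {}sub : {subset ps <= yl} by move=> x xps; apply: sub; rewrite inE xps orbT.
rewrite inE mulmxA; have [-> _|neq /= qps] := eqVneq q p.
  by rewrite clifford_sqr qformE (bform_iso OmE yl_iso) // raddf0 mul0mx.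
rewrite (clifford_anti OmE (bform_iso OmE yl_iso (sub q qps) py)) mulNmx -mulmxA IH //.
by rewrite mulmx0 oppr0.
Qed.

Lemma proj_eta : pi *m cp [seq e_ p | p <- yl] = cp [seq e_ p | p <- yl].
Proof.
suff: forall ps, {subset ps <= yl} ->
    foldr (fun p z => num_op Om p *m z) 1%:M ps *m cp [seq e_ p | p <- yl] =
    cp [seq e_ p | p <- yl] by apply.
elim=> [|p ps IH] /= sub; first by rewrite mul1mx.
rewrite -mulmxA IH => [|x xps]; last by apply: sub; rewrite inE xps orbT.
rewrite (num_opE OmE) mulmxBl mul1mx -scalemxAl -mulmxA basis_kill_word ?sub ?mem_head //.
by rewrite mulmx0 scaler0 subr0.
Qed.

Definition swap_vec (c : C) p : 'cV[C]_N := c *: (e_ p + e_ (rev_ord p)).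

(** In each swap the summand e_{-p} anticommutes with the letters of [l1], the part already treated,
    and is killed by the projector; only e_p survives. *)
Lemma proj_swap c (l1 l2 : seq 'I_N) : {subset l1 ++ l2 <= yl} -> uniq (l1 ++ l2) ->
  pi *m cp [seq e_ p | p <- l1] *m cp [seq swap_vec c p | p <- l2] =
  c ^+ size l2 *: (pi *m cp [seq e_ p | p <- l1 ++ l2]).
Proof.
elim: l2 l1 => [|p l2 IH] l1 sub un /=.
  by rewrite mulmx1 cats0 expr0 scale1r.
have py : p \in yl by apply: sub; rewrite mem_cat mem_head orbT.
rewrite mulmxA /swap_vec cliffordZ // cliffordD // -scalemxAr mulmxDr -scalemxAl mulmxDl.
rewrite -(mulmxA pi _ (cl (e_ (rev_ord p)))) (clifford_prod_anti OmE); last first.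
  move=> _ /mapP[q ql1 ->]; rewrite bform_basis2 // (inj_eq rev_ord_inj).
  by case: eqP => // pq; move: un; rewrite cat_uniq pq /= ql1 !andbF.
rewrite -scalemxAr mulmxA (proj_kill OmE yl_iso) // !mul0mx scaler0 mul0mx addr0.
have -> : pi *m cp [seq e_ q | q <- l1] *m cl (e_ p) =
    pi *m cp [seq e_ q | q <- rcons l1 p].
  by rewrite -cats1 map_cat clifford_prod_cat /= mulmx1 mulmxA.
by rewrite IH ?cat_rcons // exprS scalerA.
Qed.

Lemma clifford_prod_conj us (g : 'M[C]_N) z zi : z *m zi = 1%:M ->
  (forall v, z *m cl v = cl (g *m v) *m z) ->
  z *m cp us *m zi = cp [seq g *m u | u <- us].
Proof.
move=> zz zc; suff zcp : z *m cp us = cp [seq g *m u | u <- us] *m z.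
  by rewrite zcp -mulmxA zz mulmx1.
elim: us => [|u us IH] /=; first by rewrite mulmx1 mul1mx.
by rewrite mulmxA zc -!mulmxA IH.
Qed.

Lemma clifford_prod_scale (a : C) us : cp [seq a *: u | u <- us] = a ^+ size us *: cp us.
Proof.
elim: us => [|u us IH] /=; first by rewrite expr0 scale1r.
by rewrite cliffordZ // IH -scalemxAl -scalemxAr scalerA -exprS.
Qed.

End Laplace.

Section Spinor.
Variables (C : numClosedFieldType) (s : series) (n : nat) (top : signs n).
Hypotheses (sBD : s = serB \/ s = serD) (n_gt0 : (0 < n)%N).
Local Notation N := (Defs.dim s n).
Local Notation Om := (Omega C s n).
Local Notation cl := (clifford Om).
Local Notation cp := (clifford_prod Om).
Local Notation e_ := (@basis_vec C N).
Local Notation bf := (bform Om).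
Local Notation sp := (@signed_pos s n).
Implicit Types (u v w : 'cV[C]_N) (us vs : seq 'cV[C]_N) (p q : 'I_N) (f : signs n).

Lemma serBD_neqA : s <> serA. Proof. by case: sBD => ->. Qed.

Lemma OmegaBD p q : Om p q = (q == rev_ord p)%:R.
Proof.
have sC (x : C) : (if s is serC then x else 1) = 1 by case: sBD => ->.
by rewrite OmegaE ?sC; [case: eqP | exact: serBD_neqA].
Qed.
Let OmE := OmegaBD.

Let y (i : 'I_n) : 'I_N := sp (top i) i.
Definition top_seq : seq 'I_N := [seq y i | i <- enum 'I_n].
Local Notation yl := top_seq.

Lemma top_seqP p : reflect (exists i, p = y i) (p \in yl).
Proof.
apply: (iffP mapP) => [[i _ ->]|[i ->]]; first by exists i.
by exists i; rewrite ?mem_enum.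
Qed.

Lemma signed_neq_rev b i c j : (sp b i == rev_ord (sp c j)) = (b != c) && (i == j).
Proof.
rewrite rev_signed; apply/eqP/andP=> [/(signed_pos_inj serBD_neqA)[-> ->]|[bc /eqP ->]].
  by case: c.
by congr (sp _ _); case: b c bc => [] [].
Qed.

Lemma signed_eq b i c j : (sp b i == sp c j) = (b == c) && (i == j).
Proof.
by apply/eqP/andP=> [/(signed_pos_inj serBD_neqA)[-> ->]|[/eqP -> /eqP ->]].
Qed.

Lemma top_seq_isotropic p q : p \in yl -> q \in yl -> q != rev_ord p.
Proof.
move=> /top_seqP[i ->] /top_seqP[j ->]; rewrite signed_neq_rev.
by case: (eqVneq j i) => [->|]; rewrite ?eqxx ?andbF.
Qed.

Lemma fix_mid p : label s n p = 0 -> rev_ord p = p.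
Proof. by move=> p0; apply: label_inj; rewrite label_rev ?p0 ?oppr0 //; exact: serBD_neqA. Qed.

Lemma top_seq_span p : [|| p \in yl, rev_ord p \in yl | rev_ord p == p].
Proof.
case: (signedP p serBD_neqA) => [[b [i ->]]|[_ /fix_mid ->]]; last by rewrite eqxx !orbT.
have [->|neq] := eqVneq b (top i); first by apply/orP; left; apply/top_seqP; exists i.
apply/or3P/Or32/top_seqP; exists i; rewrite rev_signed; congr (sp _ i).
by case: b (top i) neq => [] [].
Qed.

Lemma top_seq_uniq : uniq yl.
Proof.
rewrite map_inj_uniq ?enum_uniq // => i j /eqP.
by rewrite signed_eq => /andP[_ /eqP].
Qed.

Let pi := vac_proj Om yl.
Local Notation tau := (@tau C N yl).

Lemma mid_lt : (n < N)%N.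
Proof. by rewrite /Defs.dim; case: sBD => ->; lia. Qed.
(** In series B this is the position of e_0. In series D it is that of the name 1, and facts about
    e_0 carry the hypothesis [s = serB]. *)
Definition mid : 'I_N := Ordinal mid_lt.

Lemma label_mid : s = serB -> label s n mid = 0.
Proof. by move=> sB; rewrite /label /= ltnn sB subrr. Qed.

Lemma mid_rev : s = serB -> rev_ord mid = mid.
Proof. by move=> /label_mid/fix_mid. Qed.

Lemma signed_mid b i : s = serB -> (mid == sp b i) = false.
Proof.
move=> sB; apply/eqP => /(congr1 (fun p : 'I_N => label s n p)).
by rewrite label_mid // label_signed; [case: b; lia | exact: serBD_neqA].
Qed.

Lemma spin_fix : s = serD -> forall p : 'I_N, rev_ord p != p.
Proof.
move=> sD p; case: (signedP p serBD_neqA) => [[b [i ->]]|[sB _]]; last by rewrite sB in sD.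
by rewrite eq_sym signed_neq_rev eqxx.
Qed.

(** The factor that makes e_p + e_{-p} a unit vector. *)
Definition half_root : C := (sqrtC 2)^-1.
Local Notation c := half_root.

Lemma half_rootK : c * c = 2^-1.
Proof. by rewrite /c -invfM -expr2 sqrtCK. Qed.

Lemma half_root_conj : Num.conj c = c.
Proof. by apply/geC0_conj; rewrite invr_ge0 sqrtC_ge0 ler0n. Qed.

Definition swapv (i : 'I_n) : 'cV[C]_N := swap_vec c (y i).
Local Notation h := swapv.

Lemma swapvE i b : h i = c *: (e_ (sp b i) + e_ (sp (~~ b) i)).
Proof.
rewrite /h /swap_vec /y rev_signed; congr (_ *: _).
by case: (top i) b => [] [] //; rewrite addrC.
Qed.

Lemma swapv_bf i b j : bf (h i) (e_ (sp b j)) = c * (i == j)%:R.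
Proof.
rewrite (swapvE i b) bformZ bformD !(bform_basis2 OmE) !signed_neq_rev eqxx /= add0r.
by rewrite (eq_sym j); case: b.
Qed.

Lemma swapv_unit i : qform Om (h i) = 1.
Proof.
rewrite qformE {2}(swapvE i true) (bformC OmE) bformZ bformD !(bformC OmE _ (h i)).
rewrite !swapv_bf eqxx !mulr1 -[c + c]mulr2n -mulr_natr mulrA half_rootK.
by rewrite mulVf // pnatr_eq0.
Qed.

Lemma swapv_Om i : Om *m h i = h i.
Proof.
by rewrite /h /swap_vec -scalemxAr mulmxDr !(Omega_basis OmE) rev_ordK addrC.
Qed.

Lemma basis_conj p : map_mx Num.conj (e_ p) = e_ p.
Proof. by apply/matrixP=> q j; rewrite !mxE rmorph_nat. Qed.

Lemma swapv_conj i : map_mx Num.conj (h i) = h i.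
Proof. by rewrite map_mxZ map_mxD !basis_conj /= half_root_conj. Qed.

Lemma swapv_mid i : s = serB -> bf (h i) (e_ mid) = 0.
Proof.
move=> sB; rewrite (swapvE i true) bformZ bformD !(bform_basis2 OmE) !rev_signed.
by rewrite !signed_mid // addr0 mulr0.
Qed.

Lemma refl_swapv i b j : refl Om (h i) *m e_ (sp b j) =
  (-1) ^+ (i != j) *: e_ (sp (b (+) (i == j)) j).
Proof.
rewrite refl_mul swapv_bf; have [->|neq] := eqVneq i j; last first.
  by rewrite !mulr0 scale0r sub0r addbF expr1 scaleN1r.
rewrite mulr1 (swapvE j b) scalerA -mulrA half_rootK mulfV ?pnatr_eq0 // scale1r.
by rewrite addrC addKr expr0 scale1r addbT.
Qed.

Definition swaps (js : seq 'I_n) : seq 'cV[C]_N := [seq h i | i <- js].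

Lemma swaps_unit js v : v \in swaps js -> qform Om v = 1.
Proof. by case/mapP=> i _ ->; exact: swapv_unit. Qed.

Lemma cover_swaps js b j : uniq js -> cover Om (swaps js) *m e_ (sp b j) =
  (-1) ^+ (size js + (j \in js)) *: e_ (sp (b (+) (j \in js)) j).
Proof.
elim: js => [|i js IH] /=; first by rewrite mul1mx addbF scale1r.
move=> /andP[ijs un]; rewrite -mulmxA IH // -scalemxAr refl_swapv scalerA inE eq_sym.
have [ij|neq] := eqVneq i j; last first.
  by rewrite addbF -exprD addn1.
move: ijs; rewrite ij => /negbTE ->; rewrite !addbF addn0 expr0 mulr1 /= addbT.
by rewrite addn1 !exprS mulrA mulrNN !mul1r.
Qed.

Lemma cover_swaps_mid js : s = serB ->
  cover Om (swaps js) *m e_ mid = (-1) ^+ size js *: e_ mid.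
Proof.
move=> sB; elim: js => [|i js IH] /=; first by rewrite mul1mx scale1r.
rewrite -mulmxA IH -scalemxAr refl_mul swapv_mid // mulr0 scale0r sub0r exprS.
by rewrite mulN1r scaleNr scalerN.
Qed.

Lemma mid_unit : s = serB -> qform Om (e_ mid) = 1.
Proof. by move=> sB; rewrite qformE (bform_basis2 OmE) mid_rev // eqxx. Qed.

Lemma refl_mid_signed b j : s = serB -> refl Om (e_ mid) *m e_ (sp b j) = - e_ (sp b j).
Proof.
move=> sB; rewrite refl_mul (bform_basis2 OmE) mid_rev // eq_sym signed_mid //.
by rewrite mulr0 scale0r sub0r.
Qed.

Lemma refl_mid_mid : s = serB -> refl Om (e_ mid) *m e_ mid = e_ mid.
Proof.
move=> sB; rewrite refl_mul (bform_basis2 OmE) mid_rev // eqxx mulr1.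
by rewrite -{2}[e_ mid]scale1r -scalerBl (_ : 2 - 1 = 1) ?scale1r //; ring.
Qed.

Lemma mid_comm : s = serB -> pi *m cl (e_ mid) = cl (e_ mid) *m pi.
Proof.
move=> sB; apply: (vac_proj_comm OmE) => p /top_seqP[i ->].
by rewrite !basis_vecE rev_signed !(eq_sym _ mid) !signed_mid.
Qed.

Lemma matrix_basis_eq (A B : 'M[C]_N) : (forall p, A *m e_ p = B *m e_ p) -> A = B.
Proof.
by move=> AB; apply/trmx_inj/row_matrixP=> p; rewrite -!tr_col !colE AB.
Qed.


Let js := enum 'I_n.

(** Both factors exchange e_i and e_{-i}, up to a common sign, so the product is a scalar on these
    vectors. In series B it has the opposite sign on e_0, whence the negated reflection in e_0. *)
Lemma cover_flip : exists (b : bool) (R : 'M[C]_N),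
  cover Om (swaps js) *m Om = (-1) ^+ b *: R /\
  (R = 1%:M \/ s = serB /\ R = refl Om (e_ mid)).
Proof.
have signed b i : cover Om (swaps js) *m Om *m e_ (sp b i) = (-1) ^+ n.+1 *: e_ (sp b i).
  rewrite -mulmxA (Omega_basis OmE) rev_signed cover_swaps ?enum_uniq // mem_enum.
  by rewrite size_enum_ord addbT negbK addn1.
case: sBD => sE; [exists (odd n), (refl Om (e_ mid)) | exists (odd n.+1), 1%:M].
  split; last by right.
  apply: matrix_basis_eq => p; rewrite signr_odd -scalemxAl.
  case: (signedP p serBD_neqA) => [[b [i ->]]|[sB p0]].
    by rewrite signed refl_mid_signed // scalerN exprS mulN1r scaleNr.
  have -> : p = mid by apply: label_inj; rewrite label_mid.
  rewrite refl_mid_mid // -mulmxA (Omega_basis OmE) mid_rev // cover_swaps_mid //.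
  by rewrite size_enum_ord.
split; last by left.
apply: matrix_basis_eq => p; rewrite signr_odd -scalemxAl mul1mx.
by case: (signedP p serBD_neqA) => [[b [i ->]]|[sB _]]; [rewrite signed | rewrite sB in sE].
Qed.

Lemma proj_swaps : pi *m cp (swaps js) = c ^+ n *: cp [seq e_ p | p <- yl].
Proof.
have := @proj_swap _ _ _ OmE yl top_seq_isotropic c [::] yl (fun _ => id) top_seq_uniq.
rewrite /= mulmx1 (proj_eta OmE top_seq_isotropic) size_map size_enum_ord => <-.
by rewrite -map_comp.
Qed.

Lemma swaps_tr : (cp (swaps js))^T = cp (rev (swaps js)).
Proof.
rewrite (clifford_prod_tr OmE) -map_comp; congr (cp (rev _)).
by apply: eq_map => i; exact: swapv_Om.
Qed.

Lemma sandwich_even vs : ~~ odd (size vs) -> pi *m cp vs *m pi = tau (cp vs) *: pi.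
Proof.
move=> ev; have := sandwich_word OmE top_seq_isotropic top_seq_span (vs := vs).
by rewrite /sandwich (negbTE ev); apply.
Qed.

Lemma tauZ a z : tau (a *: z) = a * tau z.
Proof. by rewrite /tau mxE. Qed.

(* For x in Spin covering g and eta the product of the e_y, y in the top
   sequence, pi x eta x^-1 eta^T pi is computed in two ways: eta is proportional
   to pi V with V the product of all swaps, which yields tau(x) tau(V x^-1 V^-1),
   and x eta x^-1 is the product of the g e_y, which yields the determinant. *)
Lemma tau_sqr (X : spin_group Om) :
  tau (val X).1 ^+ 2 = \det (\matrix_(l < n, j < n) covering X (y l) (y j)).
Proof.
have [_ [vs [ev uvs xE]] xc] := spinP X; rewrite /covering xE in xc *.
set g := (val X).2 in xc *; set x := cp vs in xc *; pose xi := cp (rev vs).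
have xxi : x *m xi = 1%:M by exact: clifford_prod_rev.
pose V := cp (swaps js); pose eta := cp [seq e_ p | p <- yl].
have pV : pi *m V = c ^+ n *: eta := proj_swaps.
have Vp : V^T *m pi = c ^+ n *: eta^T.
  by have := congr1 trmx pV; rewrite trmx_mul linearZ /= (proj_tr OmE top_seq_isotropic).
have etaT : eta^T = cp (rev [seq e_ (rev_ord (y l)) | l <- js]).
  rewrite /eta (clifford_prod_tr OmE) /yl -!map_comp; congr (cp (rev _)).
  by apply: eq_map => l /=; rewrite (Omega_basis OmE).
have expand : pi *m (x *m eta *m xi) *m eta^T =
    (2 ^+ n * \det (\matrix_(l < n, j < n) g (y l) (y j))) *: pi.
  rewrite (clifford_prod_conj _ xxi xc) etaT.
  have ey l : y l \in yl by apply/top_seqP; exists l.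
  have := laplace OmE top_seq_isotropic (fun j => g *m e_ (y j)) ey.
  have -> : [seq g *m u | u <- [seq e_ p | p <- yl]] = [seq g *m e_ (y j) | j <- js].
    by rewrite /yl -2!map_comp.
  rewrite /word => ->; congr (_ * \det _ *: _).
  apply/matrixP=> l j; rewrite !mxE (bigD1 (y j)) //= basis_vecE eqxx mulr1.
  by rewrite big1 ?addr0 // => p /negbTE neq; rewrite basis_vecE neq mulr0.
have evV : ~~ odd (size (swaps js ++ rev vs ++ rev (swaps js))).
  by rewrite !size_cat !size_rev !oddD (negbTE ev) /= addbb.
have VxV : V *m xi *m V^T = cp (swaps js ++ rev vs ++ rev (swaps js)).
  by rewrite !clifford_prod_cat mulmxA -swaps_tr.
have split_x : tau x * tau (V *m xi *m V^T) =
    \det (\matrix_(l < n, j < n) g (y l) (y j)).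
  have : (tau x * tau (V *m xi *m V^T)) *: pi =
      (c ^+ n * c ^+ n) *: (pi *m (x *m eta *m xi) *m eta^T).
    transitivity (pi *m x *m (pi *m V) *m xi *m (V^T *m pi)).
      rewrite -scalerA VxV -(sandwich_even evV) -VxV scalemxAl scalemxAl.
      by rewrite -(sandwich_even ev) -!mulmxA.
    rewrite pV Vp -!scalemxAr -!scalemxAl scalerA; congr (_ *: _).
    by rewrite -!mulmxA.
  rewrite expand scalerA mulrA -!exprMn half_rootK mulVf ?pnatr_eq0 //.
  rewrite expr1n mul1r => /(congr1 tau).
  by rewrite !tauZ (tau_pi OmE top_seq_isotropic) !mulr1.
(* Transposing inside [tau] replaces [xi] by the word [x] with [Om] applied to its letters, and
   conjugation by [V] undoes [Om] by [cover_flip]: the sign disappears as [x] is even, and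
   conjugation by e_0 is invisible to [tau] as e_0 commutes with the projector. *)
have tau_flip : tau (V *m xi *m V^T) = tau x.
  rewrite -tau_tr !trmx_mul trmxK mulmxA.
  have -> : xi^T = cp [seq Om *m v | v <- vs].
    by rewrite (clifford_prod_tr OmE) map_rev revK.
  have VV : V *m V^T = 1%:M by rewrite swaps_tr; apply: clifford_prod_rev => v /swaps_unit.
  have Vc v : V *m cl v = cl (cover Om (swaps js) *m v) *m V.
    by apply: (clifford_prod_cover OmE) => u /swaps_unit.
  rewrite (clifford_prod_conj _ VV Vc) -map_comp; have [b [R [RE Rcase]]] := cover_flip.
  have -> : [seq (mulmx (cover Om (swaps js)) \o mulmx Om) v | v <- vs] =
      [seq (-1) ^+ b *: w | w <- [seq R *m v | v <- vs]].
    by rewrite -map_comp; apply: eq_map => v /=; rewrite mulmxA RE scalemxAl.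
  rewrite (clifford_prod_scale OmE) size_map exprAC -[_ ^+ size vs]signr_odd (negbTE ev).
  rewrite expr0 expr1n scale1r; case: Rcase => [->|[sB ->]].
    by rewrite (eq_map (mul1mx (n := 1))) map_id.
  have mm : cl (e_ mid) *m cl (e_ mid) = 1%:M by rewrite clifford_sqr mid_unit.
  rewrite -(clifford_prod_conj _ mm (fun v => clifford_refl OmE v (mid_unit sB))).
  have e1 : pi *m (cl (e_ mid) *m x *m cl (e_ mid)) *m pi = tau x *: pi.
    have -> : pi *m (cl (e_ mid) *m x *m cl (e_ mid)) *m pi =
        cl (e_ mid) *m (pi *m x *m pi) *m cl (e_ mid).
      by rewrite !mulmxA -(mid_comm sB) -!mulmxA (mid_comm sB).
    rewrite sandwich_even // -scalemxAr -scalemxAl; congr (_ *: _).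
    by rewrite -(mid_comm sB) -mulmxA mm mulmx1.
  by rewrite -(tau_proj OmE top_seq_isotropic) e1 tauZ (tau_pi OmE top_seq_isotropic) mulr1.
by rewrite -split_x tau_flip expr2.
Qed.


Definition diff_signs f : seq 'I_n := [seq i <- enum 'I_n | f i != top i].

Lemma mem_diff_signs f i : (i \in diff_signs f) = (f i != top i).
Proof. by rewrite mem_filter mem_enum andbT. Qed.

Lemma diff_signs_uniq f : uniq (diff_signs f).
Proof. by rewrite filter_uniq ?enum_uniq. Qed.

(* A representative of the Weyl group element exchanging the coordinates i and
   -i for the signs in which f differs from top; for B the vector e_0 is
   appended when needed to make the number of factors even. *)
Definition spin_word f : seq 'cV[C]_N :=
  swaps (diff_signs f) ++
  if odd (size (diff_signs f)) && (if s is serB then true else false)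
  then [:: e_ mid] else [::].

Lemma serBP : reflect (s = serB) (if s is serB then true else false).
Proof. by case: (s); constructor. Qed.

Lemma spin_word_vec f v : v \in spin_word f ->
  (exists i, v = h i) \/ s = serB /\ v = e_ mid.
Proof.
rewrite mem_cat => /orP[/mapP[i _ ->]|]; first by left; exists i.
by case: ifP => // /andP[_ /serBP sB]; rewrite inE => /eqP ->; right.
Qed.

Lemma spin_word_unit f v : v \in spin_word f -> qform Om v = 1.
Proof. by case/spin_word_vec=> [[i ->]|[sB ->]]; [exact: swapv_unit | exact: mid_unit]. Qed.

(** The letters are real and fixed by [Om]. As the reversed word is the inverse, these
    representatives are unitary. *)
Lemma spin_word_adj f : adjmx (cp (rev (spin_word f))) = cp (spin_word f).
Proof.
rewrite (clifford_prod_adj OmE) map_rev revK; congr cp; rewrite -[RHS]map_id.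
apply/eq_in_map => v /spin_word_vec[[i ->]|[sB ->]]; first by rewrite swapv_conj swapv_Om.
by rewrite basis_conj (Omega_basis OmE) mid_rev.
Qed.

Lemma spin_wordK f : cp (spin_word f) *m cp (rev (spin_word f)) = 1%:M.
Proof. by apply: clifford_prod_rev => v; exact: spin_word_unit. Qed.

Lemma spin_word_cl f v :
  cp (spin_word f) *m cl v = cl (cover Om (spin_word f) *m v) *m cp (spin_word f).
Proof. by apply: (clifford_prod_cover OmE) => u; exact: spin_word_unit. Qed.

(** The sign is common to e_i and e_{-i}, so that it cancels in [num_op]. *)
Lemma spin_word_cover f i : exists a : bool, forall b,
  cover Om (spin_word f) *m e_ (sp b i) =
  (-1) ^+ a *: e_ (sp (b (+) (f i != top i)) i).
Proof.
rewrite cover_cat; pose k := (size (diff_signs f) + (f i != top i))%N.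
have cs b : cover Om (swaps (diff_signs f)) *m e_ (sp b i) =
    (-1) ^+ k *: e_ (sp (b (+) (f i != top i)) i).
  by rewrite cover_swaps ?diff_signs_uniq // mem_diff_signs.
case: ifP => [/andP[_ /serBP sB]|_]; [exists (odd k.+1)|exists (odd k)] => b.
  have -> : cover Om [:: e_ mid] = refl Om (e_ mid) by rewrite /= mulmx1.
  rewrite -mulmxA refl_mid_signed // mulmxN cs signr_odd exprS mulN1r.
  by rewrite scaleNr.
by rewrite [cover Om [::]]/= mulmx1 cs signr_odd.
Qed.

Lemma spin_word_num f i :
  cp (spin_word f) *m num_op Om (y i) = num_op Om (sp (f i) i) *m cp (spin_word f).
Proof.
have [a ca] := spin_word_cover f i.
rewrite /num_op -scalemxAr -scalemxAl mulmxA spin_word_cl -mulmxA spin_word_cl mulmxA.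
rewrite /y !rev_signed !ca !(cliffordZ OmE) -scalemxAl -scalemxAr !scalerA -expr2 sqrr_sign.
have -> : top i (+) (f i != top i) = f i by case: (top i) (f i) => [] [].
have -> : ~~ top i (+) (f i != top i) = ~~ f i by case: (top i) (f i) => [] [].
by rewrite scale1r.
Qed.

(* The sum over all signs of the products of the [num_op] factors as a product
   of the identities e_i e_{-i} / 2 + e_{-i} e_i / 2 = 1. *)
Lemma resolution :
  1%:M = \sum_f cp (spin_word f) *m pi *m cp (rev (spin_word f)).
Proof.
have num_sum p : num_op Om p + num_op Om (rev_ord p) = 1%:M.
  by rewrite (num_opE OmE (rev_ord p)) rev_ordK addrC subrK.
pose prod_num f l := foldr (fun i z => num_op Om (sp (f i) i) *m z) 1%:M l.
have conj_pi f : cp (spin_word f) *m pi *m cp (rev (spin_word f)) = prod_num f js.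
  suff -> : cp (spin_word f) *m pi = prod_num f js *m cp (spin_word f).
    by rewrite -mulmxA spin_wordK mulmx1.
  rewrite /pi /vac_proj /yl -/js; elim: js => [|i l IH] /=; first by rewrite mulmx1 mul1mx.
  by rewrite mulmxA spin_word_num -[RHS]mulmxA -IH mulmxA.
have prodE f : prod_num f js = \prod_(i < n) num_op Om (sp (f i) i).
  rewrite [index_enum _]unlock -enumT /js; elim: (enum 'I_n) => [|i l IH]; first by rewrite big_nil.
  by rewrite big_cons /= IH.
under eq_bigr do rewrite conj_pi prodE.
rewrite -(bigA_distr_bigA (fun i b => num_op Om (sp b i))) big1 // => i _.
rewrite big_bool /= -[RHS](num_sum (sp true i)); congr (_ + num_op Om _); exact: esym (rev_signed s true i).
Qed.

Definition even_signs f : bool := ~~ odd (size (spin_word f)).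

Lemma tau_sum (I : finType) (F : I -> 'M[C]_(#|{set 'I_N}|)) :
  tau (\sum_i F i) = \sum_i tau (F i).
Proof. by rewrite /tau summxE. Qed.

Lemma sandwich_odd vs : s = serD -> odd (size vs) -> pi *m cp vs *m pi = 0.
Proof.
move=> sD od; have := sandwich_word OmE top_seq_isotropic top_seq_span (vs := vs).
rewrite od /sandwich scale0r; apply; apply/implyP => _; apply/forallP.
exact: spin_fix.
Qed.

Lemma odd_signs_serD f : ~~ even_signs f -> s = serD.
Proof.
rewrite /even_signs negbK size_cat size_map => od; case: sBD => // sB; move: od.
have -> : (if s is serB then true else false) = true by apply/serBP.
by rewrite andbT; case: ifP => /= od; rewrite ?addn0 ?od // addn1 /= od.
Qed.

Lemma tau_kernel vs ws : ~~ odd (size vs) -> ~~ odd (size ws) ->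
  tau (cp vs *m adjmx (cp ws)) =
  \sum_(f | even_signs f) tau (cp vs *m cp (spin_word f)) *
                          Num.conj (tau (cp ws *m cp (spin_word f))).
Proof.
move=> ev ew; rewrite -{1}[cp vs]mulmx1 resolution mulmx_sumr mulmx_suml tau_sum.
rewrite (bigID even_signs) /= [X in _ + X]big1 ?addr0 => [|f od]; last first.
  have sD := odd_signs_serD od; rewrite -(tau_proj OmE top_seq_isotropic).
  rewrite !mulmxA -(mulmxA pi (cp vs)) -clifford_prod_cat sandwich_odd //.
    by rewrite !mul0mx /tau mxE.
  by rewrite size_cat oddD (negbTE ev) -[odd _]negbK.
apply: eq_bigr => f evf; rewrite -tau_adj adjmxM.
set x := cp vs; set w := cp (spin_word f); set wi := cp (rev (spin_word f)).
have wa : adjmx w = wi by rewrite /w -spin_word_adj adjmxK.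
rewrite wa -(tau_proj OmE top_seq_isotropic).
have -> : pi *m (x *m (w *m pi *m wi) *m adjmx (cp ws)) *m pi =
    (pi *m (x *m w) *m pi) *m (wi *m adjmx (cp ws) *m pi) by rewrite !mulmxA.
rewrite /x /w -clifford_prod_cat sandwich_even; last first.
  by rewrite size_cat oddD (negbTE ev) (negbTE evf).
rewrite clifford_prod_cat -/x -/w -scalemxAl !mulmxA.
have -> : pi *m wi *m adjmx (cp ws) *m pi = tau (wi *m adjmx (cp ws)) *: pi.
  rewrite (clifford_prod_adj OmE) /wi -(mulmxA pi) -clifford_prod_cat sandwich_even //.
  by rewrite size_cat !size_rev size_map oddD (negbTE ew) (negbTE evf).
by rewrite scalerA tauZ (tau_pi OmE top_seq_isotropic) mulr1.
Qed.

End Spinor.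

(** * Half-integer weights *)

Section SpinGroup.
Variables (C : numClosedFieldType) (s : series) (n : nat).
Hypotheses (sBD : s = serB \/ s = serD) (n_gt0 : (0 < n)%N).
Local Notation N := (Defs.dim s n).
Local Notation Om := (Omega C s n).
Local Notation cl := (clifford Om).
Local Notation cp := (clifford_prod Om).
Local Notation e_ := (@basis_vec C N).
Local Notation bf := (bform Om).
Local Notation sp := (@signed_pos s n).
Local Notation Spin := (spin_group Om).
Implicit Types (u v w : 'cV[C]_N) (us vs : seq 'cV[C]_N) (p q : 'I_N).
Implicit Types (X Y : Spin) (f top : signs n).
Let OmE := @OmegaBD C s n sBD.

Lemma OmegaBD_sqr : Om *m Om = 1%:M.
Proof.
have sC (x y : C) : (if s is serC then x else y) = y by case: sBD => ->.
by rewrite Omega_sqr ?sC //; exact: serBD_neqA.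
Qed.

Lemma qform_adj v : qform Om (Om *m map_mx Num.conj v) = Num.conj (qform Om v).
Proof.
rewrite !qformE !(bformE OmE) rmorph_sum (reindex_inj rev_ord_inj) /=.
by apply: eq_bigr => p _; rewrite !(Omega_mulE OmE) !mxE rev_ordK rmorphM mulrC.
Qed.

Lemma in_spin_adj x : in_spin Om x -> in_spin Om (adjmx x.1, adjmx x.2).
Proof.
case=> [[dx ix] [vs [ev uvs xE]] xc].
have iso : Defs.isometry Om (adjmx x.2).
  apply: isometry_adjmx ix; first exact: OmegaBD_sqr; first by rewrite mulr1.
  exact: Omega_conj.
split=> [|| v] /=; first by rewrite det_adjmx dx rmorph1.
- exists (rev [seq Om *m map_mx Num.conj v | v <- vs]); split.
  + by rewrite size_rev size_map.
  + move=> w; rewrite mem_rev => /mapP[v /uvs qv ->].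
    by rewrite qform_adj qv rmorph1.
  + by rewrite xE (clifford_prod_adj OmE).
(* The adjoint of the covering relation for [u] is the one wanted for [v]: this [u] is sent by
   conjugation and [Om] to [adjmx x.2 *m v], and its image under [x.2] is sent to [v]. *)
pose u := map_mx Num.conj (Om *m (adjmx x.2 *m v)).
have conjK k l (A : 'M[C]_(k, l)) : map_mx Num.conj (map_mx Num.conj A) = A.
  by apply/matrixP=> i j; rewrite !mxE conjCK.
have := congr1 (@adjmx C _ _) (xc u); rewrite !adjmxM !(clifford_adj OmE) map_mxM.
rewrite /u conjK (mulmxA Om Om) OmegaBD_sqr mul1mx => ->; congr (_ *m cl _).
move/eqP: iso; rewrite {1}/adjmx trmxK => e1.
by rewrite [_ *m (Om *m _)]mulmxA [_ *m (_ *m v)]mulmxA e1 mulmxA OmegaBD_sqr mul1mx.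
Qed.

Definition spin_star X : Spin :=
  Sub (adjmx (val X).1, adjmx (val X).2)
    (introT (asboolP _) (in_spin_adj (spinP X))).

Lemma spin_starK : involutive spin_star.
Proof. by case=> [[x g] xP]; apply: val_inj; rewrite /= !adjmxK. Qed.

Lemma basis_fun_eq (A B : 'M[C]_N) :
  (forall b i, A *m e_ (sp b i) = B *m e_ (sp b i)) ->
  (s = serB -> A *m e_ (mid sBD n_gt0) = B *m e_ (mid sBD n_gt0)) -> A = B.
Proof.
move=> AB ABm; apply: matrix_basis_eq => p.
case: (signedP p (serBD_neqA sBD)) => [[b [i ->]] //|[sB p0]].
have -> : p = mid sBD n_gt0 by apply: label_inj; rewrite label_mid.
exact: ABm.
Qed.

Lemma refl_hyp a i b j : a != 0 ->
  refl Om (hyp_vec (sp true i) a) *m e_ (sp b j) =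
  if i == j then (if b then (2 * a ^+ 2)^-1 else 2 * a ^+ 2) *: e_ (sp (~~ b) j)
  else - e_ (sp b j).
Proof.
move=> a0; rewrite refl_mul (hyp_vec_bf OmE) !basis_vecE rev_signed !(signed_eq sBD).
have [<-|_] := eqVneq i j; last first.
  by rewrite !andbF !mulr0 addr0 mulr0 scale0r sub0r.
rewrite /hyp_vec rev_signed !andbT.
by case: b => /=; apply/matrixP=> p q; rewrite !mxE; field.
Qed.

Lemma refl_hyp_mid a i : s = serB ->
  refl Om (hyp_vec (sp true i) a) *m e_ (mid sBD n_gt0) = - e_ (mid sBD n_gt0).
Proof.
move=> sB; rewrite refl_mul (hyp_vec_bf OmE) !basis_vecE rev_signed.
by rewrite ![_ == mid _ _]eq_sym !signed_mid // !mulr0 addr0 mulr0 scale0r sub0r.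
Qed.

(** The negated reflections in [hyp_vec a] and [hyp_vec 1] compose to the scaling of e_{-i} by a^2
    and of e_i by its inverse, all other signs being changed twice; hence the square root in
    [a i]. *)
Lemma spin_diag (d : 'rV[C]_N) : (forall p, d 0 p != 0) ->
  (forall p, d 0 p * d 0 (rev_ord p) = 1) ->
  (s = serB -> d 0 (mid sBD n_gt0) = 1) ->
  exists X, covering X = diag_mx d.
Proof.
move=> d0 drev dmid.
pose a i : C := sqrtC (d 0 (sp true i)).
have a0 i : a i != 0 by rewrite sqrtC_eq0.
pose us l := flatten [seq [:: hyp_vec (sp true i) (a i); hyp_vec (sp true i) 1] | i <- l].
have uus v : v \in us (enum 'I_n) -> qform Om v = 1.
  have rt i : rev_ord (sp true i) != sp true i.
    by rewrite eq_sym signed_neq_rev ?eqxx.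
  case/flatten_mapP=> i _; rewrite !inE => /orP[] /eqP ->; apply: hyp_vec_unit => //.
  exact: oner_neq0.
have ev : ~~ odd (size (us (enum 'I_n))).
  by rewrite /us; elim: (enum 'I_n) => //= i l; rewrite negbK.
exists (word_spin OmE uus ev); rewrite /covering /=.
have diagE p : diag_mx d *m e_ p = d 0 p *: e_ p.
  apply/matrixP=> q k; rewrite ord1 mul_diag_mx !mxE.
  by case: eqP => [->|]; rewrite ?mulr0.
have signed l b j : uniq l -> cover Om (us l) *m e_ (sp b j) =
    (if j \in l then d 0 (sp b j) else 1) *: e_ (sp b j).
  elim: l => [|i l IH] /=; first by rewrite mul1mx scale1r.
  move=> /andP[il un]; rewrite -!mulmxA IH // inE.
  rewrite -!scalemxAr refl_hyp ?oner_neq0 // (eq_sym j) {IH}.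
  have [ij|neq] := eqVneq i j; last by rewrite mulmxN refl_hyp // (negbTE neq) opprK.
  rewrite -ij (negbTE il) scale1r -scalemxAr refl_hyp // eqxx negbK scalerA /=.
  congr (_ *: _); rewrite expr1n mulr1 sqrtCK; case: b => /=.
    by rewrite mulKf // pnatr_eq0.
  rewrite invfM mulrA mulfV ?pnatr_eq0 // mul1r.
  by apply: (mulfI (d0 (sp true i))); rewrite mulfV ?d0 // drev.
have midE l : s = serB -> cover Om (us l) *m e_ (mid sBD n_gt0) = e_ (mid sBD n_gt0).
  move=> sB; elim: l => [|i l IH] /=; first by rewrite mul1mx.
  by rewrite -!mulmxA IH refl_hyp_mid // mulmxN refl_hyp_mid // opprK.
apply: basis_fun_eq => [b i|sB]; rewrite diagE.
  by rewrite signed ?enum_uniq // mem_enum.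
by rewrite midE // dmid // scale1r.
Qed.

End SpinGroup.

(** * Regular square roots of the determinants of size n *)

Section SquareRoots.
Variables (C : numClosedFieldType) (s : series) (n : nat) (top : signs n).
Hypotheses (sBD : s = serB \/ s = serD) (n_gt0 : (0 < n)%N).
Local Notation N := (Defs.dim s n).
Local Notation Om := (Omega C s n).
Local Notation cl := (clifford Om).
Local Notation cp := (clifford_prod Om).
Local Notation e_ := (@basis_vec C N).
Local Notation sp := (@signed_pos s n).
Local Notation Spin := (spin_group Om).
Local Notation tau := (@tau C N (top_seq s top)).
Local Notation sw := (spin_word C top sBD n_gt0).
Local Notation evs := (even_signs C top sBD n_gt0).
Implicit Types (X Y : Spin) (f : signs n).
Let OmE := @OmegaBD C s n sBD.

Definition spinor f X : C := tau ((val X).1 *m cp (sw f)).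

Lemma spinor_regular f : Defs.regular (spinor f).
Proof.
set r := enum_rank (yset (top_seq s top)).
have -> : spinor f = fun X => \sum_c (val X).1 r c * cp (sw f) c r.
  by apply/funext=> X; rewrite /spinor /tau mxE.
apply: regular_sum => c; apply: regularM; [exact: regular_coord|exact: regular_cst].
Qed.

(** This is [tau_sqr] at the product of [X] with the Weyl representative, which permutes the columns
    up to sign; [b] collects these signs and those of sorting the rows and columns. *)
Lemma spinor_sqr f : evs f -> exists b : bool, forall X,
  spinor f X ^+ 2 =
  (-1) ^+ b * minor (sign_set s top) (sign_set s f) (covering X).
Proof.
move=> ev; pose w := word_spin OmE (@spin_word_unit _ _ _ top sBD n_gt0 f) ev.
have [a aE] := choice (spin_word_cover C top sBD n_gt0 f).
have inj g : injective (fun i => sp (g i) i).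
  by move=> i j /(signed_pos_inj (serBD_neqA sBD))[].
have [b bE] := minor_imset_sign C (Ordinal (mid_lt sBD n_gt0)) (inj top) (inj f).
exists (odd (\sum_j a j) (+) b) => X; rewrite !sign_set_imset; try exact: serBD_neqA.
rewrite bE signr_addb -mulrA signrMK.
have := tau_sqr top sBD n_gt0 (X * w)%g; rewrite /covering /= -/(spinor f X) => ->.
set g := (val X).2; rewrite signr_odd.
have -> : (\matrix_(l, j) (g *m cover Om (sw f)) (sp (top l) l) (sp (top j) j)) =
    (\matrix_(l, j) g (sp (top l) l) (sp (f j) j)) *m
    diag_mx (\row_j (-1) ^+ a j).
  apply/matrixP=> l j; rewrite mul_mx_diag [LHS]mxE [RHS]mxE.
  rewrite [X in _ = X * _]mxE [X in _ = _ * X]mxE.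
  have := aE j (top j); rewrite (_ : _ (+) _ = f j); last first.
    by case: (top j) (f j) => [] [].
  move=> /(congr1 (mulmx g))/(congr1 (fun v : 'cV_N => v (sp (top l) l) 0)).
  have colEE (A : 'M[C]_N) p q : (A *m e_ p) q 0 = A q p by rewrite -colE mxE.
  by rewrite mulmxA colEE -scalemxAr [X in _ = X -> _]mxE colEE => ->; rewrite mulrC.
rewrite det_mulmx det_diag mulrC; congr (_ * _).
by rewrite -prodrXr; apply: eq_bigr => j _; rewrite mxE.
Qed.

(** A negative sign is corrected by the factor ['i]. Being unimodular, [k] drops out of the terms of
    the kernel. *)
Lemma spinor_sqrt f : exists k : C, k * Num.conj k = 1 /\ (evs f -> forall X,
  (k * spinor f X) ^+ 2 = minor (sign_set s top) (sign_set s f) (covering X)).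
Proof.
have [ev|nev] := boolP (evs f); last by exists 1; rewrite mul1r rmorph1.
have [b bE] := spinor_sqr ev; exists (if b then 'i else 1); split=> [|_ X].
  by case: b {bE}; rewrite ?conjCi ?mulrN -?expr2 ?sqrCi ?opprK // mul1r rmorph1.
rewrite exprMn bE mulrA; case: b {bE}; last by rewrite expr1n !mul1r.
by rewrite sqrCi expr1 mulrNN !mul1r.
Qed.

Lemma spinor_top X : spinor top X = tau (val X).1.
Proof.
rewrite /spinor; have -> : sw top = [::].
  rewrite /spin_word (_ : diff_signs top top = [::]) //.
  by rewrite /diff_signs -(filter_pred0 (enum 'I_n)); apply: eq_filter => i /=; rewrite eqxx.
by rewrite mulmx1.
Qed.

Lemma even_signs_top : evs top.
Proof.
rewrite /even_signs /spin_word (_ : diff_signs top top = [::]) //.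
by rewrite /diff_signs -(filter_pred0 (enum 'I_n)); apply: eq_filter => i /=; rewrite eqxx.
Qed.

Lemma spinor_kernel X Y : spinor top (X * spin_star sBD Y)%g =
  \sum_(f | evs f) spinor f X * Num.conj (spinor f Y).
Proof.
rewrite spinor_top /= /spinor.
have [_ [vs [ev _ ->]] _] := spinP X; have [_ [ws [ew _ ->]] _] := spinP Y.
exact: tau_kernel.
Qed.

Definition spinor_roots (t : signs n -> Spin -> C) := forall f, evs f ->
  is_sqrt (fun X => minor (sign_set s top) (sign_set s f) (covering X)) (t f).

Lemma spinor_roots_exist : exists t, spinor_roots t.
Proof.
have [k kE] := choice spinor_sqrt; exists (fun f X => k f * spinor f X) => f ev; split.
  by apply: regularM; [exact: regular_cst | exact: spinor_regular].
by move=> X; case: (kE f) => _ ->.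
Qed.

Variable t : signs n -> Spin -> C.
Hypothesis tP : spinor_roots t.

Lemma signed_rev_neq b i : rev_ord (sp b i) != sp b i.
Proof. by rewrite eq_sym signed_neq_rev ?eqxx. Qed.
Let rev_neq := signed_rev_neq true (Ordinal n_gt0).

(** Each root is a unimodular multiple of the corresponding spinor function. The factors cancel in
    every term on the right, and [c] is the one belonging to [top]. *)
Lemma roots_kernel : exists c, c != 0 /\ forall X Y,
  t top (X * spin_star sBD Y)%g = c * \sum_(f | evs f) t f X * Num.conj (t f Y).
Proof.
have [k kE] := choice spinor_sqrt.
have tE f : evs f -> exists l, l * Num.conj l = 1 /\ forall X, t f X = l * spinor f X.
  move=> ev; have [kk ksq] := kE f; have [rt tsq] := tP ev.
  have rk : Defs.regular (fun X => k f * spinor f X).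
    by apply: regularM; [exact: regular_cst | exact: spinor_regular].
  have [X|b bE] := regular_sqr OmE rev_neq rt rk; first by rewrite tsq ksq.
  exists ((-1) ^+ b * k f); split=> [|X]; last by rewrite bE mulrA.
  by rewrite rmorphM rmorphXn rmorphN rmorph1 mulrACA kk -signr_addb addbb mulr1.
have [l [ll lE]] := tE top even_signs_top; exists l; split.
  by apply/eqP => l0; move/eqP: ll; rewrite l0 mul0r eq_sym oner_eq0.
move=> X Y; rewrite lE spinor_kernel; congr (_ * _); apply: eq_bigr => f ev.
have [l' [ll' lE']] := tE f ev.
by rewrite !lE' rmorphM mulrACA ll' mul1r.
Qed.

(** The shift multiplies the square of the root by the weight, hence the root by one of the two
    square roots of it. Which one depends on the lift [T], so only the square of [nu f] is
    recorded. *)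
Lemma roots_diag T (d : 'rV[C]_N) : covering T = diag_mx d ->
  exists nu : signs n -> C, forall f, nu f ^+ 2 = weight d (sign_set s f) /\
  (evs f -> forall X, t f (X * T)%g = nu f * t f X).
Proof.
move=> Td; suff nuP f : exists r, r ^+ 2 = weight d (sign_set s f) /\
    (evs f -> forall X, t f (X * T)%g = r * t f X).
  by have [nu nuE] := choice nuP; exists nu.
set r := sqrtC (weight d (sign_set s f)).
have [ev|nev] := boolP (evs f); last by exists r; rewrite sqrtCK.
have [rt tsq] := tP ev.
have rr : Defs.regular (fun X => r * t f X).
  by apply: regularM; first exact: regular_cst.
have [X|b bE] := regular_sqr OmE rev_neq (regular_shift T rt) rr.
  rewrite /right_shift tsq exprMn tsq sqrtCK /covering /= -/(covering T) Td.
  rewrite (minor_diag_mx (Ordinal (mid_lt sBD n_gt0))) // !card_sign_set //; exact: serBD_neqA.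
exists ((-1) ^+ b * r); split=> [|_ X]; last by rewrite -mulrA -bE.
by rewrite exprMn sqrr_sign mul1r sqrtCK.
Qed.

Lemma sign_set_inj f1 f2 : sign_set s f1 = sign_set s f2 -> f1 = f2.
Proof.
rewrite !sign_set_imset; try exact: serBD_neqA.
move=> e; apply/ffunP=> i; have : sp (f1 i) i \in [set sp (f2 j) j | j : 'I_n].
  by rewrite -e; apply/imsetP; exists i.
by case/imsetP=> j _ /(signed_pos_inj (serBD_neqA sBD))[-> ->].
Qed.

Lemma roots1 f : evs f -> (t f 1%g == 0) = (f != top).
Proof.
move=> ev; have [_ tsq] := tP ev; rewrite -sqrf_eq0 tsq /covering /=.
rewrite (minor1 _ (Ordinal (mid_lt sBD n_gt0))); last first.
  by rewrite !card_sign_set //; exact: serBD_neqA.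
rewrite pnatr_eq0 eqb0; congr (~~ _).
by apply/eqP/eqP => [/sign_set_inj|->].
Qed.

End SquareRoots.

Lemma sum_pair (V : nmodType) (I J : finType) (F : I * J -> V) :
  \sum_i F i = \sum_i \sum_j F (i, j).
Proof. by rewrite pair_bigA; apply: eq_bigr => -[]. Qed.

Section HalfInteger.
Variables (C : numClosedFieldType) (s : series) (n : nat) (m : nat -> rat).
Hypotheses (sBD : s = serB \/ s = serD) (n_gt0 : (0 < n)%N).
Hypotheses (m_dom : dominant s n m) (m_half : half_integer_weight n m).
Local Notation N := (Defs.dim s n).
Local Notation Om := (Omega C s n).
Local Notation Spin := (spin_group Om).
Local Notation b := (neg_weight s m).
Local Notation top := (top_signs s n m).
Local Notation evs := (even_signs C top sBD n_gt0).
Implicit Types (X Y : Spin) (f : signs n).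

Lemma minuses_top : minuses top = if b then n.-1 else n.
Proof.
rewrite /minuses; case: ifP => neg.
  rewrite -[in RHS](card_ord n) -(cardsC1 (Ordinal n_gt0)); apply: eq_card => i.
  by rewrite !inE ffunE neg.
rewrite -[RHS](card_ord n) -cardsT; apply: eq_card => i.
by rewrite !inE ffunE neg.
Qed.

Lemma odd_diff_signs f g : odd (size (diff_signs f g)) = odd (minuses f) (+) odd (minuses g).
Proof.
have odd_card h : odd (minuses h) = \big[addb/false]_(i < n) h i.
  rewrite /minuses -sum1_card big_mkcond (big_morph odd oddD (erefl _)).
  by apply: eq_bigr => i _; rewrite inE; case: (h i).
rewrite !odd_card -big_split size_filter -sum1_count big_mkcond.
rewrite [LHS](big_morph odd oddD (erefl _)) [RHS]/= [index_enum _]unlock -enumT.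
by apply: eq_bigr => i _ /=; case: (f i) (g i) => [] [].
Qed.

(** In series B the factor e_0 makes every representative even. In series D the number of signs
    differing from the top ones has the parity of the sum of the two numbers of minus signs. *)
Lemma even_allowed f : evs f = allowed_signs s m f.
Proof.
have [sE|sE] := sBD.
  have -> : allowed_signs s m f = true by rewrite /allowed_signs sE.
  by apply: contraT => /odd_signs_serD sD; have := sE; rewrite sD.
have -> : allowed_signs s m f = (odd (minuses f) == odd (minuses top)).
  by rewrite minuses_top /allowed_signs sE.
rewrite /even_signs size_cat size_map.
have -> : (if s is serB then true else false) = false by apply/negP => /serBP; rewrite sE.
rewrite andbF addn0 odd_diff_signs.
by case: (odd _) (odd _) => [] [].
Qed.

Lemma pdet_sign_set f g : pdet b (sign_set s f) g =
  minor (sign_set s top) (sign_set s f) g :> C.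
Proof. by rewrite (pdet_minor _ _ (card_sign_set f (serBD_neqA sBD))) sign_set_top. Qed.

Lemma sqrt_familyP (t : signs n -> Spin -> C) : sqrt_family m t <-> spinor_roots top sBD n_gt0 t.
Proof.
have eqf f : (fun X : Spin => pdet b (sign_set s f) (covering X)) =
    fun X => minor (sign_set s top) (sign_set s f) (covering X).
  by apply/funext=> X; rewrite pdet_sign_set.
by split=> H f; [rewrite even_allowed => /H; rewrite eqf | rewrite -even_allowed eqf => /H].
Qed.

Lemma sqrt_family_exists : exists t, @sqrt_family C s n m t.
Proof.
by have [t tP] := spinor_roots_exist C top sBD n_gt0; exists t; apply/sqrt_familyP.
Qed.

(** The power 2 T + 1 of the root in the highest vector is the root times the power [T] of the
    determinant. *)
Lemma half_top : exists T : nat, T%:R = `|m 1%N| - 2^-1 /\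
  Num.truncn (2 * `|m 1%N|) = (2 * T).+1.
Proof.
have : `|m 1%N| - 2^-1 \is a Num.int.
  have m1 : m 1%N - 2^-1 \is a Num.int by apply: m_half; lia.
  case: ger0P => // _; rewrite (_ : _ - _ = - (m 1%N - 2^-1) - 1); last by field.
  by rewrite rpredB ?rpredN ?rpred1.
case/intrP=> -[] k kE; last first.
  have k0 : 0 <= k%:R :> rat by [].
  have := normr_ge0 (m 1%N); rewrite -(subrK 2^-1 `|m 1%N|) kE NegzE mulrNz -pmulrn (mulrSr 1 k).
  by move=> k1; exfalso; lra.
exists k; split; first by rewrite kE.
have -> : 2 * `|m 1%N| = (2 * k).+1%:R.
  rewrite -(subrK 2^-1 `|m 1%N|) kE -pmulrn (mulrSr 1 (2 * k)%N) natrM; by field.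
by rewrite natrK.
Qed.

Section Family.
Variable t : signs n -> Spin -> C.
Hypothesis tP : sqrt_family m t.

Lemma half_integer_irreducible :
  irreducible (generated (spin_highest_vector m t)) /\
  generated (spin_highest_vector m t) = half_integer_functions m t.
Proof.
have rootsP : spinor_roots top sBD n_gt0 t by apply/sqrt_familyP.
have [T [Ttop T2]] := half_top.
pose ks := det_sizes n m T; pose x0 := Ordinal (dim_gt0 s n_gt0).
pose phi0 := top_index s n b ks.
have cks k : k \in ks -> #|top_rows s n b k| = k.
  by move=> /det_sizes_bound; exact: card_top_rows.
(* Forbidden signs are kept as indices of the zero function, since nothing is known about [t]
   there. *)
pose M (i : signs n * {ffun 'I_(size ks) -> {set 'I_N}}) X : C :=
  if allowed_signs s m i.1 then t i.1 X * det_product b i.2 (covering X) else 0.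
pose i0 := (top, phi0).
have allowed_top : allowed_signs s m top by rewrite -even_allowed even_signs_top.
have -> : spin_highest_vector m t = M i0.
  apply/funext=> X; rewrite /spin_highest_vector T2 exprS exprM.
  have [_ ->] := tP allowed_top; rewrite /M allowed_top mulrCA.
  by rewrite highest_product.
have [c [c0 tker]] := roots_kernel rootsP.
have kernel X Y : M i0 (X * spin_star sBD Y)%g = c * \sum_i M i X * Num.conj (M i Y).
  rewrite /M /= allowed_top tker [covering _]/= -/(covering X) -/(covering Y).
  rewrite det_product_kernel // -mulrA; congr (_ * _).
  rewrite big_distrlr sum_pair /=.
  rewrite [RHS](bigID evs) /= [X in _ = _ + X]big1 ?addr0 => [|f nf]; last first.
    by rewrite big1 // => phi _; rewrite /M /= -even_allowed (negbTE nf) mul0r.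
  apply: eq_bigr => f ef; apply: eq_bigr => phi _.
  by rewrite /M /= -even_allowed ef rmorphM mulrACA.
pose d := torus_row C s n m.
have d_gt0 p : 0 < d 0 p by exact: torus_gt0.
have [|||Tor TorE] := @spin_diag C s n sBD n_gt0 d.
- by move=> p; rewrite lt0r_neq0.
- by move=> p; apply: torus_rev; exact: serBD_neqA.
- move=> sB; rewrite mxE /torus_exp label_mid // andbF oppr0 expr0z.
  exact: rmorph1.
have [nu nuE] := roots_diag rootsP TorE.
have th k : k \in ks -> exists theta, [/\ 0 < theta,
    forall p, p \in top_rows s n b k -> theta <= d 0 p
  & forall p, p \notin top_rows s n b k -> d 0 p < theta].
  by move=> /det_sizes_bound; exact: torus_threshold.
split; last first.
  rewrite (lin_span_generated c0 (@spin_starK C s n sBD) kernel).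
  have dP F := det_polynomial_sizes n_gt0 m_dom (@covering _ _ Om) F (or_intror m_half) Ttop.
  apply/seteqP; split=> F.
    case=> x FE; exists (fun f X => \sum_phi x (f, phi) * det_product b phi (covering X)).
    split=> [f|X]; first by apply/dP; exists (fun phi => x (f, phi)).
    rewrite FE sum_pair /=.
    rewrite [RHS]big_mkcond; apply: eq_bigr => f _; rewrite /M /=.
    case: ifP => _; last by rewrite big1 // => phi _; rewrite mulr0.
    by rewrite mulr_sumr; apply: eq_bigr => phi _; rewrite mulrCA.
  case=> G [GP FE]; have [x xE] := choice (fun f => (dP (G f)).1 (GP f)).
  exists (fun i => x i.1 i.2) => X.
  rewrite FE sum_pair /=.
  rewrite [LHS]big_mkcond; apply: eq_bigr => f _; rewrite /M /=.
  case: ifP => _; last by rewrite big1 // => phi _; rewrite mulr0.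
  by rewrite xE mulr_sumr; apply: eq_bigr => phi _; rewrite mulrCA.
apply: (reproducing_irreducible c0 (@spin_starK C s n sBD) kernel
  (t := Tor) (mu := fun i => nu i.1 * product_weight d i.2)) => [i|||].
- rewrite /M; case: ifP => // al neq; move: al; rewrite -even_allowed => ev.
  have [e1|ne1] := eqVneq i.1 top; last first.
    by move: (roots1 rootsP ev); rewrite ne1 => /eqP ->; rewrite mul0r.
  rewrite /covering /= (det_product1 C x0 cks) (_ : i.2 == phi0 = false) ?mulr0 //.
  by apply: contraNF neq => /eqP e2; rewrite (surjective_pairing i) e1 e2.
- rewrite /M allowed_top /covering /= (det_product1 C x0 cks) eqxx mulr1.
  by rewrite (roots1 rootsP) ?eqxx // even_allowed.
- move=> i X; rewrite /M; case: ifP => al; last by rewrite mulr0.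
  have [_ ->] := nuE i.1; last by rewrite even_allowed.
  have -> : covering (X * Tor)%g = covering X *m diag_mx d by rewrite -TorE.
  by rewrite (det_product_diag x0 cks) mulrACA.
(* Eigenvalues are compared through their squares because [nu] is known only up to sign; the squares
   are products of positive weights, and [nuE] gives them for forbidden signs as well. *)
move=> [f phi] neq /=; apply/eqP => /(congr1 (fun z => z ^+ 2)).
rewrite !exprMn ((nuE f).1) ((nuE top).1); apply/eqP; rewrite lt_eqF //.
have wt_top : forall f', f' != top -> weight d (sign_set s f') < weight d (sign_set s top).
  move=> f' neq'; have [|theta [th0 th1 th2]] := @torus_threshold C s n m n; first by lia.
  apply: (prod_subset_lt (theta := theta)) => //.
  - by rewrite sign_set_top.
  - by rewrite sign_set_top.
  - by rewrite !card_sign_set //; exact: serBD_neqA.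
  - by apply: contraNN neq' => /eqP/(sign_set_inj sBD) ->.
have pw_ge0 phi' : 0 <= product_weight d phi'.
  rewrite /product_weight; case: ifP => // _; apply: prodr_ge0 => j _.
  by rewrite ltW // weight_gt0.
have pw0 : 0 < product_weight d phi0.
  rewrite /product_weight top_admissible //; apply: prodr_gt0 => j _.
  exact: weight_gt0.
have pw_lt phi' : phi' != phi0 -> product_weight d phi' < product_weight d phi0.
  exact: (product_weight_lt cks d_gt0 th).
have [fE|nf] := eqVneq f top.
  have nphi : phi != phi0 by apply: contraNN neq => /eqP ->; rewrite fE.
  rewrite fE ltr_pM2l ?weight_gt0 //.
  by rewrite ltr_pXn2r // ?nnegrE ?pw_ge0 ?ltW // pw_lt.
have wf := wt_top _ nf.
apply: (@le_lt_trans _ _ (weight d (sign_set s f) * product_weight d phi0 ^+ 2)).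
  rewrite ler_pM2l ?weight_gt0 // lerXn2r // ?nnegrE ?pw_ge0 //.
  by have [->//|/pw_lt/ltW] := eqVneq phi phi0.
by rewrite ltr_pM2r // exprn_gt0.
Qed.

End Family.
End HalfInteger.

Theorem theorem3 (R : realType) (s : series) (n : nat) (m : nat -> rat)
    (n_gt0 : (0 < n)%N) (m_dominant : dominant s n m) :
  (integer_weight n m ->
     irreducible (generated (@highest_vector R[i] s n m)) /\
     generated (@highest_vector R[i] s n m) = @integer_functions R[i] s n m) /\
  (s = serB \/ s = serD -> half_integer_weight n m ->
     (exists t, @sqrt_family R[i] s n m t) /\
     forall t, @sqrt_family R[i] s n m t ->
       irreducible (generated (@spin_highest_vector R[i] s n m t)) /\
       generated (@spin_highest_vector R[i] s n m t)
         = @half_integer_functions R[i] s n m t).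
Proof.
split=> [m_int|sBD m_half]; first exact: (@integer_weight_irreducible R[i]).
split=> [|t tP]; first exact: (@sqrt_family_exists R[i]).
exact: (@half_integer_irreducible R[i] s n m sBD n_gt0 m_dominant m_half t tP).
Qed.
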